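(* The theory $\mathsf{BIM}$ proves: $$\mathbf{FT}\leftrightarrow \mathbf{\Sigma}^0_1\text{-}\overleftarrow{\mathbf{AC}_{\omega,<\omega}}\qquad\text{and}\qquad \neg!\mathbf{FT}\leftrightarrow \neg!(\mathbf{\Sigma}^0_1\text{-}\overleftarrow{\mathbf{AC}_{\omega,<\omega}}).$$ Here $\mathbf{FT}$ is $\forall \alpha[Bar_{2^\omega}(D_\alpha)\rightarrow\exists m[Bar_{2^\omega}(D_{\overline\alpha m})]]$; $\neg!\mathbf{FT}$ is $\exists\alpha[Bar_{2^\omega}(D_\alpha)\wedge\forall m[\neg Bar_{2^\omega}(D_{\overline\alpha m})]]$; $\mathbf{\Sigma}^0_1\text{-}\overleftarrow{\mathbf{AC}_{\omega,<\omega}}$ is $$\forall\alpha[\forall\gamma\exists n[\gamma(n)\le\alpha^{\upharpoonright0}(n)\rightarrow(n,\gamma(n))\in E_{\alpha^{\upharpoonright1}}]\rightarrow\exists n\forall i\le\alpha^{\upharpoonright0}(n)[(n,i)\in E_{\alpha^{\upharpoonright1}}]];$$ and $\neg!(\mathbf{\Sigma}^0_1\text{-}\overleftarrow{\mathbf{AC}_{\omega,<\omega}})$ is $$\exists\alpha[\forall\gamma\exists n[\gamma(n)\le\alpha^{\upharpoonright0}(n)\rightarrow(n,\gamma(n))\in E_{\alpha^{\upharpoonright1}}]\wedge\neg\exists n\forall i\le\alpha^{\upharpoonright0}(n)[(n,i)\in E_{\alpha^{\upharpoonright1}}]].$$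
   Context: $\mathsf{BIM}$ (Basic Intuitionistic Mathematics) is the following two-sorted first-order theory with intuitionistic logic and equality. Numerical variables $m,n,p,\ldots$ range over $\omega=\{0,1,2,\ldots\}$; function variables $\alpha,\beta,\gamma,\ldots$ range over the set $\omega^\omega$ of infinite sequences of natural numbers. There are a numerical constant $0$, unary function constants $Id,\underline 0,S,K,L$ and a binary function symbol $J$; numerical terms are built from numerical variables and $0$ by applying function symbols and function variables. Axioms: (1) $\forall\alpha\forall\beta[\alpha=\beta\leftrightarrow\forall n[\alpha(n)=\beta(n)]]$; (2) $Id(n)=n$, $S(n)\neq 0$, $S(m)=S(n)\rightarrow m=n$, $\underline 0(n)=0$, $K(J(m,n))=m$, $L(J(m,n))=n$, $J(K(n),L(n))=n$; (3) $\forall\alpha\forall\beta\exists\gamma\forall n[\gamma(n)=\alpha(\beta(n))]$, $\forall\alpha\forall\beta\exists\gamma\forall n[\gamma(n)=J(\alpha(n),\beta(n))]$, $\forall\alpha\forall\beta\exists\gamma\forall m\forall n[\gamma(m,0)=\alpha(m)\wedge\gamma(m,S(n))=\beta(m,n,\gamma(m,n))]$, $\forall\alpha[\forall n\exists m[\alpha(n,m)=0]\rightarrow\exists\gamma\forall n[\alpha(n,\gamma(n))=0]]$; (4) induction for all formulas of the language. Here $(m,n):=J(m,n)$, $\alpha(m,n):=\alpha(J(m,n))$, $\alpha(m,n,p):=\alpha(J(J(m,n),p))$, $n':=K(n)$, $n'':=L(n)$. $\mathsf{BIM}$ is tacitly extended (conservatively) by symbols and defining equations for all primitive recursive functions and relations.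 Subsets of $\omega$ and $\omega^\omega$ are given by formulas; set notation is an abbreviation. Finite sequences are coded by natural numbers: $\langle\,\rangle=0$, $\langle m_0,\ldots,m_{k-1}\rangle=p(k-1)\cdot\prod_{i<k}p(i)^{m_i}-1$ for $k>0$ ($p(0)=2,p(1)=3,\ldots$ the primes); every number codes exactly one finite sequence. $length(s)$ is the length of the sequence coded by $s$ and $s(i)$ its $i$-th entry ($s(i)=0$ if $i\ge length(s)$); $s\ast t$ is concatenation. $\overline\alpha n=\langle\alpha(0),\ldots,\alpha(n-1)\rangle$. $2^\omega=\{\gamma\mid\forall n[\gamma(n)<2]\}$. $\alpha^{\upharpoonright n}$ is the sequence with $\alpha^{\upharpoonright n}(m)=\alpha(\langle n\rangle\ast m)$ for all $m$. $D_\alpha=\{i\mid\alpha(i)\neq0\}$; for a number $a$, $D_a=\{i<length(a)\mid a(i)\neq0\}$. $E_\alpha=\{n\mid\exists p[\alpha(p)=n+1]\}$. For $\mathcal X\subseteq\omega^\omega$, $B\subseteq\omega$: $Bar_{\mathcal X}(B)$ means $\forall\gamma\in\mathcal X\exists n[\overline\gamma n\in B]$. *)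

(* Defs.v *)
(* BIM is embedded deeply: terms, formulas and intuitionistic derivations are
   inductive objects, so that "BIM proves F" is a statement about derivations. *)
From Stdlib Require Import List.
From Stdlib Require Vector Fin.
Set Implicit Arguments.

Local Notation "[| |]" := (@Vector.nil _).
Local Notation "[| x |]" := (Vector.cons _ x _ (Vector.nil _)).
Local Notation "[| x ; .. ; y |]" :=
  (Vector.cons _ x _ .. (Vector.cons _ y _ (Vector.nil _)) ..).
Local Notation "x ::: v" := (Vector.cons _ x _ v)
  (at level 60, right associativity).

(** * Primitive recursive function symbols *)

(* [pRec g h] is the function f with f(0,x) = g(x), f(k+1,x) = h(k,f(k,x),x). *)
Inductive prf : nat -> Type :=
| pZero : forall n, prf n
| pSucc : prf 1
| pProj : forall n, Fin.t n -> prf n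
| pComp : forall m n, prf m -> Vector.t (prf n) m -> prf n
| pRec  : forall n, prf n -> prf (S (S n)) -> prf (S n).
Arguments pZero {n}.
Arguments pComp {m n} f gs.
Arguments pRec {n} g h.

Definition arg0 {n} : prf (S n) := pProj Fin.F1.
Definition arg1 {n} : prf (S (S n)) := pProj (Fin.FS Fin.F1).
Definition arg2 {n} : prf (S (S (S n))) := pProj (Fin.FS (Fin.FS Fin.F1)).
Definition arg3 {n} : prf (S (S (S (S n)))) :=
  pProj (Fin.FS (Fin.FS (Fin.FS Fin.F1))).

Definition C1 {n} (f : prf 1) (g : prf n) : prf n := pComp f [| g |].
Definition C2 {n} (f : prf 2) (g h : prf n) : prf n := pComp f [| g ; h |].
Definition C3 {n} (f : prf 3) (g h k : prf n) : prf n :=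
  pComp f [| g ; h ; k |].

Definition pOne {n} : prf n := C1 pSucc pZero.
Definition pTwo {n} : prf n := C1 pSucc pOne.
Definition pAdd : prf 2 := pRec arg0 (C1 pSucc arg1).
Definition pMul : prf 2 := pRec pZero (C2 pAdd arg1 arg2).
(* (b, e) |-> b ^ e *)
Definition pPow : prf 2 := C2 (pRec pOne (C2 pMul arg1 arg2)) arg1 arg0.
Definition pFact : prf 1 := pRec pOne (C2 pMul (C1 pSucc arg0) arg1).
Definition pPred : prf 1 := pRec pZero arg0.
(* (a, b) |-> a - b, truncated *)
Definition pSub : prf 2 := C2 (pRec arg0 (C1 pPred arg1)) arg1 arg0.
(* 0 if the arguments are equal, positive otherwise *)
Definition pDist : prf 2 := C2 pAdd (C2 pSub arg0 arg1) (C2 pSub arg1 arg0).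
(* 0 |-> 0, k+1 |-> 1 *)
Definition pSg : prf 1 := pRec pZero pOne.
(* 0 |-> 1, k+1 |-> 0 *)
Definition pNot : prf 1 := pRec pOne pZero.
(* (c, a, b) |-> a if c = 0, b otherwise *)
Definition pIf : prf 3 := pRec arg0 arg3.

Fixpoint fins (n : nat) : Vector.t (Fin.t n) n :=
  match n with
  | 0 => [| |]
  | S m => Fin.F1 ::: Vector.map Fin.FS (fins m)
  end.
Definition drop2 {n} : Vector.t (prf (S (S n))) n :=
  Vector.map (fun i => pProj (Fin.FS (Fin.FS i))) (fins n).

(* (b, x) |-> the least i < b with f(i,x) = 0, and b if there is none:
   the candidate r is kept when f(r,x) = 0 and incremented otherwise *)
Definition pMu {n} (f : prf (S n)) : prf (S n) :=
  pRec pZero (C2 pAdd arg1 (C1 pSg (pComp f (arg1 ::: drop2)))).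
(* (b, x) |-> the product of the f(i,x), i < b *)
Definition pProd {n} (f : prf (S n)) : prf (S n) :=
  pRec pOne (C2 pMul arg1 (pComp f (arg0 ::: drop2))).

(* (a, d) |-> a mod d *)
Definition pRem : prf 2 :=
  pRec pZero (C3 pIf (C2 pDist (C1 pSucc arg1) arg2) pZero (C1 pSucc arg1)).
(* n |-> 2 + the least i < n such that i+2 divides n (2 + n if none) *)
Definition pLeastFactor : prf 1 :=
  C1 pSucc (C1 pSucc (C2 (pMu (C2 pRem arg1 (C1 pSucc (C1 pSucc arg0)))) arg0 arg0)).
(* 0 iff the argument is prime *)
Definition pNonPrime : prf 1 := C2 pDist pLeastFactor arg0.
(* the least prime > n, which is at most n! + 1 *)
Definition pNextPrime : prf 1 :=
  C2 pAdd (C1 pSucc arg0)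
     (C2 (pMu (C1 pNonPrime (C2 pAdd (C1 pSucc arg1) arg0)))
         (C1 pSucc (C1 pFact arg0)) arg0).
(* p(0) = 2, p(1) = 3, ... *)
Definition pPrime : prf 1 := pRec pTwo (C1 pNextPrime arg1).
(* (d, n) |-> the exponent of d in n, i.e. the least e with d^(e+1) not
   dividing n; the bound n is large enough for n > 0, d > 1 *)
Definition pExpo : prf 2 :=
  C3 (pMu (C1 pNot (C2 pRem arg2 (C2 pPow arg1 (C1 pSucc arg0))))) arg1 arg0 arg1.

(** Coding of finite sequences:
    <> = 0, <m_0,...,m_{k-1}> = p(k-1) * prod_{i<k} p(i)^{m_i} - 1. *)

(* (b, s) |-> 1 + the largest i < b with p(i) dividing s+1, 0 if none *)
Definition pLengthUpto : prf 2 :=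
  pRec pZero
    (C3 pIf (C2 pRem (C1 pSucc arg2) (C1 pPrime arg0)) (C1 pSucc arg0) arg1).
Definition pLength : prf 1 := C2 pLengthUpto (C1 pSucc arg0) arg0.
(* (s, i) |-> s(i): the exponent of p(i) in s+1, less 1 if i = length(s) - 1 *)
Definition pEntry : prf 2 :=
  C2 pSub (C2 pExpo (C1 pPrime arg1) (C1 pSucc arg0))
          (C1 pNot (C2 pDist (C1 pSucc arg1) (C1 pLength arg0))).
(* (k, x) |-> the code of < f(0,x), ..., f(k-1,x) > *)
Definition pCode {n} (f : prf (S n)) : prf (S n) :=
  C3 pIf arg0 pZero
     (C1 pPred (C2 pMul (C1 pPrime (C1 pPred arg0))
                        (pProd (C2 pPow (C1 pPrime arg0) f)))).
(* n |-> <n> *)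
Definition pSingle : prf 1 := C2 (pCode arg1) pOne arg0.
(* (s, t) |-> s * t; the j-th entry is s(j) if j < length(s), and
   t(j - length(s)) otherwise *)
Definition pConcat : prf 2 :=
  C3 (pCode (C3 pIf (C2 pSub (C1 pSucc arg0) (C1 pLength arg1))
                    (C2 pEntry arg1 arg0)
                    (C2 pEntry arg2 (C2 pSub arg0 (C1 pLength arg1)))))
     (C2 pAdd (C1 pLength arg0) (C1 pLength arg1)) arg0 arg1.

(** * Terms and formulas *)

(* De Bruijn indices, with separate index spaces for the two sorts.  The unary
   primitive recursive symbols are function constants, just as Id, 0, S, K, L. *)
Inductive fterm : Type :=
| FVar : nat -> fterm
| FId | FZero | FSucc | FK | FL
| FPrf : prf 1 -> fterm.

Inductive term : Type :=
| Var : nat -> term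
| Zero : term
| App : fterm -> term -> term
| Pair : term -> term -> term
| Prf : forall n, prf n -> Vector.t term n -> term.

Inductive form : Type :=
| Bot : form
| Eq0 : term -> term -> form
| Eq1 : fterm -> fterm -> form
| And : form -> form -> form
| Or  : form -> form -> form
| Imp : form -> form -> form
| All0 : form -> form
| Ex0  : form -> form
| All1 : form -> form
| Ex1  : form -> form.

Definition subst_fterm (s1 : nat -> fterm) (f : fterm) : fterm :=
  match f with FVar k => s1 k | _ => f end.

Fixpoint subst_term (s0 : nat -> term) (s1 : nat -> fterm) (t : term) : term :=
  match t with
  | Var k => s0 k
  | Zero => Zero
  | App f u => App (subst_fterm s1 f) (subst_term s0 s1 u)
  | Pair u v => Pair (subst_term s0 s1 u) (subst_term s0 s1 v)
  | Prf f us => Prf f (Vector.map (subst_term s0 s1) us)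
  end.

Definition scons {A : Type} (a : A) (s : nat -> A) (k : nat) : A :=
  match k with 0 => a | S k' => s k' end.
Definition shift0_term : term -> term :=
  subst_term (fun k => Var (S k)) FVar.
Definition shift1_term : term -> term :=
  subst_term Var (fun k => FVar (S k)).
Definition shift1_fterm : fterm -> fterm :=
  subst_fterm (fun k => FVar (S k)).

Fixpoint subst (s0 : nat -> term) (s1 : nat -> fterm) (A : form) : form :=
  let under0 := subst (scons (Var 0) (fun k => shift0_term (s0 k))) s1 in
  let under1 := subst (fun k => shift1_term (s0 k))
                      (scons (FVar 0) (fun k => shift1_fterm (s1 k))) in
  match A with
  | Bot => Bot
  | Eq0 t u => Eq0 (subst_term s0 s1 t) (subst_term s0 s1 u)
  | Eq1 f g => Eq1 (subst_fterm s1 f) (subst_fterm s1 g)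
  | And B C => And (subst s0 s1 B) (subst s0 s1 C)
  | Or B C => Or (subst s0 s1 B) (subst s0 s1 C)
  | Imp B C => Imp (subst s0 s1 B) (subst s0 s1 C)
  | All0 B => All0 (under0 B)
  | Ex0 B => Ex0 (under0 B)
  | All1 B => All1 (under1 B)
  | Ex1 B => Ex1 (under1 B)
  end.

Definition shift0 : form -> form := subst (fun k => Var (S k)) FVar.
Definition shift1 : form -> form := subst Var (fun k => FVar (S k)).
Definition inst0 (t : term) : form -> form := subst (scons t Var) FVar.
Definition inst1 (f : fterm) : form -> form := subst Var (scons f FVar).

(** * Two-sorted intuitionistic natural deduction with equality *)

(* Members of [Ax] may have free variables, which are read universally: they
   are not affected by the side conditions of the quantifier rules. *)
Inductive prv (Ax : form -> Prop) : list form -> form -> Prop :=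
| prv_ax G A : Ax A -> prv Ax G A
| prv_hyp G A : In A G -> prv Ax G A
| prv_botE G A : prv Ax G Bot -> prv Ax G A
| prv_andI G A B : prv Ax G A -> prv Ax G B -> prv Ax G (And A B)
| prv_andE1 G A B : prv Ax G (And A B) -> prv Ax G A
| prv_andE2 G A B : prv Ax G (And A B) -> prv Ax G B
| prv_orI1 G A B : prv Ax G A -> prv Ax G (Or A B)
| prv_orI2 G A B : prv Ax G B -> prv Ax G (Or A B)
| prv_orE G A B C : prv Ax G (Or A B) -> prv Ax (A :: G) C ->
    prv Ax (B :: G) C -> prv Ax G C
| prv_impI G A B : prv Ax (A :: G) B -> prv Ax G (Imp A B)
| prv_impE G A B : prv Ax G (Imp A B) -> prv Ax G A -> prv Ax G B
| prv_all0I G A : prv Ax (map shift0 G) A -> prv Ax G (All0 A)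
| prv_all0E G A t : prv Ax G (All0 A) -> prv Ax G (inst0 t A)
| prv_ex0I G A t : prv Ax G (inst0 t A) -> prv Ax G (Ex0 A)
| prv_ex0E G A C : prv Ax G (Ex0 A) ->
    prv Ax (A :: map shift0 G) (shift0 C) -> prv Ax G C
| prv_all1I G A : prv Ax (map shift1 G) A -> prv Ax G (All1 A)
| prv_all1E G A f : prv Ax G (All1 A) -> prv Ax G (inst1 f A)
| prv_ex1I G A f : prv Ax G (inst1 f A) -> prv Ax G (Ex1 A)
| prv_ex1E G A C : prv Ax G (Ex1 A) ->
    prv Ax (A :: map shift1 G) (shift1 C) -> prv Ax G C
| prv_eq0_refl G t : prv Ax G (Eq0 t t)
| prv_eq0_subst G A t u : prv Ax G (Eq0 t u) ->
    prv Ax G (inst0 t A) -> prv Ax G (inst0 u A)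
| prv_eq1_refl G f : prv Ax G (Eq1 f f)
| prv_eq1_subst G A f g : prv Ax G (Eq1 f g) ->
    prv Ax G (inst1 f A) -> prv Ax G (inst1 g A).

(** * Formulas with named binders *)

(* An expression is given as a function of the numbers [i], [j] of numerical
   and function quantifiers in whose scope it occurs.  A variable bound at
   depth [i] has, at depth [i'] > [i], the de Bruijn index [i' - (i+1)]. *)
Definition tm := nat -> nat -> term.
Definition fn := nat -> nat -> fterm.
Definition fm := nat -> nat -> form.

Definition close (A : fm) : form := A 0 0.

Definition mkAll0 (A : tm -> fm) : fm :=
  fun i j => All0 (A (fun i' _ => Var (i' - S i)) (S i) j).
Definition mkEx0 (A : tm -> fm) : fm :=
  fun i j => Ex0 (A (fun i' _ => Var (i' - S i)) (S i) j).
Definition mkAll1 (A : fn -> fm) : fm :=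
  fun i j => All1 (A (fun _ j' => FVar (j' - S j)) i (S j)).
Definition mkEx1 (A : fn -> fm) : fm :=
  fun i j => Ex1 (A (fun _ j' => FVar (j' - S j)) i (S j)).

Definition mkEq0 (t u : tm) : fm := fun i j => Eq0 (t i j) (u i j).
Definition mkEq1 (f g : fn) : fm := fun i j => Eq1 (f i j) (g i j).
Definition mkBot : fm := fun _ _ => Bot.
Definition mkAnd (A B : fm) : fm := fun i j => And (A i j) (B i j).
Definition mkImp (A B : fm) : fm := fun i j => Imp (A i j) (B i j).

Definition mkApp (f : fn) (t : tm) : tm := fun i j => App (f i j) (t i j).
Definition pair_tm (t u : tm) : tm := fun i j => Pair (t i j) (u i j).
Definition zero_tm : tm := fun _ _ => Zero.
Definition cst (f : fterm) : fn := fun _ _ => f.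
Definition prf1 (f : prf 1) (t : tm) : tm := fun i j => Prf f [| t i j |].
Definition prf2 (f : prf 2) (t u : tm) : tm :=
  fun i j => Prf f [| t i j ; u i j |].

Declare Scope fm_scope.
Delimit Scope fm_scope with fm.
Bind Scope fm_scope with fm.

Notation "'all0' x , A" := (mkAll0 (fun x : tm => A%fm))
  (at level 200, x name, right associativity) : fm_scope.
Notation "'ex0' x , A" := (mkEx0 (fun x : tm => A%fm))
  (at level 200, x name, right associativity) : fm_scope.
Notation "'all1' x , A" := (mkAll1 (fun x : fn => A%fm))
  (at level 200, x name, right associativity) : fm_scope.
Notation "'ex1' x , A" := (mkEx1 (fun x : fn => A%fm))
  (at level 200, x name, right associativity) : fm_scope.
Notation "t = u" := (mkEq0 t u) : fm_scope.
Notation "f =1 g" := (mkEq1 f g) (at level 70, no associativity) : fm_scope.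
Notation "A /\ B" := (mkAnd A B) : fm_scope.
Notation "A --> B" := (mkImp A B)
  (at level 99, right associativity) : fm_scope.
Notation "~ A" := (mkImp A mkBot) : fm_scope.
Notation "t <> u" := (mkImp (mkEq0 t u) mkBot) : fm_scope.
Notation "A <--> B" := (mkAnd (mkImp A B) (mkImp B A))
  (at level 100, no associativity) : fm_scope.
Notation "f @ t" := (mkApp f t) (at level 30, right associativity) : fm_scope.

Local Open Scope fm_scope.

Definition suc_tm (t : tm) : tm := cst FSucc @ t.
(* alpha(t, u) and alpha(t, u, v) *)
Definition app2 (f : fn) (t u : tm) : tm := f @ pair_tm t u.
Definition app3 (f : fn) (t u v : tm) : tm := f @ pair_tm (pair_tm t u) v.

(** * The theory BIM *)

(* The defining equations of the primitive recursive symbols and the induction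
   schema are given by all their instances, with arbitrary terms as arguments
   and arbitrary free variables as parameters. *)
Inductive BIM_axiom : form -> Prop :=
| ax_ext : BIM_axiom (close
    (all1 a, all1 b, (a =1 b <--> all0 n, a @ n = b @ n)))
| ax_Id : BIM_axiom (close (all0 n, cst FId @ n = n))
| ax_S_neq_0 : BIM_axiom (close (all0 n, suc_tm n <> zero_tm))
| ax_S_inj : BIM_axiom (close
    (all0 m, all0 n, (suc_tm m = suc_tm n --> m = n)))
| ax_Zero : BIM_axiom (close (all0 n, cst FZero @ n = zero_tm))
| ax_K : BIM_axiom (close (all0 m, all0 n, cst FK @ pair_tm m n = m))
| ax_L : BIM_axiom (close (all0 m, all0 n, cst FL @ pair_tm m n = n))
| ax_J : BIM_axiom (close (all0 n, pair_tm (cst FK @ n) (cst FL @ n) = n))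
| ax_comp : BIM_axiom (close
    (all1 a, all1 b, ex1 c, all0 n, c @ n = a @ b @ n))
| ax_pair : BIM_axiom (close
    (all1 a, all1 b, ex1 c, all0 n, c @ n = pair_tm (a @ n) (b @ n)))
| ax_rec : BIM_axiom (close
    (all1 a, all1 b, ex1 c, all0 m, all0 n,
       (app2 c m zero_tm = a @ m /\
        app2 c m (suc_tm n) = app3 b m n (app2 c m n))))
| ax_choice : BIM_axiom (close
    (all1 a, ((all0 n, ex0 m, app2 a n m = zero_tm) -->
              ex1 c, all0 n, app2 a n (c @ n) = zero_tm)))
| ax_ind : forall A : form, BIM_axiom
    (Imp (And (inst0 Zero A)
              (All0 (Imp A
                 (subst (scons (App FSucc (Var 0)) (fun k => Var (S k)))
                        FVar A))))
         (All0 A))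
| ax_pZero : forall n (ts : Vector.t term n),
    BIM_axiom (Eq0 (Prf pZero ts) Zero)
| ax_pSucc : forall t, BIM_axiom (Eq0 (Prf pSucc [| t |]) (App FSucc t))
| ax_pProj : forall n (k : Fin.t n) ts,
    BIM_axiom (Eq0 (Prf (pProj k) ts) (Vector.nth ts k))
| ax_pComp : forall m n (f : prf m) (gs : Vector.t (prf n) m) ts,
    BIM_axiom (Eq0 (Prf (pComp f gs) ts)
                   (Prf f (Vector.map (fun g => Prf g ts) gs)))
| ax_pRec0 : forall n (g : prf n) h ts,
    BIM_axiom (Eq0 (Prf (pRec g h) (Zero ::: ts)) (Prf g ts))
| ax_pRecS : forall n (g : prf n) h t ts,
    BIM_axiom (Eq0 (Prf (pRec g h) (App FSucc t ::: ts))
                   (Prf h (t ::: Prf (pRec g h) (t ::: ts) ::: ts)))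
| ax_FPrf : forall (f : prf 1) t,
    BIM_axiom (Eq0 (App (FPrf f) t) (Prf f [| t |])).

Definition BIM_proves (A : fm) : Prop := prv BIM_axiom nil (close A).

(** * The fan theorem and the contraposed axiom of choice *)

(* Primitive recursive relations are given by their characteristic terms. *)
Definition le_fm (t u : tm) : fm := prf2 pSub t u = zero_tm.
Definition lt_fm (t u : tm) : fm := le_fm (suc_tm t) u.

Definition length_tm (s : tm) : tm := prf1 pLength s.
Definition entry_tm (s i : tm) : tm := prf2 pEntry s i.

(* "s codes the finite sequence <alpha(0), ..., alpha(n-1)>".  As every number
   codes exactly one finite sequence, a context B(alpha-bar n) is rendered as
   "there is s coding that sequence such that B(s)". *)
Definition codes_initial (a : fn) (n s : tm) : fm :=
  length_tm s = n /\ all0 i, (lt_fm i n --> entry_tm s i = a @ i).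
Definition with_initial (a : fn) (n : tm) (B : tm -> fm) : fm :=
  ex0 s, (codes_initial a n s /\ B s).

(* alpha^{|k}(m) = alpha(<k> * m) *)
Definition section (a : fn) (k m : tm) : tm :=
  a @ prf2 pConcat (prf1 pSingle k) m.

(* membership in D_alpha, D_s (s a number), and in E for an enumerating
   function given by its value term e(p) *)
Definition inD (a : fn) (i : tm) : fm := a @ i <> zero_tm.
Definition inDnum (s i : tm) : fm :=
  lt_fm i (length_tm s) /\ entry_tm s i <> zero_tm.
Definition inE (e : tm -> tm) (n : tm) : fm := ex0 p, e p = suc_tm n.

Definition inCantor (c : fn) : fm :=
  all0 n, lt_fm (c @ n) (suc_tm (suc_tm zero_tm)).
Definition BarCantor (B : tm -> fm) : fm :=
  all1 c, (inCantor c --> ex0 n, with_initial c n B).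

Definition FT : fm :=
  all1 a, (BarCantor (inD a) -->
           ex0 m, with_initial a m (fun s => BarCantor (inDnum s))).

Definition notFT : fm :=
  ex1 a, (BarCantor (inD a) /\
          all0 m, ~ with_initial a m (fun s => BarCantor (inDnum s))).

Definition AC_premise (a : fn) : fm :=
  all1 c, ex0 n,
    (le_fm (c @ n) (section a zero_tm n) -->
     inE (section a (suc_tm zero_tm)) (pair_tm n (c @ n))).

Definition AC_conclusion (a : fn) : fm :=
  ex0 n, all0 i,
    (le_fm i (section a zero_tm n) -->
     inE (section a (suc_tm zero_tm)) (pair_tm n i)).

Definition revAC : fm := all1 a, (AC_premise a --> AC_conclusion a).

Definition notRevAC : fm := ex1 a, (AC_premise a /\ ~ AC_conclusion a).

(* Main.v *)
From Stdlib Require Vector.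
From Stdlib Require Import List Arith Lia.
From Stdlib Require Import -(notations) Setoid Morphisms Ring.
Require Import Defs.
Import ListNotations.
Set Implicit Arguments.

(** Both equivalences follow from two translations, proved in BIM:
    every [a] has a [b] such that the premise of the choice principle for [a]
    makes D_b a bar and a finite bar inside D_b gives its conclusion for [a]
    ([ac_from_bar]), and every [b] has an [a] with the same property in the
    other direction ([bar_from_ac]).  Each translation serves both the positive
    and the strongly negated statement.

    From bars to choice.  A binary sequence d is read as a matrix and selects in
    each row n a number at most f(n) = a|0(n): the first j with d(n,j) <> 0, or
    f(n) if there is none before it.  The initial part s of d goes into D_b as
    soon as it decides a row n whose selected number i is seen to satisfy
    (n,i) in E at a stage below the length of s ([decided]).  The premise says
    that every selection meets E, so D_b is a bar ([bar_decided]).  Conversely,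
    given a finite bar, either some row below a fixed bound lies entirely in E,
    with witnesses below the bound, or one can choose in each such row a number
    not yet seen in E; the matrix of that choice would escape the finite bar
    ([choice_of_fin_bar]).

    From choice to bars.  All rows have the two elements 0 and 1, and rows are
    indexed by binary nodes x.  A node is secured at m when every binary
    sequence through it has an initial part s < m in D_b ([secured]); this is
    decidable, since only the finitely many nodes of length m matter
    ([secured_iff]).  The pair (x,i) enters E when at some stage the root is
    secured, or x * <i> is secured and the other child of x is not
    ([separated]).  If both (x,0) and (x,1) are in E, then comparing the two
    stages shows that the root is secured, which is a finite bar
    ([fin_bar_of_separated]).  If D_b is a bar, a choice function g defines a
    branch, some node of the branch is secured, and on the way back to the root
    either security is inherited by the parent or the choice of g at the parent
    is in E ([premise_of_secured]).

    Derivations are handled through a semantics.  A statement is forced at a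
    list of hypotheses, its variables being interpreted by object terms, and
    forcing agrees with derivability ([sat_iff]): implication quantifies over
    larger lists, and disjunction and existence hold locally ([loc]).  Hence a
    derivation may be written as an ordinary argument about terms, in which only
    induction and congruence ask for a formula ([nat_induction], [resp]); such
    formulas are found by recursion on the shape of the predicate ([Rep]).

    The arithmetic below BIM's coding of sequences is developed in the same way:
    division, primes, Euclid's theorem and lemma, and the recovery of length and
    entries from a product of prime powers ([code_len], [code_entry]).
    Functions come from the axioms by closure: every term with a free variable
    is computed by a function ([comp_prim]), every bounded formula has a
    characteristic function ([char_bex], [char_ball]), and the choice axiom
    applies to such formulas ([choice]). *)

(** * Substitution *)

(** The generated principle has no hypotheses for the arguments of [Prf]. *)
Lemma term_nested_ind (P : term -> Prop) :
  (forall k, P (Var k)) -> P Zero ->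
  (forall f u, P u -> P (App f u)) ->
  (forall u v, P u -> P v -> P (Pair u v)) ->
  (forall n (f : prf n) us, Vector.Forall P us -> P (Prf f us)) ->
  forall t, P t.
Proof.
  intros HV HZ HA HP HF. fix IH 1. intros [k| |f u|u v|n f us].
  - apply HV.
  - apply HZ.
  - apply HA, IH.
  - apply HP; apply IH.
  - apply HF. revert us. clear f.
    induction us as [|u m us IHus]; constructor; [apply IH|apply IHus].
Qed.

Lemma map_ext_Forall (A B : Type) (f g : A -> B) n (v : Vector.t A n) :
  Vector.Forall (fun a => f a = g a) v -> Vector.map f v = Vector.map g v.
Proof. induction 1; simpl; congruence. Qed.

(** Only finitely many variables matter to a substitution, uniformly in the
    substitution; this is what makes fresh variables exist. *)
Lemma subst_fterm_support f : exists n, forall s1 s1',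
  (forall k, k < n -> s1 k = s1' k) -> subst_fterm s1 f = subst_fterm s1' f.
Proof.
  destruct f as [k| | | | | |]; try (exists 0; reflexivity).
  exists (S k). intros s1 s1' H. apply H. lia.
Qed.

Lemma subst_term_support t : exists n, forall s0 s0' s1 s1',
  (forall k, k < n -> s0 k = s0' k) -> (forall k, k < n -> s1 k = s1' k) ->
  subst_term s0 s1 t = subst_term s0' s1' t.
Proof.
  induction t as [k| |f u [n IH]|u v [n IHu] [m IHv]|n f us IH]
    using term_nested_ind.
  - exists (S k). intros s0 s0' s1 s1' H0 H1. apply H0. lia.
  - exists 0. reflexivity.
  - destruct (subst_fterm_support f) as [m Hm].
    exists (n + m). intros s0 s0' s1 s1' H0 H1. simpl.
    rewrite (IH s0 s0' s1 s1'), (Hm s1 s1'); auto; intros k Hk;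
      [apply H1|apply H0|apply H1]; lia.
  - exists (n + m). intros s0 s0' s1 s1' H0 H1. simpl.
    rewrite (IHu s0 s0' s1 s1'), (IHv s0 s0' s1 s1'); auto; intros k Hk;
      first [apply H0; lia|apply H1; lia].
  - assert (exists N, forall s0 s0' s1 s1',
      (forall k, k < N -> s0 k = s0' k) -> (forall k, k < N -> s1 k = s1' k) ->
      Vector.map (subst_term s0 s1) us = Vector.map (subst_term s0' s1') us)
      as [N HN].
    { clear f. induction IH as [|m u us [a Ha] _ [b Hb]].
      - exists 0. reflexivity.
      - exists (a + b). intros s0 s0' s1 s1' H0 H1. simpl.
        rewrite (Ha s0 s0' s1 s1'), (Hb s0 s0' s1 s1'); auto; intros k Hk;
          first [apply H0; lia|apply H1; lia]. }
    exists N. intros s0 s0' s1 s1' H0 H1. simpl.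
    rewrite (HN s0 s0' s1 s1'); auto.
Qed.

Lemma subst_support A : exists n, forall s0 s0' s1 s1',
  (forall k, k < n -> s0 k = s0' k) -> (forall k, k < n -> s1 k = s1' k) ->
  subst s0 s1 A = subst s0' s1' A.
Proof.
  induction A as [|t u|f g|A [n HA] B [m HB]|A [n HA] B [m HB]|A [n HA] B [m HB]
    |A [n HA]|A [n HA]|A [n HA]|A [n HA]].
  - exists 0. reflexivity.
  - destruct (subst_term_support t) as [n Hn], (subst_term_support u) as [m Hm].
    exists (n + m). intros s0 s0' s1 s1' H0 H1. simpl.
    rewrite (Hn s0 s0' s1 s1'), (Hm s0 s0' s1 s1'); auto; intros k Hk;
      first [apply H0; lia|apply H1; lia].
  - destruct (subst_fterm_support f) as [n Hn], (subst_fterm_support g) as [m Hm].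
    exists (n + m). intros s0 s0' s1 s1' H0 H1. simpl.
    rewrite (Hn s1 s1'), (Hm s1 s1'); auto; intros k Hk; apply H1; lia.
  - exists (n + m). intros s0 s0' s1 s1' H0 H1. simpl.
    rewrite (HA s0 s0' s1 s1'), (HB s0 s0' s1 s1'); auto; intros k Hk;
      first [apply H0; lia|apply H1; lia].
  - exists (n + m). intros s0 s0' s1 s1' H0 H1. simpl.
    rewrite (HA s0 s0' s1 s1'), (HB s0 s0' s1 s1'); auto; intros k Hk;
      first [apply H0; lia|apply H1; lia].
  - exists (n + m). intros s0 s0' s1 s1' H0 H1. simpl.
    rewrite (HA s0 s0' s1 s1'), (HB s0 s0' s1 s1'); auto; intros k Hk;
      first [apply H0; lia|apply H1; lia].
  - exists n. intros s0 s0' s1 s1' H0 H1. simpl. f_equal. apply HA; auto.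
    intros [|k] Hk; simpl; auto. rewrite H0; auto; lia.
  - exists n. intros s0 s0' s1 s1' H0 H1. simpl. f_equal. apply HA; auto.
    intros [|k] Hk; simpl; auto. rewrite H0; auto; lia.
  - exists n. intros s0 s0' s1 s1' H0 H1. simpl. f_equal. apply HA.
    + intros k Hk. rewrite H0; auto.
    + intros [|k] Hk; simpl; auto. rewrite H1; auto; lia.
  - exists n. intros s0 s0' s1 s1' H0 H1. simpl. f_equal. apply HA.
    + intros k Hk. rewrite H0; auto.
    + intros [|k] Hk; simpl; auto. rewrite H1; auto; lia.
Qed.

Lemma subst_term_ext t s0 s0' s1 s1' :
  (forall k, s0 k = s0' k) -> (forall k, s1 k = s1' k) ->
  subst_term s0 s1 t = subst_term s0' s1' t.
Proof. intros H0 H1. destruct (subst_term_support t) as [n Hn]. apply Hn; auto. Qed.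

Lemma subst_ext A s0 s0' s1 s1' :
  (forall k, s0 k = s0' k) -> (forall k, s1 k = s1' k) ->
  subst s0 s1 A = subst s0' s1' A.
Proof. intros H0 H1. destruct (subst_support A) as [n Hn]. apply Hn; auto. Qed.

Lemma subst_fterm_id f : subst_fterm FVar f = f.
Proof. destruct f; reflexivity. Qed.

Lemma subst_fterm_comp r1 s1 f :
  subst_fterm r1 (subst_fterm s1 f) =
  subst_fterm (fun k => subst_fterm r1 (s1 k)) f.
Proof. destruct f; reflexivity. Qed.

Lemma subst_term_comp r0 r1 s0 s1 t :
  subst_term r0 r1 (subst_term s0 s1 t) =
  subst_term (fun k => subst_term r0 r1 (s0 k))
             (fun k => subst_fterm r1 (s1 k)) t.
Proof.
  induction t using term_nested_ind; simpl; auto.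
  - now rewrite subst_fterm_comp, IHt.
  - now rewrite IHt1, IHt2.
  - now rewrite Vector.map_map, (map_ext_Forall _ _ H).
Qed.

Lemma subst_comp A : forall r0 r1 s0 s1,
  subst r0 r1 (subst s0 s1 A) =
  subst (fun k => subst_term r0 r1 (s0 k)) (fun k => subst_fterm r1 (s1 k)) A.
Proof.
  induction A; intros r0 r1 s0 s1; simpl;
    rewrite ?subst_term_comp, ?subst_fterm_comp, ?IHA1, ?IHA2, ?IHA;
    try reflexivity; f_equal; apply subst_ext; try reflexivity;
    intros [|k]; simpl; unfold shift0_term, shift1_term, shift1_fterm;
    rewrite ?subst_term_comp, ?subst_fterm_comp; try reflexivity;
    apply subst_term_ext; intros; 
    rewrite ?subst_fterm_id; reflexivity.
Qed.

Lemma subst_term_id t : subst_term Var FVar t = t.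
Proof.
  induction t using term_nested_ind; simpl; rewrite ?subst_fterm_id; try congruence.
  rewrite (map_ext_Forall _ _ H), Vector.map_id. reflexivity.
Qed.

Lemma subst_id A : subst Var FVar A = A.
Proof.
  induction A; simpl; rewrite ?subst_term_id, ?subst_fterm_id; try congruence;
    f_equal; rewrite <- IHA at 2; apply subst_ext; intros [|k]; reflexivity.
Qed.

Definition up0 (s0 : nat -> term) : nat -> term :=
  scons (Var 0) (fun k => shift0_term (s0 k)).
Definition up1 (s1 : nat -> fterm) : nat -> fterm :=
  scons (FVar 0) (fun k => shift1_fterm (s1 k)).

Lemma subst_inst0 s0 s1 t A :
  subst s0 s1 (inst0 t A) = inst0 (subst_term s0 s1 t) (subst (up0 s0) s1 A).
Proof.
  unfold inst0. rewrite !subst_comp. apply subst_ext.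
  - intros [|k]; simpl; [reflexivity|]. unfold shift0_term.
    rewrite subst_term_comp. simpl. now rewrite subst_term_id.
  - intros k. simpl. now rewrite subst_fterm_id.
Qed.

Lemma subst_inst1 s0 s1 f A :
  subst s0 s1 (inst1 f A) =
  inst1 (subst_fterm s1 f) (subst (fun k => shift1_term (s0 k)) (up1 s1) A).
Proof.
  unfold inst1. rewrite !subst_comp. apply subst_ext.
  - intros k. simpl. unfold shift1_term. rewrite subst_term_comp. simpl.
    now rewrite subst_term_id.
  - intros [|k]; simpl; [reflexivity|]. unfold shift1_fterm.
    rewrite subst_fterm_comp. simpl. now rewrite subst_fterm_id.
Qed.

Lemma subst_shift0 s0 s1 A :
  shift0 (subst s0 s1 A) = subst (up0 s0) s1 (shift0 A).
Proof.
  unfold shift0. rewrite !subst_comp. apply subst_ext; [reflexivity|].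
  intros k. simpl. apply subst_fterm_id.
Qed.

Lemma subst_shift1 s0 s1 A :
  shift1 (subst s0 s1 A) = subst (fun k => shift1_term (s0 k)) (up1 s1) (shift1 A).
Proof. unfold shift1. rewrite !subst_comp. apply subst_ext; reflexivity. Qed.

(** * Structural properties of derivability *)

Lemma prv_weaken Ax G A : prv Ax G A -> forall G', incl G G' -> prv Ax G' A.
Proof.
  assert (Hcons : forall (B : form) G G', incl G G' -> incl (B :: G) (B :: G')).
  { intros B G0 G' H C [->|HC]; simpl; auto. }
  induction 1; intros G' HG.
  - now apply prv_ax.
  - apply prv_hyp; auto.
  - apply prv_botE; auto.
  - apply prv_andI; auto.
  - eapply prv_andE1; auto.
  - eapply prv_andE2; auto.
  - apply prv_orI1; auto.
  - apply prv_orI2; auto.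
  - eapply prv_orE; eauto.
  - apply prv_impI; auto.
  - eapply prv_impE; eauto.
  - apply prv_all0I. auto using incl_map.
  - apply prv_all0E; auto.
  - eapply prv_ex0I; eauto.
  - eapply prv_ex0E; eauto using incl_map.
  - apply prv_all1I. auto using incl_map.
  - apply prv_all1E; auto.
  - eapply prv_ex1I; eauto.
  - eapply prv_ex1E; eauto using incl_map.
  - apply prv_eq0_refl.
  - eapply prv_eq0_subst; eauto.
  - apply prv_eq1_refl.
  - eapply prv_eq1_subst; eauto.
Qed.

(** The axioms with free variables are schematic, so that a substitution leads
    from instances to instances; for induction it acts on the induction formula. *)
Lemma BIM_axiom_subst A s0 s1 : BIM_axiom A -> BIM_axiom (subst s0 s1 A).
Proof.
  destruct 1 as [ | | | | | | | | | | | | A | n ts | t | n k ts | m n f gs ts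
    | n g h ts | n g h t ts | f t].
  1-12: constructor.
  - assert (E : subst s0 s1
      (Imp (And (inst0 Zero A)
              (All0 (Imp A
                 (subst (scons (App FSucc (Var 0)) (fun k => Var (S k)))
                        FVar A))))
         (All0 A)) =
      let A' := subst (up0 s0) s1 A in
      Imp (And (inst0 Zero A')
              (All0 (Imp A'
                 (subst (scons (App FSucc (Var 0)) (fun k => Var (S k)))
                        FVar A'))))
         (All0 A')); [|rewrite E; apply ax_ind].
    simpl. rewrite subst_inst0. fold (up0 s0). do 4 f_equal.
    rewrite !subst_comp. apply subst_ext.
    + intros [|k]; simpl; [reflexivity|]. unfold shift0_term.
      rewrite subst_term_comp. simpl. apply subst_term_ext; reflexivity.
    + intros k. simpl. now rewrite subst_fterm_id.
  - apply (ax_pZero (Vector.map (subst_term s0 s1) ts)).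
  - apply ax_pSucc.
  - simpl. rewrite <- (Vector.nth_map (subst_term s0 s1) ts k k eq_refl).
    apply ax_pProj.
  - simpl. rewrite Vector.map_map. simpl.
    apply (ax_pComp f gs (Vector.map (subst_term s0 s1) ts)).
  - apply (ax_pRec0 g h (Vector.map (subst_term s0 s1) ts)).
  - apply (ax_pRecS g h (subst_term s0 s1 t) (Vector.map (subst_term s0 s1) ts)).
  - apply ax_FPrf.
Qed.

Lemma map_subst_shift0 s0 s1 G :
  map shift0 (map (subst s0 s1) G) = map (subst (up0 s0) s1) (map shift0 G).
Proof. rewrite !map_map. apply map_ext, subst_shift0. Qed.

Lemma map_subst_shift1 s0 s1 G :
  map shift1 (map (subst s0 s1) G) =
  map (subst (fun k => shift1_term (s0 k)) (up1 s1)) (map shift1 G).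
Proof. rewrite !map_map. apply map_ext, subst_shift1. Qed.

Lemma prv_subst G A : prv BIM_axiom G A ->
  forall s0 s1, prv BIM_axiom (map (subst s0 s1) G) (subst s0 s1 A).
Proof.
  induction 1; intros s0 s1.
  - now apply prv_ax, BIM_axiom_subst.
  - now apply prv_hyp, in_map.
  - apply prv_botE, IHprv.
  - apply prv_andI; [apply IHprv1|apply IHprv2].
  - exact (prv_andE1 (IHprv s0 s1)).
  - exact (prv_andE2 (IHprv s0 s1)).
  - apply prv_orI1, IHprv.
  - apply prv_orI2, IHprv.
  - exact (prv_orE (IHprv1 s0 s1) (IHprv2 s0 s1) (IHprv3 s0 s1)).
  - apply prv_impI, IHprv.
  - exact (prv_impE (IHprv1 s0 s1) (IHprv2 s0 s1)).
  - apply prv_all0I. rewrite map_subst_shift0. apply IHprv.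
  - rewrite subst_inst0. apply prv_all0E, IHprv.
  - apply prv_ex0I with (subst_term s0 s1 t). fold (up0 s0).
    rewrite <- subst_inst0. apply IHprv.
  - eapply prv_ex0E; [apply IHprv1|]. fold (up0 s0).
    rewrite map_subst_shift0, subst_shift0. apply IHprv2.
  - apply prv_all1I. rewrite map_subst_shift1. apply IHprv.
  - rewrite subst_inst1. apply prv_all1E, IHprv.
  - apply prv_ex1I with (subst_fterm s1 f). fold (up1 s1).
    rewrite <- subst_inst1. apply IHprv.
  - eapply prv_ex1E; [apply IHprv1|]. fold (up1 s1).
    rewrite map_subst_shift1, subst_shift1. apply IHprv2.
  - apply prv_eq0_refl.
  - rewrite subst_inst0. apply (prv_eq0_subst _ (IHprv1 s0 s1)).
    rewrite <- subst_inst0. apply IHprv2.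
  - apply prv_eq1_refl.
  - rewrite subst_inst1. apply (prv_eq1_subst _ (IHprv1 s0 s1)).
    rewrite <- subst_inst1. apply IHprv2.
Qed.

(** ** Fresh variables as eigenvariables *)

(** Makes the variable [x] the eigenvariable of a quantifier rule. *)
Definition rename0 (x : nat) (k : nat) : term :=
  if k =? x then Var 0 else Var (S k).
Definition rename1 (x : nat) (k : nat) : fterm :=
  if k =? x then FVar 0 else FVar (S k).

(** Renaming a fresh [x] acts on side formulas as the shift and undoes the
    instantiation at [x]: the two facts that turn a derivation about [x] into the
    premise of a quantifier rule. *)
Definition fresh (x : nat) (A : form) : Prop :=
  subst (rename0 x) FVar A = shift0 A /\
  subst Var (rename1 x) A = shift1 A /\
  subst (rename0 x) FVar (inst0 (Var x) A) = A /\
  subst Var (rename1 x) (inst1 (FVar x) A) = A.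

Lemma fresh_ex (L : list form) : exists x, forall A, In A L -> fresh x A.
Proof.
  assert (R0 : forall x k, k < x -> rename0 x k = Var (S k)).
  { intros x k Hk. unfold rename0. now rewrite (proj2 (Nat.eqb_neq k x)) by lia. }
  assert (R1 : forall x k, k < x -> rename1 x k = FVar (S k)).
  { intros x k Hk. unfold rename1. now rewrite (proj2 (Nat.eqb_neq k x)) by lia. }
  assert (R0' : forall x, rename0 x x = Var 0).
  { intros x. unfold rename0. now rewrite Nat.eqb_refl. }
  assert (R1' : forall x, rename1 x x = FVar 0).
  { intros x. unfold rename1. now rewrite Nat.eqb_refl. }
  assert (H : exists n, forall A, In A L -> forall x, n <= x -> fresh x A).
  2:{ destruct H as [n Hn]. exists n. intros A HA. now apply (Hn A). }
  induction L as [|A L [n IH]]; [exists 0; easy|].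
  destruct (subst_support A) as [m Hm]. exists (n + m).
  intros B [<-|HB] x Hx; [|apply IH; auto; lia]. repeat split.
  - apply Hm; auto. intros k Hk. apply R0; lia.
  - apply Hm; auto. intros k Hk. apply R1; lia.
  - rewrite <- (subst_id A) at 2. unfold inst0. rewrite subst_comp.
    apply Hm; auto. intros [|k] Hk; simpl; [apply R0'|apply R0; lia].
  - rewrite <- (subst_id A) at 2. unfold inst1. rewrite subst_comp.
    apply Hm; auto. intros [|k] Hk; simpl; [apply R1'|apply R1; lia].
Qed.

Lemma map_fresh0 x G : (forall A, In A G -> fresh x A) ->
  map (subst (rename0 x) FVar) G = map shift0 G.
Proof. intros H. apply map_ext_in. intros A HA. apply (H A HA). Qed.

Lemma map_fresh1 x G : (forall A, In A G -> fresh x A) ->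
  map (subst Var (rename1 x)) G = map shift1 G.
Proof. intros H. apply map_ext_in. intros A HA. apply (H A HA). Qed.

(** With terms of the object language as values of a variable of the
    metalanguage, generalization is uniform derivability of all instances: it
    suffices to take a fresh variable as instance and to rename it. *)
Lemma prv_all0_intro G A :
  (forall t, prv BIM_axiom G (inst0 t A)) -> prv BIM_axiom G (All0 A).
Proof.
  intros H. destruct (fresh_ex (A :: G)) as [x Hx]. apply prv_all0I.
  rewrite <- (@map_fresh0 x) by (intros; apply Hx; simpl; auto).
  destruct (Hx A) as (_ & _ & E & _); [simpl; auto|]. rewrite <- E.
  apply prv_subst, H.
Qed.

Lemma prv_all1_intro G A :
  (forall f, prv BIM_axiom G (inst1 f A)) -> prv BIM_axiom G (All1 A).
Proof.
  intros H. destruct (fresh_ex (A :: G)) as [x Hx]. apply prv_all1I.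
  rewrite <- (@map_fresh1 x) by (intros; apply Hx; simpl; auto).
  destruct (Hx A) as (_ & _ & _ & E); [simpl; auto|]. rewrite <- E.
  apply prv_subst, H.
Qed.

Lemma prv_ex0_elim G A C : prv BIM_axiom G (Ex0 A) ->
  (forall t, prv BIM_axiom (inst0 t A :: G) C) -> prv BIM_axiom G C.
Proof.
  intros HA H. destruct (fresh_ex (A :: C :: G)) as [x Hx].
  eapply prv_ex0E; [exact HA|].
  rewrite <- (@map_fresh0 x G) by (intros; apply Hx; simpl; auto).
  destruct (Hx A) as (_ & _ & E & _); [simpl; auto|]. rewrite <- E.
  destruct (Hx C) as (E' & _); [simpl; auto|]. rewrite <- E'.
  apply (prv_subst (H (Var x))).
Qed.

Lemma prv_ex1_elim G A C : prv BIM_axiom G (Ex1 A) ->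
  (forall f, prv BIM_axiom (inst1 f A :: G) C) -> prv BIM_axiom G C.
Proof.
  intros HA H. destruct (fresh_ex (A :: C :: G)) as [x Hx].
  eapply prv_ex1E; [exact HA|].
  rewrite <- (@map_fresh1 x G) by (intros; apply Hx; simpl; auto).
  destruct (Hx A) as (_ & _ & _ & E); [simpl; auto|]. rewrite <- E.
  destruct (Hx C) as (_ & E' & _); [simpl; auto|]. rewrite <- E'.
  apply (prv_subst (H (FVar x))).
Qed.

(** * Forcing over contexts *)

Notation ctx := (list form).
Definition hprop := ctx -> Prop.
Notation BIM G A := (prv BIM_axiom G A).

(** Closes [X] under elimination of derivable disjunctions and existential
    statements, in continuation passing style: [X] may be assumed, at the price
    of a larger context, whenever the aim is a derivation. *)
Record loc (X : hprop) (G : ctx) : Prop := local_intro {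
  local_elim : forall C G', incl G G' ->
    (forall G'', incl G' G'' -> X G'' -> BIM G'' C) -> BIM G' C }.

(** Kripke implication.  Like [loc] it is a record, so that no tactic unfolds it
    by itself. *)
Record imp (P Q : hprop) (G : ctx) : Prop := imp_intro {
  imp_elim : forall G', incl G G' -> P G' -> Q G' }.

Definition bot : hprop := fun G => BIM G Bot.
Definition eqn (G : ctx) (t u : term) : Prop := BIM G (Eq0 t u).

(** Forcing over contexts, with object terms as individuals.  Universal
    quantifiers need no passage to larger contexts, because all terms exist
    everywhere. *)
Fixpoint sat (A : form) (e0 : nat -> term) (e1 : nat -> fterm) (G : ctx)
  : Prop :=
  match A with
  | Bot => bot G
  | Eq0 t u => eqn G (subst_term e0 e1 t) (subst_term e0 e1 u)
  | Eq1 f g => BIM G (Eq1 (subst_fterm e1 f) (subst_fterm e1 g))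
  | And B C => sat B e0 e1 G /\ sat C e0 e1 G
  | Or B C => loc (fun G => sat B e0 e1 G \/ sat C e0 e1 G) G
  | Imp B C => imp (fun G => sat B e0 e1 G) (fun G => sat C e0 e1 G) G
  | All0 B => forall t, sat B (scons t e0) e1 G
  | Ex0 B => loc (fun G => exists t, sat B (scons t e0) e1 G) G
  | All1 B => forall f, sat B e0 (scons f e1) G
  | Ex1 B => loc (fun G => exists f, sat B e0 (scons f e1) G) G
  end.

Lemma inst0_up0 t e0 e1 A :
  inst0 t (subst (up0 e0) e1 A) = subst (scons t e0) e1 A.
Proof.
  unfold inst0. rewrite subst_comp. apply subst_ext.
  - intros [|k]; simpl; [reflexivity|]. unfold shift0_term.
    rewrite subst_term_comp. simpl. apply subst_term_id.
  - intros k. apply subst_fterm_id.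
Qed.

Lemma inst1_up1 f e0 e1 A :
  inst1 f (subst (fun k => shift1_term (e0 k)) (up1 e1) A) =
  subst e0 (scons f e1) A.
Proof.
  unfold inst1. rewrite subst_comp. apply subst_ext.
  - intros k. unfold shift1_term. rewrite subst_term_comp. simpl.
    apply subst_term_id.
  - intros [|k]; simpl; [reflexivity|]. unfold shift1_fterm.
    rewrite subst_fterm_comp. simpl. apply subst_fterm_id.
Qed.

(** Forcing and derivability agree.  Contexts extended by the formula in question
    serve as generic extensions for implication and for [loc]; the quantifiers
    are covered by fresh variables. *)
Lemma sat_iff A : forall e0 e1 G, sat A e0 e1 G <-> BIM G (subst e0 e1 A).
Proof.
  induction A as [|t u|f g|A IHA B IHB|A IHA B IHB|A IHA B IHB
    |A IHA|A IHA|A IHA|A IHA]; intros e0 e1 G; simpl; try reflexivity.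
  - rewrite IHA, IHB. split.
    + intros [H1 H2]. now apply prv_andI.
    + intros H. split; [exact (prv_andE1 H)|exact (prv_andE2 H)].
  - split.
    + intros H. apply (local_elim H (incl_refl G)). intros G' L [H'|H'].
      * now apply prv_orI1, IHA.
      * now apply prv_orI2, IHB.
    + intros H. constructor. intros C G' L K.
      eapply prv_orE; [exact (prv_weaken H L)| |]; apply K.
      * apply incl_tl, incl_refl.
      * left. apply IHA, prv_hyp. now left.
      * apply incl_tl, incl_refl.
      * right. apply IHB, prv_hyp. now left.
  - split.
    + intros H. apply prv_impI, IHB, (imp_elim H); [apply incl_tl, incl_refl|].
      apply IHA, prv_hyp. now left.
    + intros H. constructor. intros G' L HA. apply IHB. apply IHA in HA.
      exact (prv_impE (prv_weaken H L) HA).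
  - fold (up0 e0). split.
    + intros H. apply prv_all0_intro. intros t. rewrite inst0_up0. apply IHA, H.
    + intros H t. apply IHA. rewrite <- inst0_up0. now apply prv_all0E.
  - fold (up0 e0). split.
    + intros H. apply (local_elim H (incl_refl G)). intros G' L [t Ht].
      apply prv_ex0I with t. rewrite inst0_up0. now apply IHA.
    + intros H. constructor. intros C G' L K.
      eapply prv_ex0_elim; [exact (prv_weaken H L)|].
      intros t. apply K; [apply incl_tl, incl_refl|]. exists t. apply IHA.
      rewrite <- inst0_up0. apply prv_hyp. now left.
  - fold (up1 e1). split.
    + intros H. apply prv_all1_intro. intros f. rewrite inst1_up1. apply IHA, H.
    + intros H f. apply IHA. rewrite <- inst1_up1. now apply prv_all1E.
  - fold (up1 e1). split.
    + intros H. apply (local_elim H (incl_refl G)). intros G' L [f Hf].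
      apply prv_ex1I with f. rewrite inst1_up1. now apply IHA.
    + intros H. constructor. intros C G' L K.
      eapply prv_ex1_elim; [exact (prv_weaken H L)|].
      intros f. apply K; [apply incl_tl, incl_refl|]. exists f. apply IHA.
      rewrite <- inst1_up1. apply prv_hyp. now left.
Qed.

Lemma sat_closed A G : sat A Var FVar G <-> BIM G A.
Proof. now rewrite sat_iff, subst_id. Qed.

(** ** Monotone and local propositions *)

(** Hypotheses have to survive when a [loc] statement is opened and the context
    grows. *)
Class Mono (P : hprop) : Prop := mono : forall G G', incl G G' -> P G -> P G'.
(** A goal of this kind allows a [loc] statement to be opened. *)
Class Stable (P : hprop) : Prop := stable : forall G, loc P G -> P G.

#[global] Instance mono_prv (A : form) : Mono (fun G => BIM G A).
Proof. intros G G' L H. exact (prv_weaken H L). Qed.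
#[global] Instance mono_eqn t u : Mono (fun G => eqn G t u).
Proof. apply mono_prv. Qed.
#[global] Instance mono_loc X : Mono (loc X).
Proof.
  intros G G' L H. constructor. intros C G2 L2. apply H.
  now apply incl_tran with G'.
Qed.
#[global] Instance mono_imp P Q : Mono (imp P Q).
Proof.
  intros G G' L H. constructor. intros G2 L2. apply H.
  now apply incl_tran with G'.
Qed.
#[global] Instance mono_and P Q : Mono P -> Mono Q -> Mono (fun G => P G /\ Q G).
Proof. intros HP HQ G G' L [H1 H2]. split; eapply mono; eauto. Qed.
#[global] Instance mono_all (A : Type) (P : A -> hprop) :
  (forall a, Mono (P a)) -> Mono (fun G => forall a, P a G).
Proof. intros HP G G' L H a. eapply (HP a); eauto. Qed.
#[global] Instance mono_ex (A : Type) (P : A -> hprop) :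
  (forall a, Mono (P a)) -> Mono (fun G => exists a, P a G).
Proof. intros HP G G' L [a H]. exists a. eapply (HP a); eauto. Qed.
#[global] Instance mono_or P Q : Mono P -> Mono Q -> Mono (fun G => P G \/ Q G).
Proof. intros HP HQ G G' L [H|H]; [left|right]; eapply mono; eauto. Qed.

#[global] Instance stable_prv (A : form) : Stable (fun G => BIM G A).
Proof. intros G H. apply (local_elim H (incl_refl G)). auto. Qed.
#[global] Instance stable_eqn t u : Stable (fun G => eqn G t u).
Proof. apply stable_prv. Qed.
#[global] Instance stable_loc X : Stable (loc X).
Proof.
  intros G H. constructor. intros C G' L K. apply (local_elim H L).
  intros G2 L2 H2.
  apply (local_elim H2 (incl_refl _)). intros G3 L3. apply K.
  now apply incl_tran with G2.
Qed.

Lemma loc_map (X Y : hprop) G :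
  loc X G -> (forall G', incl G G' -> X G' -> Y G') -> loc Y G.
Proof.
  intros H HXY. constructor. intros C G' L K. apply (local_elim H L).
  intros G2 L2 H2. apply (K G2 L2).
  apply HXY; auto. now apply incl_tran with G'.
Qed.

Arguments loc_map {X Y G}.

#[global] Instance stable_imp P Q : Mono P -> Stable Q -> Stable (imp P Q).
Proof.
  intros HP HQ G H. constructor. intros G' L HP'. apply HQ.
  apply (loc_map (X := imp P Q)); [exact (mono_loc L H)|].
  intros G2 L2 H2. apply (imp_elim H2 (incl_refl _)). exact (HP _ _ L2 HP').
Qed.
#[global] Instance stable_and P Q :
  Stable P -> Stable Q -> Stable (fun G => P G /\ Q G).
Proof.
  intros HP HQ G H. split; [apply HP|apply HQ]; apply (loc_map H); firstorder.
Qed.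
#[global] Instance stable_all (A : Type) (P : A -> hprop) :
  (forall a, Stable (P a)) -> Stable (fun G => forall a, P a G).
Proof. intros HP G H a. apply HP. apply (loc_map H). firstorder. Qed.

#[global] Hint Extern 1 (Mono _) => apply mono_imp : typeclass_instances.
(* The instances also apply to eta-expanded propositions. *)
#[global] Hint Extern 1 (Mono _) => apply mono_loc : typeclass_instances.
#[global] Hint Extern 1 (Stable _) => apply stable_loc : typeclass_instances.

#[global] Hint Extern 5 (Mono ?P) =>
  lazymatch P with (fun x => ?F x) => change (Mono F) end : typeclass_instances.
#[global] Hint Extern 5 (Stable ?P) =>
  lazymatch P with (fun x => ?F x) => change (Stable F) end : typeclass_instances.

Lemma ret (X : hprop) G : Mono X -> X G -> loc X G.
Proof.
  intros HX H. constructor. intros C G' L K.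
  apply (K G' (incl_refl _)). eapply mono; eauto.
Qed.

Lemma bind (X Q : hprop) G : Stable Q -> loc X G ->
  (forall G', incl G G' -> X G' -> Q G') -> Q G.
Proof. intros HQ H K. apply HQ. exact (loc_map H K). Qed.

Arguments bind {X Q G HQ}.

Lemma bot_elim (Q : hprop) G : Stable Q -> bot G -> Q G.
Proof.
  intros HQ H. apply HQ. constructor. intros C G' L _.
  apply prv_botE, (prv_weaken H L).
Qed.

Lemma mp (P Q : hprop) G : imp P Q G -> P G -> Q G.
Proof. intros H. apply H, incl_refl. Qed.

(** ** Tactics *)

Ltac eta_reduce P :=
  lazymatch P with (fun x => ?F x) => F | _ => P end.

Ltac mono_hyp H G L :=
  let X := type of H in
  let P := eval pattern G in X in
  let H' := fresh in
  lazymatch P with ?P0 _ =>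
    let P' := eta_reduce P0 in
    pose proof (mono (P := P') L H : ltac:(lazymatch type of L with incl _ ?G' =>
      let Y := eval cbv beta in (P' G') in exact Y end)) as H'
  end;
  clear H; rename H' into H.

(* Transports all hypotheses at [G] along [L : incl G G']. *)
Ltac weaken L :=
  lazymatch type of L with incl ?G ?G' =>
    repeat match goal with
    | H : context [G] |- _ =>
      lazymatch H with
      | L => fail
      | _ => mono_hyp H G L
      end
    end;
    clear L; clear G; rename G' into G
  end.

Ltac unlocal H :=
  let G' := fresh "G'" in let L := fresh "L" in let X := fresh "X" in
  let T := type of H in let T' := eval hnf in T in change T' in H;
  lazymatch type of H with loc _ ?G =>
    pattern G;
    lazymatch goal with |- ?Q0 _ =>
      let Q := eta_reduce Q0 in
      refine (@bind _ Q G ltac:(typeclasses eauto) H _)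
    end;
    clear H;
    intros G' L X; cbv beta in X |- *; weaken L; revert X
  end.

(* Case analysis on a local disjunction or existence statement. *)
Tactic Notation "tdes" constr(H) "as" simple_intropattern(p) :=
  tryif is_var H then unlocal H
  else (let H' := fresh in pose proof H as H'; unlocal H');
  intros p.

(* The context grows by the premise, and the hypotheses are carried over. *)
Tactic Notation "iintro" simple_intropattern(p) :=
  let G' := fresh "G'" in let L := fresh "L" in let X := fresh "X" in
  constructor; intros G' L X; cbv beta in X; weaken L; revert X; intros p.

Ltac falso := 
  match goal with |- ?X => match X with context [?G] => 
    is_var G; match type of G with list form => 
    pattern G;
    lazymatch goal with |- ?Q0 _ => let Q := eta_reduce Q0 in
      refine (bot_elim (Q := Q) _ _); cbv beta end end end end.

(** ** Definable families *)

(** From [n] on, the variables denote themselves: they are the parameters of a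
    family with [n] bound variables. *)
Definition env_fix {A} (v : nat -> A) (n : nat) (e : nat -> A) : Prop :=
  forall k, e (n + k) = v k.

Definition RepF n m (f : (nat -> term) -> (nat -> fterm) -> fterm) : Prop :=
  exists g, forall e0 e1, env_fix Var n e0 -> env_fix FVar m e1 ->
  f e0 e1 = subst_fterm e1 g.
Definition RepT n m (t : (nat -> term) -> (nat -> fterm) -> term) : Prop :=
  exists u, forall e0 e1, env_fix Var n e0 -> env_fix FVar m e1 ->
  t e0 e1 = subst_term e0 e1 u.
Definition RepV n m k (t : (nat -> term) -> (nat -> fterm) -> Vector.t term k)
  : Prop :=
  exists u, forall e0 e1, env_fix Var n e0 -> env_fix FVar m e1 ->
  t e0 e1 = Vector.map (subst_term e0 e1) u.
(** A family of propositions is representable if one formula defines it for all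
    values of its bound variables.  This is what induction and congruence need,
    as their axioms speak of formulas only. *)
Definition Rep n m (P : (nat -> term) -> (nat -> fterm) -> hprop) : Prop :=
  exists A, forall e0 e1, env_fix Var n e0 -> env_fix FVar m e1 ->
  forall G, P e0 e1 G <-> sat A e0 e1 G.

Lemma repF_const n m f : RepF n m (fun _ _ => f).
Proof.
  exists (subst_fterm (fun k => FVar (m + k)) f). intros e0 e1 H0 H1.
  rewrite subst_fterm_comp. destruct f; simpl; auto.
Qed.
Lemma repF_var n m k : RepF n m (fun _ e1 => e1 k).
Proof. now exists (FVar k). Qed.
(** A parameter is a term in which the variables have to skip the bound ones. *)
Lemma repT_const n m t : RepT n m (fun _ _ => t).
Proof.
  exists (subst_term (fun k => Var (n + k)) (fun k => FVar (m + k)) t).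
  intros e0 e1 H0 H1. rewrite subst_term_comp. rewrite <- (subst_term_id t) at 1.
  apply subst_term_ext; intros k; simpl; auto.
Qed.
Lemma repT_var n m k : RepT n m (fun e0 _ => e0 k).
Proof. now exists (Var k). Qed.
Lemma repT_app n m f t : RepF n m f -> RepT n m t ->
  RepT n m (fun e0 e1 => App (f e0 e1) (t e0 e1)).
Proof.
  intros [g Hg] [u Hu]. exists (App g u). intros e0 e1 H0 H1. simpl.
  now rewrite Hg, Hu.
Qed.
Lemma repT_pair n m t u : RepT n m t -> RepT n m u ->
  RepT n m (fun e0 e1 => Pair (t e0 e1) (u e0 e1)).
Proof.
  intros [t' Ht] [u' Hu]. exists (Pair t' u'). intros e0 e1 H0 H1. simpl.
  now rewrite Ht, Hu.
Qed.
Lemma repT_prf n m k (f : prf k) us : RepV n m us ->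
  RepT n m (fun e0 e1 => Prf f (us e0 e1)).
Proof.
  intros [u' Hu]. exists (Prf f u'). intros e0 e1 H0 H1. simpl. now rewrite Hu.
Qed.
Lemma repV_const n m k (us : Vector.t term k) : RepV n m (fun _ _ => us).
Proof.
  induction us as [|t k us [vs IH]].
  - exists (Vector.nil _). reflexivity.
  - destruct (repT_const n m t) as [u Hu]. exists (Vector.cons _ u _ vs).
    intros e0 e1 H0 H1. simpl. now rewrite <- Hu, <- IH.
Qed.
Lemma repV_cons n m k t (us : _ -> _ -> Vector.t term k) :
  RepT n m t -> RepV n m us ->
  RepV n m (fun e0 e1 => Vector.cons _ (t e0 e1) _ (us e0 e1)).
Proof.
  intros [u Hu] [vs Hv]. exists (Vector.cons _ u _ vs). intros e0 e1 H0 H1. simpl.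
  now rewrite Hu, Hv.
Qed.

Lemma rep_bot n m : Rep n m (fun _ _ G => bot G).
Proof. now exists Bot. Qed.
Lemma rep_eqn n m t u : RepT n m t -> RepT n m u ->
  Rep n m (fun e0 e1 G => eqn G (t e0 e1) (u e0 e1)).
Proof.
  intros [t' Ht] [u' Hu]. exists (Eq0 t' u'). intros e0 e1 H0 H1 G. simpl.
  now rewrite Ht, Hu.
Qed.
Lemma rep_and n m P Q : Rep n m P -> Rep n m Q ->
  Rep n m (fun e0 e1 G => P e0 e1 G /\ Q e0 e1 G).
Proof.
  intros [A HA] [B HB]. exists (And A B). intros e0 e1 H0 H1 G. simpl.
  now rewrite HA, HB.
Qed.
Lemma loc_iff (X Y : hprop) G : (forall G, X G <-> Y G) -> (loc X G <-> loc Y G).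
Proof.
  intros H. split; intros K; apply (loc_map K); intros; now apply H.
Qed.
Lemma rep_or n m P Q : Rep n m P -> Rep n m Q ->
  Rep n m (fun e0 e1 G => loc (fun G => P e0 e1 G \/ Q e0 e1 G) G).
Proof.
  intros [A HA] [B HB]. exists (Or A B). intros e0 e1 H0 H1 G. simpl.
  apply loc_iff. intros G'. now rewrite HA, HB.
Qed.
Lemma rep_imp n m P Q : Rep n m P -> Rep n m Q ->
  Rep n m (fun e0 e1 G => imp (P e0 e1) (Q e0 e1) G).
Proof.
  intros [A HA] [B HB]. exists (Imp A B). intros e0 e1 H0 H1 G. simpl.
  split; intros H; constructor; intros G' L K.
  - apply HB; auto. apply H; auto. apply HA; auto.
  - apply (HB e0 e1 H0 H1). apply H; auto. apply (HA e0 e1 H0 H1); auto.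
Qed.
Lemma env_fix_scons A (v : nat -> A) n e a :
  env_fix v n e -> env_fix v (S n) (scons a e).
Proof. intros H k. exact (H k). Qed.
Lemma rep_all0 n m (P : _ -> _ -> term -> hprop) :
  Rep (S n) m (fun e0 e1 => P (fun k => e0 (S k)) e1 (e0 0)) ->
  Rep n m (fun e0 e1 G => forall t, P e0 e1 t G).
Proof.
  intros [A HA]. exists (All0 A). intros e0 e1 H0 H1 G. simpl.
  split; intros H t; apply (HA (scons t e0) e1 (env_fix_scons t H0) H1 G), H.
Qed.
Lemma rep_all1 n m (P : _ -> _ -> fterm -> hprop) :
  Rep n (S m) (fun e0 e1 => P e0 (fun k => e1 (S k)) (e1 0)) ->
  Rep n m (fun e0 e1 G => forall t, P e0 e1 t G).
Proof.
  intros [A HA]. exists (All1 A). intros e0 e1 H0 H1 G. simpl.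
  split; intros H t; apply (HA e0 (scons t e1) H0 (env_fix_scons t H1) G), H.
Qed.
Lemma rep_ex0 n m (P : _ -> _ -> term -> hprop) :
  Rep (S n) m (fun e0 e1 => P (fun k => e0 (S k)) e1 (e0 0)) ->
  Rep n m (fun e0 e1 G => loc (fun G => exists t, P e0 e1 t G) G).
Proof.
  intros [A HA]. exists (Ex0 A). intros e0 e1 H0 H1 G. simpl. apply loc_iff.
  intros G'. split; intros [t H]; exists t;
    apply (HA (scons t e0) e1 (env_fix_scons t H0) H1 G'), H.
Qed.
Lemma rep_ex1 n m (P : _ -> _ -> fterm -> hprop) :
  Rep n (S m) (fun e0 e1 => P e0 (fun k => e1 (S k)) (e1 0)) ->
  Rep n m (fun e0 e1 G => loc (fun G => exists t, P e0 e1 t G) G).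
Proof.
  intros [A HA]. exists (Ex1 A). intros e0 e1 H0 H1 G. simpl. apply loc_iff.
  intros G'. split; intros [t H]; exists t;
    apply (HA e0 (scons t e1) H0 (env_fix_scons t H1) G'), H.
Qed.

Create HintDb semdef.

(** The stability under substitution that a term scheme has. *)
Definition Uniform (F : term -> term) : Prop :=
  forall n m t, RepT n m t -> RepT n m (fun e0 e1 => F (t e0 e1)).

(* Some shapes occur twice, as predicates may be eta-reduced. *)
Ltac rep_step :=
  cbv beta;
  lazymatch goal with
  | |- RepF _ _ (fun _ _ => ?f) => apply repF_const
  | |- RepF _ _ (fun _ e => e ?k) => apply repF_var
  | |- RepT _ _ (fun _ _ => ?t) => apply repT_const
  | |- RepT _ _ (fun e _ => e ?k) => apply repT_var
  | |- RepT _ _ (fun _ _ => App _ _) => apply repT_app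
  | |- RepT _ _ (fun _ _ => Pair _ _) => apply repT_pair
  | |- RepT _ _ (fun _ _ => Prf _ _) => apply repT_prf
  | H : Uniform ?F |- RepT _ _ (fun _ _ => ?F _) => apply H
  | |- RepV _ _ (fun _ _ => ?t) => apply repV_const
  | |- RepV _ _ (fun _ _ => Vector.cons _ _ _ _) => apply repV_cons
  | |- Rep _ _ (fun _ _ G => bot _) => apply rep_bot
  | |- Rep _ _ (fun _ _ => bot) => apply rep_bot
  | |- Rep _ _ (fun _ _ G => eqn _ _ _) => apply rep_eqn
  | |- Rep _ _ (fun _ _ G => _ /\ _) => apply rep_and
  | |- Rep _ _ (fun _ _ G => loc (fun _ => _ \/ _) _) => apply rep_or
  | |- Rep _ _ (fun _ _ => loc (fun _ => _ \/ _)) => apply rep_or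
  | |- Rep _ _ (fun _ _ => loc (fun _ => exists t : term, _)) => apply rep_ex0
  | |- Rep _ _ (fun _ _ G => imp _ _ _) => apply rep_imp
  | |- Rep _ _ (fun _ _ => imp _ _) => apply rep_imp
  | |- Rep _ _ (fun _ _ G => forall t : term, _) => apply rep_all0
  | |- Rep _ _ (fun _ _ G => forall t : fterm, _) => apply rep_all1
  | |- Rep _ _ (fun _ _ G => loc (fun _ => exists t : term, _) _) => apply rep_ex0
  | |- Rep _ _ (fun _ _ G => loc (fun _ => exists t : fterm, _) _) => apply rep_ex1
  end.
Ltac rep := autounfold with semdef; solve [repeat rep_step].

(** Equals may be replaced only in representable families. *)
Lemma resp (P : term -> hprop) G t u : Rep 1 0 (fun e0 _ => P (e0 0)) ->
  eqn G t u -> P t G -> P u G.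
Proof.
  intros [A HA] E H.
  assert (K : forall t, P t G <-> BIM G (inst0 t A)).
  { intros v. rewrite (HA (scons v Var) FVar); try (intros k; reflexivity).
    apply sat_iff. }
  apply K. apply K in H. exact (prv_eq0_subst A E H).
Qed.

Notation suc t := (App FSucc t).

Lemma nat_induction (P : term -> hprop) G : Rep 1 0 (fun e0 _ => P (e0 0)) ->
  P Zero G -> (forall t G', incl G G' -> P t G' -> P (suc t) G') ->
  forall t, P t G.
Proof.
  intros [A HA] H0 HS.
  assert (K : forall t G, P t G <-> BIM G (inst0 t A)).
  { intros v G'. rewrite (HA (scons v Var) FVar); try (intros k; reflexivity).
    apply sat_iff. }
  intros t. apply K, prv_all0E.
  eapply prv_impE; [apply prv_ax, ax_ind|]. apply prv_andI; [now apply K|].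
  apply prv_all0_intro. intros u.
  change (BIM G (Imp (inst0 u A)
    (inst0 u (subst (scons (suc (Var 0)) (fun k => Var (S k))) FVar A)))).
  apply prv_impI.
  replace (inst0 u (subst (scons (suc (Var 0)) (fun k => Var (S k))) FVar A))
    with (inst0 (suc u) A).
  - apply K, HS; [apply incl_tl, incl_refl|]. apply K, prv_hyp. now left.
  - unfold inst0. rewrite subst_comp. apply subst_ext; [|reflexivity].
    intros [|k]; reflexivity.
Qed.

Ltac induct t :=
  lazymatch goal with G : list form |- _ =>
    pattern t, G;
    let G' := fresh "G'" in let L := fresh "L" in let IH := fresh "IH" in
    revert t;
    lazymatch goal with |- forall t, ?P t G => refine (nat_induction P _ _ _) end;
    [rep|cbv beta|intros t G' L IH; cbv beta in IH |- *; weaken L]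
  end.

#[global] Instance eqn_refl G : Reflexive (eqn G).
Proof. intros t. apply prv_eq0_refl. Qed.
#[global] Instance eqn_sym G : Symmetric (eqn G).
Proof.
  intros t u H. apply (resp (fun x G => eqn G x t) (t := t)); auto.
  - rep.
  - reflexivity.
Qed.
#[global] Instance eqn_trans G : Transitive (eqn G).
Proof.
  intros t u v H1 H2. apply (resp (fun x G => eqn G t x) (t := u)); auto.
  rep.
Qed.
#[global] Instance eqn_equiv G : Equivalence (eqn G) := {}.

Lemma app_congr G f t u : eqn G t u -> eqn G (App f t) (App f u).
Proof.
  intros H. apply (resp (fun x G => eqn G (App f t) (App f x)) (t := t)); auto.
  - rep.
  - reflexivity.
Qed.

(** * Evaluation of primitive recursive terms *)

Notation "R ==> S" := (respectful R S) (right associativity, at level 55).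
Notation vnil := (Vector.nil _).
Notation "t ::: v" := (Vector.cons _ t _ v) (at level 60, right associativity).

(** Equality in all contexts: the relation for which [ring] can be set up once
    and for all. *)
Definition eqv (t u : term) : Prop := forall G, eqn G t u.

#[global] Instance eqv_equiv : Equivalence eqv.
Proof.
  split.
  - intros t G. reflexivity.
  - intros t u H G. symmetry. apply H.
  - intros t u v H1 H2 G. transitivity u; [apply H1|apply H2].
Qed.

Lemma eqv_in G t u : eqv t u -> eqn G t u.
Proof. auto. Qed.

Lemma pair_congr G t t' u u' :
  eqn G t t' -> eqn G u u' -> eqn G (Pair t u) (Pair t' u').
Proof.
  intros H1 H2. transitivity (Pair t' u).
  - apply (resp (fun x G => eqn G (Pair t u) (Pair x u)) (t := t)); auto.
    + rep.
    + reflexivity.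
  - apply (resp (fun x G => eqn G (Pair t' u) (Pair t' x)) (t := u)); auto.
    + rep.
    + reflexivity.
Qed.

Inductive veqn (G : ctx) : forall n, Vector.t term n -> Vector.t term n -> Prop :=
| veqn_nil : veqn G vnil vnil
| veqn_cons n t u (v w : Vector.t term n) :
    eqn G t u -> veqn G v w -> veqn G (t ::: v) (u ::: w).

Lemma veqn_refl G n (v : Vector.t term n) : veqn G v v.
Proof. induction v; constructor; auto. reflexivity. Qed.

(** Replaces the entries one at a time, as the equality rule treats one
    variable. *)
Lemma veqn_uniform G n (v w : Vector.t term n) : veqn G v w ->
  forall F : Vector.t term n -> term,
  (forall us, RepV 1 0 us -> RepT 1 0 (fun e0 e1 => F (us e0 e1))) ->
  eqn G (F v) (F w).
Proof.
  induction 1 as [|n t u v w E H IH]; intros F HF; [reflexivity|].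
  transitivity (F (u ::: v)).
  - apply (resp (fun x G => eqn G (F (t ::: v)) (F (x ::: v))) (t := t)); auto.
    + apply rep_eqn; [apply repT_const|]. apply (HF (fun e0 _ => e0 0 ::: v)).
      rep.
    + reflexivity.
  - apply (IH (fun v => F (u ::: v))). intros us Hus. apply HF.
    apply (repV_cons (t := fun _ _ => u)); [rep|exact Hus].
Qed.

Lemma prf_congr G n (f : prf n) v w : veqn G v w -> eqn G (Prf f v) (Prf f w).
Proof. intros H. apply (veqn_uniform H). intros us. apply repT_prf. Qed.

(** Unfolds compositions, and recursions along the visible successors of their
    first argument.  Terms with equal values are provably equal, so that
    recursion equations are checked by computation. *)
Fixpoint ev {n} (f : prf n) : Vector.t term n -> term :=
  match f in prf n return Vector.t term n -> term with
  | pZero => fun _ => Zero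
  | pSucc => fun v => suc (Vector.hd v)
  | pProj i => fun v => Vector.nth v i
  | pComp f gs => fun v => ev f (Vector.map (fun g => ev g v) gs)
  | pRec g h => fun v =>
      (fix go (t : term) : term :=
         match t with
         | Zero => ev g (Vector.tl v)
         | App FSucc u => ev h (u ::: go u ::: Vector.tl v)
         | _ => Prf (pRec g h) (t ::: Vector.tl v)
         end) (Vector.hd v)
  end.

(** As for terms, the generated principle ignores the vector of functions. *)
Lemma prf_nested_ind (P : forall n, prf n -> Prop) :
  (forall n, P n pZero) -> P 1 pSucc -> (forall n (i : Fin.t n), P n (pProj i)) ->
  (forall m n (f : prf m) (gs : Vector.t (prf n) m),
     P m f -> Vector.Forall (P n) gs -> P n (pComp f gs)) ->
  (forall n (g : prf n) h, P n g -> P _ h -> P _ (pRec g h)) ->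
  forall n f, P n f.
Proof.
  intros HZ HS HP HC HR. fix IH 2. intros n [n'| |n' i|m n' f gs|n' g h].
  - apply HZ.
  - apply HS.
  - apply HP.
  - apply HC; [apply IH|]. clear f.
    induction gs as [|g m gs IHgs]; constructor; [apply IH|apply IHgs].
  - apply HR; apply IH.
Qed.

Lemma ax_eqv t u : BIM_axiom (Eq0 t u) -> eqv t u.
Proof. intros H G. now apply prv_ax. Qed.

Lemma veqn_map G A n (F1 F2 : A -> term) (v : Vector.t A n) :
  Vector.Forall (fun a => eqn G (F1 a) (F2 a)) v ->
  veqn G (Vector.map F1 v) (Vector.map F2 v).
Proof. induction 1; simpl; constructor; auto. Qed.

Lemma ev_sound n (f : prf n) : forall v, eqv (Prf f v) (ev f v).
Proof.
  induction f using prf_nested_ind; intros v G; simpl.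
  - apply ax_eqv, ax_pZero.
  - pattern v. apply Vector.caseS'. intros t w. pattern w. apply Vector.case0.
    apply ax_eqv, ax_pSucc.
  - apply ax_eqv, ax_pProj.
  - rewrite (eqv_in G (ax_eqv (ax_pComp f gs v))).
    transitivity (Prf f (Vector.map (fun g => ev g v) gs)); [|apply IHf].
    apply prf_congr, veqn_map. eapply Vector.Forall_impl; [|exact H].
    intros g Hg. apply Hg.
  - pattern v. apply Vector.caseS'. clear v. intros t v. simpl.
    induction t as [k| |q t IHt|t IHt u IHu|m q us _] using term_nested_ind;
      try reflexivity.
    + rewrite (eqv_in G (ax_eqv (ax_pRec0 f1 f2 v))). apply IHf1.
    + destruct q; try reflexivity.
      rewrite (eqv_in G (ax_eqv (ax_pRecS f1 f2 t v))).
      transitivity (Prf f2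
       (t ::: (fix go (t : term) : term :=
         match t with
         | Zero => ev f1 v
         | App FSucc u => ev f2 (u ::: go u ::: v)
         | _ => Prf (pRec f1 f2) (t ::: v)
         end) t ::: v)); [|apply IHf2].
      apply prf_congr. constructor; [reflexivity|].
      constructor; [exact IHt|apply veqn_refl].
Qed.

Fixpoint nrm (t : term) : term :=
  match t with
  | Prf f us => ev f (Vector.map nrm us)
  | App (FPrf f) u => ev f (nrm u ::: vnil)
  | App f u => App f (nrm u)
  | Pair u v => Pair (nrm u) (nrm v)
  | _ => t
  end.

Lemma nrm_sound t : eqv t (nrm t).
Proof.
  intros G. induction t as [k| |f t IH|t IHt u IHu|m q us IH] using term_nested_ind;
    simpl; try reflexivity.
  - destruct f; try now apply app_congr.
    rewrite (eqv_in G (ax_eqv (ax_FPrf p t))).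
    transitivity (Prf p (nrm t ::: vnil)); [|apply ev_sound].
    apply prf_congr. constructor; [exact IH|constructor].
  - now apply pair_congr.
  - transitivity (Prf q (Vector.map nrm us)); [|apply ev_sound].
    apply prf_congr. rewrite <- (Vector.map_id _ _ us) at 1. now apply veqn_map.
Qed.

Lemma nrm_eqv t u : nrm t = nrm u -> eqv t u.
Proof. intros H. rewrite (nrm_sound t), (nrm_sound u), H. reflexivity. Qed.

Ltac prf_eval := intros; apply nrm_eqv; reflexivity.

(** * Elementary arithmetic *)

Notation one := (suc Zero).
Definition add t u := Prf pAdd (t ::: u ::: vnil).
Definition mul t u := Prf pMul (t ::: u ::: vnil).
Definition pow t u := Prf pPow (t ::: u ::: vnil).
Definition sub t u := Prf pSub (t ::: u ::: vnil).
Definition dist t u := Prf pDist (t ::: u ::: vnil).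
Definition pred t := Prf pPred (t ::: vnil).
Definition sg t := Prf pSg (t ::: vnil).
Definition nt t := Prf pNot (t ::: vnil).
Definition ite c t u := Prf pIf (c ::: t ::: u ::: vnil).
Definition le G t u := eqn G (sub t u) Zero.
Definition lt G t u := le G (suc t) u.
#[global] Hint Unfold add mul pow sub dist pred sg nt ite le lt : semdef.

Ltac congr_tac := intros; unfold add, mul, pow, sub, dist, pred, sg, nt, ite;
  apply prf_congr; repeat (constructor; auto).

#[global] Instance App_proper G f : Proper (eqn G ==> eqn G) (App f).
Proof. intros t u. apply app_congr. Qed.
#[global] Instance Pair_proper G :
  Proper (eqn G ==> eqn G ==> eqn G) Pair.
Proof. intros t u H t' u' H'. now apply pair_congr. Qed.
#[global] Instance add_proper G : Proper (eqn G ==> eqn G ==> eqn G) add.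
Proof. repeat intro. congr_tac. Qed.
#[global] Instance mul_proper G : Proper (eqn G ==> eqn G ==> eqn G) mul.
Proof. repeat intro. congr_tac. Qed.
#[global] Instance pow_proper G : Proper (eqn G ==> eqn G ==> eqn G) pow.
Proof. repeat intro. congr_tac. Qed.
#[global] Instance sub_proper G : Proper (eqn G ==> eqn G ==> eqn G) sub.
Proof. repeat intro. congr_tac. Qed.
#[global] Instance dist_proper G : Proper (eqn G ==> eqn G ==> eqn G) dist.
Proof. repeat intro. congr_tac. Qed.
#[global] Instance pred_proper G : Proper (eqn G ==> eqn G) pred.
Proof. repeat intro. congr_tac. Qed.
#[global] Instance sg_proper G : Proper (eqn G ==> eqn G) sg.
Proof. repeat intro. congr_tac. Qed.
#[global] Instance nt_proper G : Proper (eqn G ==> eqn G) nt.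
Proof. repeat intro. congr_tac. Qed.
#[global] Instance ite_proper G :
  Proper (eqn G ==> eqn G ==> eqn G ==> eqn G) ite.
Proof. repeat intro. congr_tac. Qed.
#[global] Instance le_proper G : Proper (eqn G ==> eqn G ==> iff) (le G).
Proof. intros t t' H u u' H'. unfold le. now rewrite H, H'. Qed.
#[global] Instance lt_proper G : Proper (eqn G ==> eqn G ==> iff) (lt G).
Proof. intros t t' H u u' H'. unfold lt. now rewrite H, H'. Qed.

Lemma add_0_l u : eqv (add Zero u) u. Proof. prf_eval. Qed.
Lemma add_S_l t u : eqv (add (suc t) u) (suc (add t u)). Proof. prf_eval. Qed.
Lemma mul_0_l u : eqv (mul Zero u) Zero. Proof. prf_eval. Qed.
Lemma mul_S_l t u : eqv (mul (suc t) u) (add (mul t u) u). Proof. prf_eval. Qed.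
Lemma pow_0_r t : eqv (pow t Zero) one. Proof. prf_eval. Qed.
Lemma pow_S_r t u : eqv (pow t (suc u)) (mul (pow t u) t). Proof. prf_eval. Qed.
Lemma pred_0 : eqv (pred Zero) Zero. Proof. prf_eval. Qed.
Lemma pred_S t : eqv (pred (suc t)) t. Proof. prf_eval. Qed.
Lemma sub_0_r t : eqv (sub t Zero) t. Proof. prf_eval. Qed.
Lemma sub_S_r t u : eqv (sub t (suc u)) (pred (sub t u)). Proof. prf_eval. Qed.
Lemma dist_def t u : eqv (dist t u) (add (sub t u) (sub u t)). Proof. prf_eval. Qed.
Lemma sg_0 : eqv (sg Zero) Zero. Proof. prf_eval. Qed.
Lemma sg_S t : eqv (sg (suc t)) one. Proof. prf_eval. Qed.
Lemma nt_0 : eqv (nt Zero) one. Proof. prf_eval. Qed.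
Lemma nt_S t : eqv (nt (suc t)) Zero. Proof. prf_eval. Qed.
Lemma ite_0 t u : eqv (ite Zero t u) t. Proof. prf_eval. Qed.
Lemma ite_S c t u : eqv (ite (suc c) t u) u. Proof. prf_eval. Qed.

#[global] Instance eqv_eqn_sub G : subrelation eqv (eqn G).
Proof. intros t u H. apply H. Qed.

(* Enters the monad [loc]. *)
Ltac here := apply ret; [typeclasses eauto|].

Lemma closed_ax A G : BIM_axiom A -> sat A Var FVar G.
Proof. intros H. now apply sat_closed, prv_ax. Qed.

Lemma suc_neq_0 G t : eqn G (suc t) Zero -> bot G.
Proof.
  intros H. assert (K := closed_ax G ax_S_neq_0). cbn in K.
  exact (mp (K t) H).
Qed.

Lemma suc_inj G t u : eqn G (suc t) (suc u) -> eqn G t u.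
Proof.
  intros H. assert (K := closed_ax G ax_S_inj). cbn in K.
  exact (mp (K t u) H).
Qed.

Lemma nat_cases G t :
  loc (fun G => eqn G t Zero \/ exists u, eqn G t (suc u)) G.
Proof.
  assert (H : loc (fun G => eqn G t Zero \/
    loc (fun G => exists u, eqn G t (suc u)) G) G).
  { induct t.
    - here. left. reflexivity.
    - here. right. here. exists t. reflexivity. }
  tdes H as [H|H].
  - here. now left.
  - tdes H as [u H]. here. right. now exists u.
Qed.

Tactic Notation "ncase" constr(t) "as" simple_intropattern(p) :=
  match goal with G : list form |- _ => tdes (nat_cases G t) as p end.

Lemma add_0_r t : eqv (add t Zero) t.
Proof.
  intros G. induct t; [apply add_0_l|]. now rewrite add_S_l, IH.
Qed.

Lemma add_S_r t u : eqv (add t (suc u)) (suc (add t u)).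
Proof.
  intros G. induct t; [now rewrite !add_0_l|]. now rewrite !add_S_l, IH.
Qed.

Lemma add_comm t u : eqv (add t u) (add u t).
Proof.
  intros G. induct t; [now rewrite add_0_l, add_0_r|].
  now rewrite add_S_l, add_S_r, IH.
Qed.

Lemma add_assoc t u v : eqv (add t (add u v)) (add (add t u) v).
Proof.
  intros G. induct t; [now rewrite !add_0_l|]. now rewrite !add_S_l, IH.
Qed.

Lemma mul_0_r t : eqv (mul t Zero) Zero.
Proof.
  intros G. induct t; [apply mul_0_l|]. now rewrite mul_S_l, IH, add_0_l.
Qed.

Lemma mul_S_r t u : eqv (mul t (suc u)) (add (mul t u) t).
Proof.
  intros G. induct t; [now rewrite !mul_0_l, add_0_l|].
  rewrite !mul_S_l, IH, !add_S_r, <- !add_assoc, (add_comm t u). reflexivity.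
Qed.

Lemma mul_comm t u : eqv (mul t u) (mul u t).
Proof.
  intros G. induct t; [now rewrite mul_0_l, mul_0_r|].
  now rewrite mul_S_l, mul_S_r, IH.
Qed.

Lemma mul_add_l t u v : eqv (mul (add t u) v) (add (mul t v) (mul u v)).
Proof.
  intros G. induct t; [now rewrite mul_0_l, !add_0_l|].
  rewrite add_S_l, !mul_S_l, IH, <- !add_assoc, (add_comm v). reflexivity.
Qed.

Lemma mul_assoc t u v : eqv (mul t (mul u v)) (mul (mul t u) v).
Proof.
  intros G. induct t; [now rewrite !mul_0_l|].
  now rewrite !mul_S_l, mul_add_l, IH.
Qed.

Lemma mul_1_l t : eqv (mul one t) t.
Proof. intros G. now rewrite mul_S_l, mul_0_l, add_0_l. Qed.

#[global] Instance add_eqv : Proper (eqv ==> eqv ==> eqv) add.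
Proof. intros t t' H u u' H' G. now rewrite (H G), (H' G). Qed.
#[global] Instance mul_eqv : Proper (eqv ==> eqv ==> eqv) mul.
Proof. intros t t' H u u' H' G. now rewrite (H G), (H' G). Qed.
#[global] Instance App_eqv f : Proper (eqv ==> eqv) (App f).
Proof. intros t t' H G. now rewrite (H G). Qed.

(** A constant of its own, so that the normalization of successors to sums stops
    at it. *)
Definition unit_tm := one.

Lemma term_semiring : semi_ring_theory Zero unit_tm add mul eqv.
Proof.
  split; intros; eauto using add_0_l, add_comm, add_assoc, mul_1_l, mul_0_l,
    mul_comm, mul_assoc, mul_add_l.
Qed.

Lemma term_semiring_ext : sring_eq_ext add mul eqv.
Proof. split; [apply add_eqv|apply mul_eqv]. Qed.

Add Ring term_ring : term_semiring (setoid eqv_equiv term_semiring_ext).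

Lemma suc_unit t : eqv (suc t) (add t unit_tm).
Proof. intros G. unfold unit_tm. now rewrite add_S_r, add_0_r. Qed.

(* Semiring identities; successors are read as sums with one. *)
Ltac tring := apply eqv_in; rewrite ?suc_unit; ring.

(** * Order *)

Lemma uniform_congr F : Uniform F -> forall G, Proper (eqn G ==> eqn G) F.
Proof.
  intros HF G t u H. apply (resp (fun x G => eqn G (F t) (F x)) (t := t)); auto.
  - rep.
  - reflexivity.
Qed.

Lemma sub_SS t u : eqv (sub (suc t) (suc u)) (sub t u).
Proof.
  intros G. induct u.
  - now rewrite sub_S_r, !sub_0_r, pred_S.
  - rewrite sub_S_r, IH. now rewrite sub_S_r.
Qed.

Lemma sub_0_l t : eqv (sub Zero t) Zero.
Proof.
  intros G. induct t; [apply sub_0_r|]. now rewrite sub_S_r, IH, pred_0.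
Qed.

Lemma sub_add_l t u : eqv (sub (add t u) t) u.
Proof.
  intros G. induct t; [now rewrite add_0_l, sub_0_r|].
  now rewrite add_S_l, sub_SS.
Qed.

Lemma sub_add_0 t u : eqv (sub t (add t u)) Zero.
Proof.
  intros G. induct t; [now rewrite add_0_l, sub_0_l|].
  now rewrite add_S_l, sub_SS.
Qed.

Lemma sub_diag t : eqv (sub t t) Zero.
Proof. intros G. rewrite <- (add_0_r t) at 2. apply sub_add_0. Qed.

(** Both sides are the maximum.  With it the truncated difference becomes a
    witness for the order. *)
Lemma add_sub t u : eqv (add t (sub u t)) (add u (sub t u)).
Proof.
  intros G. revert u. induct t.
  - intros u. now rewrite add_0_l, sub_0_r, sub_0_l, add_0_r.
  - intros u. ncase u as [E|[v E]]; rewrite E.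
    + now rewrite sub_0_l, sub_0_r, add_0_l, add_0_r.
    + now rewrite !sub_SS, !add_S_l, (IH v).
Qed.

Lemma le_intro G t u d : eqn G u (add t d) -> le G t u.
Proof. intros H. rewrite H. apply sub_add_0. Qed.

(** The witness is a term, hence exists outright and not only locally. *)
Lemma le_elim G t u : le G t u -> exists d, eqn G u (add t d).
Proof.
  intros H. exists (sub u t). rewrite add_sub. unfold le in H.
  now rewrite H, add_0_r.
Qed.

Lemma lt_elim G t u : lt G t u -> exists d, eqn G u (suc (add t d)).
Proof.
  intros H. destruct (le_elim H) as [d E]. exists d. now rewrite E, add_S_l.
Qed.

Lemma lt_intro G t u d : eqn G u (suc (add t d)) -> lt G t u.
Proof. intros H. apply (le_intro (d := d)). now rewrite add_S_l. Qed.

Lemma add_cancel G c t u : eqn G (add c t) (add c u) -> eqn G t u.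
Proof.
  intros H. rewrite <- (sub_add_l c t), H. apply sub_add_l.
Qed.

Lemma add_eq_self G t u : eqn G t (add t u) -> eqn G u Zero.
Proof.
  intros H. apply (add_cancel (c := t)). now rewrite <- H, add_0_r.
Qed.

Lemma add_eq_0 G t u : eqn G (add t u) Zero -> eqn G t Zero.
Proof.
  intros H. ncase t as [E|[v E]]; auto. rewrite E in H.
  rewrite add_S_l in H. falso. exact (suc_neq_0 H).
Qed.

Lemma le_refl G t : le G t t.
Proof. apply sub_diag. Qed.

Lemma le_trans G t u v : le G t u -> le G u v -> le G t v.
Proof.
  intros H1 H2. destruct (le_elim H1) as [d E], (le_elim H2) as [d' E'].
  apply (le_intro (d := add d d')). rewrite E', E. tring.
Qed.

Lemma zero_le G t : le G Zero t.
Proof. apply sub_0_l. Qed.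

Lemma le_S_S G t u : le G (suc t) (suc u) <-> le G t u.
Proof. unfold le. now rewrite sub_SS. Qed.

Lemma lt_S G t u : lt G t (suc u) <-> le G t u.
Proof. apply le_S_S. Qed.

Lemma lt_le G t u : lt G t u -> le G t u.
Proof.
  intros H. destruct (lt_elim H) as [d E]. apply (le_intro (d := suc d)).
  now rewrite E, add_S_r.
Qed.

Lemma lt_irrefl G t : lt G t t -> bot G.
Proof.
  intros H. destruct (lt_elim H) as [d E]. apply (suc_neq_0 (t := d)).
  apply (add_eq_self (t := t)). now rewrite add_S_r.
Qed.

Lemma lt_le_trans G t u v : lt G t u -> le G u v -> lt G t v.
Proof. apply le_trans. Qed.

Lemma le_lt_trans G t u v : le G t u -> lt G u v -> lt G t v.
Proof. intros H. apply le_trans. now apply le_S_S. Qed.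

Lemma lt_0_absurd G t : lt G t Zero -> bot G.
Proof. intros H. destruct (lt_elim H) as [d E]. apply (suc_neq_0 (symmetry E)). Qed.

Lemma le_lt_absurd G t u : le G t u -> lt G u t -> bot G.
Proof. intros H1 H2. exact (lt_irrefl (le_lt_trans H1 H2)). Qed.

Lemma le_lt_dec G t u : loc (fun G => le G t u \/ lt G u t) G.
Proof.
  revert u. induct t.
  - intros u. here. left. apply zero_le.
  - intros u. ncase u as [E|[v E]].
    + here. right. rewrite E. apply le_S_S, zero_le.
    + tdes (IH v) as [H|H]; here; [left|right]; rewrite E; now apply le_S_S.
Qed.

Lemma le_antisym G t u : le G t u -> le G u t -> eqn G t u.
Proof.
  intros H1 H2. destruct (le_elim H1) as [d E], (le_elim H2) as [d' E'].
  rewrite E in E'. rewrite <- add_assoc in E'.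
  rewrite E, (add_eq_0 (add_eq_self E')). now rewrite add_0_r.
Qed.

Lemma le_cases G t u : le G t u -> loc (fun G => lt G t u \/ eqn G t u) G.
Proof.
  intros H. tdes (le_lt_dec G u t) as [K|K]; here; auto.
  right. now apply le_antisym.
Qed.

Lemma lt_S_cases G t u : lt G t (suc u) -> loc (fun G => lt G t u \/ eqn G t u) G.
Proof. intros H. now apply le_cases, lt_S. Qed.

Lemma trichotomy G t u :
  loc (fun G => lt G t u \/ eqn G t u \/ lt G u t) G.
Proof.
  tdes (le_lt_dec G t u) as [K|K]; [|here; auto].
  tdes (le_cases K) as [K'|K']; here; auto.
Qed.

Lemma lt_neq G t u : lt G t u -> eqn G t u -> bot G.
Proof. intros H E. rewrite E in H. exact (lt_irrefl H). Qed.

Lemma dist_0 G t u : eqn G (dist t u) Zero <-> eqn G t u.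
Proof.
  rewrite dist_def. split; intros H.
  - apply le_antisym; unfold le.
    + exact (add_eq_0 H).
    + rewrite add_comm in H. exact (add_eq_0 H).
  - now rewrite H, sub_diag, add_0_l.
Qed.

Lemma neq_suc G t : imp (fun G => eqn G t Zero) bot G ->
  loc (fun G => exists u, eqn G t (suc u)) G.
Proof.
  intros H. ncase t as [E|[u E]].
  - falso. exact (mp H E).
  - here. now exists u.
Qed.

Lemma le_add_r G t u : le G t (add t u).
Proof. now apply (le_intro (d := u)). Qed.

Lemma le_add_l G t u : le G t (add u t).
Proof. rewrite add_comm. apply le_add_r. Qed.

Lemma mul_lt G c t u : lt G Zero c -> lt G t u -> lt G (mul c t) (mul c u).
Proof.
  intros Hc H. destruct (lt_elim Hc) as [d E], (lt_elim H) as [e E'].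
  apply (lt_intro (d := add (mul c e) d)). rewrite E', E. tring.
Qed.

Lemma mul_cancel G c t u : lt G Zero c -> eqn G (mul c t) (mul c u) -> eqn G t u.
Proof.
  intros Hc H. tdes (trichotomy G t u) as [L|[L|L]]; auto; falso.
  - exact (lt_neq (mul_lt Hc L) H).
  - symmetry in H. exact (lt_neq (mul_lt Hc L) H).
Qed.

(** * Divisibility *)

Definition dvd G d a := loc (fun G => exists q, eqn G a (mul d q)) G.
Definition rem a d := Prf pRem (a ::: d ::: vnil).
#[global] Hint Unfold dvd rem : semdef.
#[global] Instance rem_proper G : Proper (eqn G ==> eqn G ==> eqn G) rem.
Proof. repeat intro. unfold rem. congr_tac. Qed.

#[global] Instance dvd_proper G : Proper (eqn G ==> eqn G ==> iff) (dvd G).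
Proof.
  assert (K : forall d d' a a', eqn G d d' -> eqn G a a' -> dvd G d a -> dvd G d' a').
  { intros d d' a a' E E' H. unfold dvd in *. tdes H as [q H]. here. exists q.
    now rewrite <- E, <- E'. }
  intros d d' E a a' E'. split; apply K; auto; now symmetry.
Qed.

Lemma rem_0 d : eqv (rem Zero d) Zero. Proof. prf_eval. Qed.
Lemma rem_S a d : eqv (rem (suc a) d)
  (ite (dist (suc (rem a d)) d) Zero (suc (rem a d))).
Proof. prf_eval. Qed.

Lemma div_spec G a d : lt G Zero d ->
  loc (fun G => exists q, eqn G a (add (mul d q) (rem a d)) /\ lt G (rem a d) d) G.
Proof.
  intros Hd. induct a.
  - here. exists Zero. rewrite rem_0. split; auto. tring.
  - tdes IH as [q [E K]].
    tdes (le_cases K) as [K'|K'].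
    + assert (D : loc (fun G => exists u, eqn G (dist (suc (rem a d)) d) (suc u)) G).
      { apply neq_suc. iintro H. apply (proj1 (dist_0 _ _ _)) in H.
        exact (lt_neq K' H). }
      tdes D as [u D]. here. exists q. rewrite rem_S, D, ite_S. split; auto.
      rewrite E at 1. tring.
    (* The remainder returns to zero and the quotient moves on. *)
    + here. exists (suc q). rewrite rem_S, (proj2 (dist_0 G _ _) K'), ite_0.
      split; auto. rewrite E at 1.
      transitivity (add (mul d q) (suc (rem a d))); [tring|].
      rewrite K'. tring.
Qed.

(** By symmetry this gives equality of the quotients. *)
Lemma div_unique G d q r q' r' : lt G r d -> lt G r' d ->
  eqn G (add (mul d q) r) (add (mul d q') r') -> le G q q'.
Proof.
  intros H1 H2 E. tdes (le_lt_dec G q q') as [K|K]; auto.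
  falso. destruct (lt_elim K) as [e Ee]. apply (le_lt_absurd (t := d) (u := r')); auto.
  apply (le_intro (d := add (mul d e) r)). apply (add_cancel (c := mul d q')).
  rewrite <- E, Ee. tring.
Qed.

Lemma rem_dvd G a d : lt G Zero d -> eqn G (rem a d) Zero <-> dvd G d a.
Proof.
  intros Hd. split.
  - intros H. unfold dvd. tdes (div_spec a Hd) as [q [E _]]. here. exists q.
    now rewrite H, add_0_r in E.
  - intros H. unfold dvd in H. tdes H as [q E]. tdes (div_spec a Hd) as [q' [E' K]].
    rewrite E in E' at 1.
    assert (Q : eqn G q q').
    { apply le_antisym; [apply div_unique with (d := d) (r := Zero) (r' := rem a d)
        |apply div_unique with (d := d) (r' := Zero) (r := rem a d)]; auto;
      now rewrite add_0_r. }
    rewrite Q in E'. exact (add_eq_self E').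
Qed.

Lemma dvd_refl G d : dvd G d d.
Proof. here. exists one. tring. Qed.

Lemma dvd_trans G d e a : dvd G d e -> dvd G e a -> dvd G d a.
Proof.
  intros H1 H2. unfold dvd in *. tdes H1 as [q E]. tdes H2 as [q' E']. here.
  exists (mul q q'). rewrite E', E. tring.
Qed.

Lemma dvd_mul_l G d a b : dvd G d a -> dvd G d (mul a b).
Proof.
  intros H. unfold dvd in *. tdes H as [q E]. here. exists (mul q b). rewrite E. tring.
Qed.

Lemma dvd_mul_r G d a b : dvd G d b -> dvd G d (mul a b).
Proof. rewrite mul_comm. apply dvd_mul_l. Qed.

Lemma dvd_add_cancel G d a b :
  lt G Zero d -> dvd G d a -> dvd G d (add a b) -> dvd G d b.
Proof.
  intros Hd H1 H2. unfold dvd in *. tdes H1 as [q E]. tdes H2 as [q' E'].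
  assert (K : le G q q').
  { tdes (le_lt_dec G q q') as [K|K]; auto. destruct (lt_elim K) as [e Ee].
    falso. rewrite E, Ee in E'.
    destruct (lt_elim Hd) as [d' Ed].
    apply (suc_neq_0 (t := add d' (add (mul d e) b))).
    apply (add_eq_self (t := mul d q')). rewrite <- E' at 1. rewrite Ed. tring. }
  destruct (le_elim K) as [e Ee]. here. exists e. rewrite E, Ee in E'.
  apply (add_cancel (c := mul d q)). rewrite E'. tring.
Qed.

Lemma dvd_le G d a : lt G Zero a -> dvd G d a -> le G d a.
Proof.
  intros Ha H. unfold dvd in H. tdes H as [q E]. ncase q as [Q|[q' Q]]; rewrite Q in E.
  - rewrite mul_0_r in E. rewrite E in Ha. falso. exact (lt_irrefl Ha).
  - apply (le_intro (d := mul d q')). rewrite E. tring.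
Qed.

(** * Bounded search and products *)

(** The recursion of [pMu] in abstract form, so that it applies both to primitive
    recursive terms and to functions obtained from the axioms.  The candidate
    stops at the first zero of [F]. *)
Lemma mu_spec F R G : Uniform F -> Uniform R ->
  eqn G (R Zero) Zero ->
  (forall b, eqn G (R (suc b)) (add (R b) (sg (F (R b))))) ->
  forall b, le G (R b) b /\
    (forall i, imp (fun G => lt G i (R b) /\ eqn G (F i) Zero) bot G) /\
    loc (fun G => eqn G (R b) b \/ eqn G (F (R b)) Zero) G.
Proof.
  intros UF UR R0 RS b.
  assert (CF := uniform_congr UF). assert (CR := uniform_congr UR).
  induct b.
  - rewrite R0. split; [apply le_refl|]. split.
    + intros i. iintro [H _]. rewrite R0 in H. exact (lt_0_absurd H).
    + here. now left.
  - destruct IH as (H1 & H2 & H3). ncase (F (R b)) as [E|[u E]].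
    + assert (K : eqn G (R (suc b)) (R b)).
      { now rewrite RS, E, sg_0, add_0_r. }
      rewrite K. split; [apply le_trans with b; auto; apply lt_le, le_refl|].
      split.
      * intros i. iintro [H H']. rewrite K in H. exact (mp (H2 i) (conj H H')).
      * here. right. now rewrite K.
    + assert (K : eqn G (R (suc b)) (suc (R b))).
      { now rewrite RS, E, sg_S, add_S_r, add_0_r. }
      rewrite K. split; [now apply le_S_S|]. split.
      * intros i. iintro [H H']. rewrite K in H.
        tdes (lt_S_cases H) as [H4|H4]; [exact (mp (H2 i) (conj H4 H'))|].
        rewrite H4, E in H'. exact (suc_neq_0 H').
      * tdes H3 as [H3|H3]; [here; left; now rewrite K, H3|].
        rewrite H3 in E. falso. exact (suc_neq_0 (symmetry E)).
Qed.

Lemma mu_found F R G : Uniform F -> Uniform R ->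
  eqn G (R Zero) Zero ->
  (forall b, eqn G (R (suc b)) (add (R b) (sg (F (R b))))) ->
  forall b i, lt G i b -> eqn G (F i) Zero ->
  le G (R b) i /\ eqn G (F (R b)) Zero.
Proof.
  intros UF UR R0 RS b i Hi HF.
  destruct (mu_spec UF UR R0 RS b) as (H1 & H2 & H3).
  assert (K : le G (R b) i).
  { tdes (le_lt_dec G (R b) i) as [K|K]; auto. falso. exact (mp (H2 i) (conj K HF)). }
  split; auto. tdes H3 as [H3|H3]; auto. rewrite H3 in K. falso.
  exact (le_lt_absurd K Hi).
Qed.

Lemma map_nth_fins n (v : Vector.t term n) : Vector.map (Vector.nth v) (fins n) = v.
Proof.
  induction v as [|t n v IH]; simpl; [reflexivity|]. f_equal.
  rewrite Vector.map_map. exact IH.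
Qed.

(** The projections collected in [drop2] return the parameters. *)
Lemma drop2_args G n (xs : Vector.t term n) t u :
  veqn G (Vector.map (fun g => Prf g (t ::: u ::: xs)) drop2) xs.
Proof.
  enough (K : veqn G (Vector.map (fun g => Prf g (t ::: u ::: xs)) drop2)
    (Vector.map (Vector.nth xs) (fins n))) by now rewrite map_nth_fins in K.
  unfold drop2. rewrite Vector.map_map.
  apply veqn_map, Vector.Forall_forall. intros i _.
  exact (ax_eqv (ax_pProj (Fin.FS (Fin.FS i)) (t ::: u ::: xs)) G).
Qed.

Lemma prf_comp n m (f : prf m) gs (v : Vector.t term n) :
  eqv (Prf (pComp f gs) v) (Prf f (Vector.map (fun g => Prf g v) gs)).
Proof. apply ax_eqv, ax_pComp. Qed.

(* Unfolds compositions on the left until both sides agree, without evaluating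
   any recursion. *)
Ltac prf_match :=
  lazymatch goal with
  | |- veqn _ _ _ => constructor; prf_match
  | |- eqn ?G (Prf (pProj ?i) ?v) _ => exact (ax_eqv (ax_pProj i v) G)
  | |- eqn ?G (Prf pSucc (?t ::: _)) _ =>
    etransitivity; [exact (ax_eqv (ax_pSucc t) G)|apply app_congr; prf_match]
  | |- eqn ?G (Prf pZero ?v) _ => exact (ax_eqv (ax_pZero v) G)
  | |- eqn ?G (Prf ?f _) (Prf ?f _) => apply prf_congr; prf_match
  | |- eqn ?G (Prf (pComp ?f ?gs) ?v) _ =>
    etransitivity; [exact (prf_comp f gs v G)|cbn [Vector.map]; prf_match]
  | |- eqn ?G (Prf ?f ?v) _ => let f' := eval hnf in f in
    change (Prf f v) with (Prf f' v); prf_match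
  | |- eqn _ _ _ => reflexivity
  end.

Lemma pMu_0 n (f : prf (S n)) xs : eqv (Prf (pMu f) (Zero ::: xs)) Zero.
Proof. prf_eval. Qed.

Lemma pMu_S n (f : prf (S n)) xs b :
  eqv (Prf (pMu f) (suc b ::: xs))
    (add (Prf (pMu f) (b ::: xs))
         (sg (Prf f (Prf (pMu f) (b ::: xs) ::: xs)))).
Proof.
  intros G. unfold pMu at 1. rewrite (eqv_in G (ax_eqv (ax_pRecS _ _ _ _))).
  fold (pMu f). unfold C2, C1, add, sg.
  rewrite (prf_comp _ _ _ G). simpl. apply prf_congr.
  constructor; [apply ax_eqv, (ax_pProj (Fin.FS Fin.F1))|].
  constructor; [|constructor]. rewrite (prf_comp _ _ _ G). simpl. apply prf_congr.
  constructor; [|constructor]. rewrite (prf_comp _ _ _ G). simpl. apply prf_congr.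
  constructor; [apply ax_eqv, (ax_pProj (Fin.FS Fin.F1))|apply drop2_args].
Qed.

Lemma pProd_0 n (f : prf (S n)) xs : eqv (Prf (pProd f) (Zero ::: xs)) one.
Proof. prf_eval. Qed.

Lemma pProd_S n (f : prf (S n)) xs k :
  eqv (Prf (pProd f) (suc k ::: xs))
    (mul (Prf (pProd f) (k ::: xs)) (Prf f (k ::: xs))).
Proof.
  intros G. unfold pProd at 1. rewrite (eqv_in G (ax_eqv (ax_pRecS _ _ _ _))).
  fold (pProd f). unfold C2, mul.
  rewrite (prf_comp _ _ _ G). simpl. apply prf_congr.
  constructor; [apply ax_eqv, (ax_pProj (Fin.FS Fin.F1))|].
  constructor; [|constructor]. rewrite (prf_comp _ _ _ G). simpl. apply prf_congr.
  constructor; [apply ax_eqv, (ax_pProj Fin.F1)|apply drop2_args].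
Qed.

Lemma uniform_prf_fst n (f : prf (S n)) xs : Uniform (fun t => Prf f (t ::: xs)).
Proof. intros k m t Ht. apply repT_prf, repV_cons; [exact Ht|apply repV_const]. Qed.

Lemma pMu_found n (f : prf (S n)) xs G b i :
  lt G i b -> eqn G (Prf f (i ::: xs)) Zero ->
  let r := Prf (pMu f) (b ::: xs) in
  le G r i /\ eqn G (Prf f (r ::: xs)) Zero.
Proof.
  intros Hi HF. apply (mu_found (F := fun t => Prf f (t ::: xs))
    (R := fun b => Prf (pMu f) (b ::: xs))); auto using uniform_prf_fst.
  - apply pMu_0.
  - intros. apply pMu_S.
Qed.

Lemma pMu_least n (f : prf (S n)) xs G b i :
  lt G i (Prf (pMu f) (b ::: xs)) -> eqn G (Prf f (i ::: xs)) Zero -> bot G.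
Proof.
  intros Hi HF.
  destruct (mu_spec (F := fun t => Prf f (t ::: xs))
    (R := fun b => Prf (pMu f) (b ::: xs)) (uniform_prf_fst f xs)
    (uniform_prf_fst _ xs) (pMu_0 f xs G) (fun b => pMu_S f xs b G) b) as (_ & H & _).
  exact (mp (H i) (conj Hi HF)).
Qed.

(** * Primes *)

Notation two := (suc one).
Definition prime G p := le G two p /\
  forall d, imp (fun G => dvd G d p)
                (loc (fun G => eqn G d one \/ eqn G d p)) G.
#[global] Hint Unfold prime : semdef.

Lemma zero_lt_S G t : lt G Zero (suc t).
Proof. apply le_S_S, zero_le. Qed.

Lemma pos_suc G t : lt G Zero t -> exists u, eqn G t (suc u).
Proof. intros H. destruct (lt_elim H) as [d E]. exists d. now rewrite E, add_0_l. Qed.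

Lemma prime_pos G p : prime G p -> lt G Zero p.
Proof. intros [H _]. apply lt_le_trans with two; auto. apply zero_lt_S. Qed.

Lemma prime_congr G p q : eqn G p q -> prime G p -> prime G q.
Proof.
  intros E. apply (resp (fun p G => prime G p) (t := p)); auto. rep.
Qed.

Lemma prime_ndvd_one G p : prime G p -> dvd G p one -> bot G.
Proof.
  intros Hp H. apply (lt_irrefl (t := one)). apply le_trans with p; [apply Hp|].
  apply dvd_le; auto. apply zero_lt_S.
Qed.

(** Descent: if [p] divides [a * b] with 0 < a < p, it also divides [r * b] for
    the remainder [r] of [p] by [a], and [r] is smaller than [a], and positive
    unless a = 1. *)
Lemma euclid_small G p b : prime G p -> forall n a,
  imp (fun G => lt G a n /\ lt G Zero a /\ lt G a p /\ dvd G p (mul a b))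
      (fun G => dvd G p b) G.
Proof.
  intros Hp n. induct n; intros a; iintro (H1 & H2 & H3 & H4).
  - falso. exact (lt_0_absurd H1).
  - tdes (div_spec p H2) as [q [E K]].
    ncase (rem p a) as [Z|[u Z]].
    + rewrite Z, add_0_r in E.
      assert (D : dvd G a p) by (here; now exists q).
      tdes (mp (proj2 Hp a) D) as [D'|D'].
      * now rewrite D', mul_1_l in H4.
      * falso. exact (lt_neq H3 D').
    + apply (mp (IH (rem p a))). split; [|split; [|split]].
      * apply lt_le_trans with a; auto. now apply lt_S.
      * rewrite Z. apply zero_lt_S.
      * now apply le_lt_trans with a; [apply lt_le|].
      * apply dvd_add_cancel with (mul q (mul a b)).
        -- now apply prime_pos.
        -- now apply dvd_mul_r.
        -- assert (E' : eqn G (add (mul q (mul a b)) (mul (rem p a) b)) (mul p b)).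
           { rewrite E at 2. tring. }
           rewrite E'. apply dvd_mul_l, dvd_refl.
Qed.

(** Reduces [a] modulo [p] and applies the descent to the remainder. *)
Lemma euclid G p a b : prime G p -> dvd G p (mul a b) ->
  loc (fun G => dvd G p a \/ dvd G p b) G.
Proof.
  intros Hp H. assert (Pp := prime_pos Hp).
  tdes (div_spec a Pp) as [q [E K]].
  ncase (rem a p) as [Z|[u Z]]; here.
  - left. now apply rem_dvd.
  - right. apply (mp (euclid_small b Hp p (rem a p))). repeat split; auto.
    + rewrite Z. apply zero_lt_S.
    + apply dvd_add_cancel with (mul p (mul q b)); auto.
      * apply dvd_mul_l, dvd_refl.
      * assert (E' : eqn G (add (mul p (mul q b)) (mul (rem a p) b)) (mul a b)).
        { rewrite E at 2. tring. }
        now rewrite E'.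
Qed.

Lemma prime_dvd_pow G p a e : prime G p ->
  imp (fun G => dvd G p (pow a e)) (fun G => dvd G p a) G.
Proof.
  intros Hp. induct e; iintro H.
  - rewrite pow_0_r in H. falso. exact (prime_ndvd_one Hp H).
  - rewrite pow_S_r in H. tdes (euclid Hp H) as [K|K]; auto.
    exact (mp IH K).
Qed.

Definition lfactor t := Prf pLeastFactor (t ::: vnil).
Definition fact t := Prf pFact (t ::: vnil).
Definition nextprime t := Prf pNextPrime (t ::: vnil).
Definition pr t := Prf pPrime (t ::: vnil).
#[global] Hint Unfold lfactor fact nextprime pr : semdef.
#[global] Instance lfactor_proper G : Proper (eqn G ==> eqn G) lfactor.
Proof. repeat intro. unfold lfactor. congr_tac. Qed.
#[global] Instance pr_proper G : Proper (eqn G ==> eqn G) pr.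
Proof. repeat intro. unfold pr. congr_tac. Qed.

Definition factor_test : prf 2 := C2 pRem arg1 (C1 pSucc (C1 pSucc arg0)).

Lemma lfactor_def t : eqv (lfactor t)
  (suc (suc (Prf (pMu factor_test) (t ::: t ::: vnil)))).
Proof. prf_eval. Qed.

Lemma factor_test_def i t :
  eqv (Prf factor_test (i ::: t ::: vnil)) (rem t (suc (suc i))).
Proof. prf_eval. Qed.

(** A proper divisor of the least factor would be a smaller factor. *)
Lemma lfactor_spec G t : le G two t -> prime G (lfactor t) /\ dvd G (lfactor t) t.
Proof.
  intros Ht. destruct (le_elim Ht) as [i Ei].
  assert (Ei' : eqn G t (suc (suc i))) by (rewrite Ei; tring).
  destruct (@pMu_found _ factor_test (t ::: vnil) G t i) as [_ H].
  { rewrite Ei'. apply lt_S, lt_le, le_refl. }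
  { rewrite factor_test_def, <- Ei'. apply rem_dvd, dvd_refl.
    rewrite Ei'. apply zero_lt_S. }
  rewrite factor_test_def, <- lfactor_def in H.
  assert (P : lt G Zero (lfactor t)) by (rewrite lfactor_def; apply zero_lt_S).
  assert (D : dvd G (lfactor t) t) by now apply rem_dvd. split; auto. split.
  { rewrite lfactor_def. apply le_S_S, le_S_S, zero_le. }
  intros d. iintro Hd. assert (L := dvd_le P Hd).
  assert (Dt := dvd_trans Hd D).
  ncase d as [E|[e E]].
  - rewrite E in Hd. unfold dvd in Hd. tdes Hd as [q Q]. rewrite mul_0_l in Q.
    rewrite Q in P. falso. exact (lt_irrefl P).
  - ncase e as [E'|[e' E']]; rewrite E' in E; [here; now left|].
    tdes (le_cases L) as [K|K]; [|here; now right].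
    falso. rewrite E, lfactor_def in K.
    apply (pMu_least (f := factor_test) (xs := t ::: vnil) (b := t) (i := e')).
    + exact (proj1 (le_S_S _ _ _) (proj1 (le_S_S _ _ _) K)).
    + rewrite factor_test_def, <- E. apply rem_dvd; auto. rewrite E. apply zero_lt_S.
Qed.

Lemma lfactor_prime G p : prime G p -> eqn G (lfactor p) p.
Proof.
  intros Hp. destruct (lfactor_spec (proj1 Hp)) as [P D].
  tdes (mp (proj2 Hp _) D) as [K|K]; auto.
  falso. rewrite lfactor_def in K. exact (suc_neq_0 (suc_inj K)).
Qed.

Lemma fact_pos G t : lt G Zero (fact t).
Proof.
  induct t.
  - assert (E : eqv (fact Zero) one) by prf_eval. rewrite E. apply zero_lt_S.
  - assert (E : eqv (fact (suc t)) (mul (suc t) (fact t))) by prf_eval.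
    rewrite E. rewrite mul_S_l. apply lt_le_trans with (fact t); auto. apply le_add_l.
Qed.

Lemma dvd_fact G t d : imp (fun G => lt G Zero d /\ le G d t)
  (fun G => dvd G d (fact t)) G.
Proof.
  induct t; iintro [H1 H2].
  - falso. exact (le_lt_absurd H2 H1).
  - assert (E : eqv (fact (suc t)) (mul (suc t) (fact t))) by prf_eval.
    rewrite E. tdes (le_cases H2) as [K|K].
    + apply dvd_mul_r, (mp IH). split; auto. now apply lt_S.
    + rewrite K. apply dvd_mul_l, dvd_refl.
Qed.

Definition prime_test : prf 2 := C1 pNonPrime (C2 pAdd (C1 pSucc arg1) arg0).

Lemma nextprime_def t : eqv (nextprime t)
  (add (suc t) (Prf (pMu prime_test) (suc (fact t) ::: t ::: vnil))).
Proof. prf_eval. Qed.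

Lemma prime_test_def i t : eqv (Prf prime_test (i ::: t ::: vnil))
  (dist (lfactor (add (suc t) i)) (add (suc t) i)).
Proof. prf_eval. Qed.

(** Euclid's argument: the least factor of [t! + 1] is a prime above [t], and it
    lies within the range of the search. *)
Lemma nextprime_spec G t : prime G (nextprime t) /\ lt G t (nextprime t).
Proof.
  assert (N : le G two (suc (fact t))) by apply le_S_S, fact_pos.
  destruct (lfactor_spec N) as [P D].
  assert (L : lt G t (lfactor (suc (fact t)))).
  { tdes (le_lt_dec G (lfactor (suc (fact t))) t) as [K|K]; auto. falso.
    apply (prime_ndvd_one P). apply dvd_add_cancel with (fact t).
    - now apply prime_pos.
    - apply (mp (dvd_fact G t _)). split; auto. now apply prime_pos.
    - now rewrite add_S_r, add_0_r. }
  destruct (lt_elim L) as [i Ei]. rewrite <- add_S_l in Ei.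
  destruct (@pMu_found _ prime_test (t ::: vnil) G (suc (fact t)) i) as [_ H].
  { apply lt_le_trans with (lfactor (suc (fact t))).
    - rewrite Ei, add_S_l. apply lt_S, le_add_l.
    - apply dvd_le; auto. apply zero_lt_S. }
  { rewrite prime_test_def, <- Ei. apply dist_0. now apply lfactor_prime. }
  rewrite prime_test_def, <- nextprime_def in H.
  apply (proj1 (dist_0 _ _ _)) in H. split.
  - apply (prime_congr H), lfactor_spec. rewrite <- H, lfactor_def.
    apply le_S_S, le_S_S, zero_le.
  - rewrite nextprime_def. apply le_add_r.
Qed.

Lemma pr_S t : eqv (pr (suc t)) (nextprime (pr t)).
Proof. prf_eval. Qed.

Lemma pr_prime G t : prime G (pr t).
Proof.
  induct t.
  - assert (E : eqv (pr Zero) (lfactor two)) by prf_eval.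
    apply (prime_congr (symmetry (E G))), lfactor_spec, le_refl.
  - apply (prime_congr (symmetry (pr_S t G))), nextprime_spec.
Qed.

Lemma pr_lt_S G t : lt G (pr t) (pr (suc t)).
Proof. rewrite pr_S. apply nextprime_spec. Qed.

Lemma pr_lt G i j : imp (fun G => lt G i j) (fun G => lt G (pr i) (pr j)) G.
Proof.
  induct j; iintro H.
  - falso. exact (lt_0_absurd H).
  - tdes (lt_S_cases H) as [K|K].
    + apply le_lt_trans with (pr j); [|apply pr_lt_S]. apply lt_le, (mp IH K).
    + rewrite K. apply pr_lt_S.
Qed.

(** Needed because the search for the length of a code [s] stops at s + 1. *)
Lemma lt_pr G i : lt G i (pr i).
Proof.
  induct i.
  - apply prime_pos, pr_prime.
  - apply le_lt_trans with (pr i); auto. apply pr_lt_S.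
Qed.

Lemma pr_dvd_pr G i j : dvd G (pr i) (pr j) -> eqn G i j.
Proof.
  intros H. tdes (mp (proj2 (pr_prime G j) _) H) as [K|K].
  - falso. apply (prime_ndvd_one (pr_prime G i)). rewrite K. apply dvd_refl.
  - tdes (trichotomy G i j) as [L|[L|L]]; auto; falso.
    + exact (lt_neq (mp (pr_lt G _ _) L) K).
    + exact (lt_neq (mp (pr_lt G _ _) L) (symmetry K)).
Qed.

(** * Codes of finite sequences *)

Lemma lt_pow G d e : le G two d -> lt G e (pow d e).
Proof.
  intros Hd. destruct (le_elim Hd) as [c Ec]. induct e.
  - rewrite pow_0_r. apply zero_lt_S.
  - rewrite pow_S_r. apply lt_le_trans with (add (pow d e) (pow d e)).
    + destruct (lt_elim IH) as [x Ex]. apply (lt_intro (d := add e (add x x))).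
      rewrite Ex. tring.
    + apply (le_intro (d := mul (pow d e) c)). rewrite Ec at 2. tring.
Qed.

Lemma pow_pos G d e : lt G Zero d -> lt G Zero (pow d e).
Proof.
  intros Hd. induct e.
  - rewrite pow_0_r. apply zero_lt_S.
  - rewrite pow_S_r. destruct (lt_elim Hd) as [x Ex], (lt_elim IH) as [y Ey].
    apply (lt_intro (d := add (mul x y) (add x y))). rewrite Ey, Ex. tring.
Qed.

Lemma pow_dvd_pow G d e f : le G e f -> dvd G (pow d e) (pow d f).
Proof.
  intros H. destruct (le_elim H) as [x Ex]. clear H.
  assert (K : forall x, dvd G (pow d e) (pow d (add e x))).
  { clear x Ex f. intros x. induct x.
    - rewrite add_0_r. apply dvd_refl.
    - rewrite add_S_r, pow_S_r. now apply dvd_mul_l. }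
  now rewrite Ex.
Qed.

Definition expo d t := Prf pExpo (d ::: t ::: vnil).
#[global] Hint Unfold expo : semdef.
#[global] Instance expo_proper G : Proper (eqn G ==> eqn G ==> eqn G) expo.
Proof. repeat intro. unfold expo. congr_tac. Qed.

Definition expo_test : prf 3 := C1 pNot (C2 pRem arg2 (C2 pPow arg1 (C1 pSucc arg0))).

Lemma expo_def d t :
  eqv (expo d t) (Prf (pMu expo_test) (t ::: d ::: t ::: vnil)).
Proof. prf_eval. Qed.

Lemma expo_test_def i d t : eqv (Prf expo_test (i ::: d ::: t ::: vnil))
  (nt (rem t (pow d (suc i)))).
Proof. prf_eval. Qed.

(** The first exponent that fails is found by cancelling the power of [d]. *)
Lemma expo_spec G d e t u : le G two d -> eqn G t (mul (pow d e) u) ->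
  imp (fun G => dvd G d u) bot G -> eqn G (expo d t) e.
Proof.
  intros Hd E H.
  assert (Pd : lt G Zero d) by (apply lt_le_trans with two; auto; apply zero_lt_S).
  assert (Pe := pow_pos e Pd).
  assert (L : lt G e t).
  { apply lt_le_trans with (pow d e); [now apply lt_pow|].
    ncase u as [U|[v U]].
    - falso. apply (mp H). rewrite U. here. exists Zero. now rewrite mul_0_r.
    - apply (le_intro (d := mul (pow d e) v)). rewrite E, U. tring. }
  destruct (@pMu_found _ expo_test (d ::: t ::: vnil) G t e L) as [K R].
  { rewrite expo_test_def.
    ncase (rem t (pow d (suc e))) as [R|[v R]]; [|now rewrite R, nt_S].
    falso. apply rem_dvd in R; [|now apply pow_pos]. apply (mp H).
    unfold dvd in *. tdes R as [q Q]. here. exists q.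
    apply (mul_cancel Pe). rewrite <- E, Q, pow_S_r. tring. }
  rewrite expo_test_def, <- expo_def in R. rewrite <- expo_def in K.
  tdes (le_cases K) as [K'|K']; auto. falso.
  assert (D : dvd G (pow d (suc (expo d t))) (mul (pow d e) u)).
  { now apply dvd_mul_l, pow_dvd_pow. }
  rewrite <- E in D.
  apply rem_dvd in D; [|now apply pow_pos]. rewrite D, nt_0 in R.
  exact (suc_neq_0 R).
Qed.

Definition len s := Prf pLength (s ::: vnil).
Definition entry s i := Prf pEntry (s ::: i ::: vnil).
Definition len_upto b s := Prf pLengthUpto (b ::: s ::: vnil).
#[global] Hint Unfold len entry len_upto : semdef.
#[global] Instance len_proper G : Proper (eqn G ==> eqn G) len.
Proof. repeat intro. unfold len. congr_tac. Qed.
#[global] Instance entry_proper G : Proper (eqn G ==> eqn G ==> eqn G) entry.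
Proof. repeat intro. unfold entry. congr_tac. Qed.
#[global] Instance len_upto_proper G : Proper (eqn G ==> eqn G ==> eqn G) len_upto.
Proof. repeat intro. unfold len_upto. congr_tac. Qed.

Lemma len_def s : eqv (len s) (len_upto (suc s) s).
Proof. intros G. unfold len, len_upto. prf_match. Qed.
Lemma len_upto_0 s : eqv (len_upto Zero s) Zero. Proof. prf_eval. Qed.
Lemma len_upto_S b s : eqv (len_upto (suc b) s)
  (ite (rem (suc s) (pr b)) (suc b) (len_upto b s)).
Proof.
  intros G. unfold len_upto at 1, pLengthUpto at 1.
  rewrite (eqv_in G (ax_eqv (ax_pRecS _ _ _ _))).
  fold pLengthUpto. unfold ite, rem, pr, len_upto. prf_match.
Qed.

Lemma len_le G s : le G (len s) (suc s).
Proof.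
  rewrite len_def. generalize (suc s). intros b. induct b.
  - rewrite len_upto_0. apply le_refl.
  - rewrite len_upto_S. ncase (rem (suc s) (pr b)) as [E|[u E]]; rewrite E.
    + rewrite ite_0. apply le_refl.
    + rewrite ite_S. apply le_trans with b; auto. apply lt_le, le_refl.
Qed.

(** The search runs upwards and keeps the last prime index that divides. *)
Lemma len_spec G s k :
  loc (fun G => eqn G k Zero \/ exists j, eqn G k (suc j) /\ dvd G (pr j) (suc s)) G ->
  (forall j, imp (fun G => le G k j /\ dvd G (pr j) (suc s)) bot G) ->
  eqn G (len s) k.
Proof.
  intros H1 H2.
  assert (K : eqn G (len_upto k s) k).
  { tdes H1 as [E|[j [E D]]]; rewrite E; [apply len_upto_0|].
    rewrite len_upto_S. apply rem_dvd in D; [|apply prime_pos, pr_prime].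
    now rewrite D, ite_0. }
  assert (K' : forall d, eqn G (len_upto (add k d) s) k).
  { intros d. induct d; [now rewrite add_0_r|].
    rewrite add_S_r, len_upto_S.
    ncase (rem (suc s) (pr (add k d))) as [E|[u E]].
    - falso. apply (mp (H2 (add k d))). split; [apply le_add_r|].
      apply rem_dvd; auto. apply prime_pos, pr_prime.
    - now rewrite E, ite_S. }
  assert (L : le G k (suc s)).
  { tdes H1 as [E|[j [E D]]]; rewrite E; [apply zero_le|].
    apply le_trans with (pr j); [apply lt_pr|]. apply dvd_le; auto. apply zero_lt_S. }
  destruct (le_elim L) as [d Ed]. rewrite len_def, Ed. apply K'.
Qed.

Lemma entry_def s i : eqv (entry s i)
  (sub (expo (pr i) (suc s)) (nt (dist (suc i) (len s)))).
Proof. intros G. unfold entry, sub, expo, nt, dist, pr, len. prf_match. Qed.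

Definition prime_powers {n} (f : prf (S n)) : prf (S n) :=
  pProd (C2 pPow (C1 pPrime arg0) f).

Lemma prime_power_def n (f : prf (S n)) xs i :
  eqv (Prf (C2 pPow (C1 pPrime arg0) f) (i ::: xs)) (pow (pr i) (Prf f (i ::: xs))).
Proof.
  intros G. unfold C2. rewrite (prf_comp _ _ _ G). simpl. apply prf_congr.
  constructor; [|constructor; [reflexivity|constructor]].
  unfold C1. rewrite (prf_comp _ _ _ G). simpl. apply prf_congr.
  constructor; [|constructor]. apply ax_eqv, (ax_pProj Fin.F1).
Qed.

Lemma prime_powers_0 n (f : prf (S n)) xs :
  eqv (Prf (prime_powers f) (Zero ::: xs)) one.
Proof. apply pProd_0. Qed.

Lemma prime_powers_S n (f : prf (S n)) xs k :
  eqv (Prf (prime_powers f) (suc k ::: xs))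
    (mul (Prf (prime_powers f) (k ::: xs)) (pow (pr k) (Prf f (k ::: xs)))).
Proof.
  intros G. unfold prime_powers. rewrite (pProd_S _ _ _ G).
  now rewrite (prime_power_def f xs k G).
Qed.

Lemma prf_fst_congr n (f : prf (S n)) xs G t u :
  eqn G t u -> eqn G (Prf f (t ::: xs)) (Prf f (u ::: xs)).
Proof. intros H. apply prf_congr. constructor; auto. apply veqn_refl. Qed.

Lemma prime_powers_pos n (f : prf (S n)) xs G k :
  lt G Zero (Prf (prime_powers f) (k ::: xs)).
Proof.
  induct k.
  - rewrite (prime_powers_0 f xs G). apply zero_lt_S.
  - rewrite (prime_powers_S f xs k G).
    assert (P := pow_pos (Prf f (k ::: xs)) (prime_pos (pr_prime G k))).
    destruct (lt_elim P) as [x Ex], (lt_elim IH) as [y Ey].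
    apply (lt_intro (d := add (mul x y) (add x y))). rewrite Ey, Ex. tring.
Qed.

(** A prime dividing a product of powers of smaller primes would be one of them,
    by Euclid's lemma. *)
Lemma prime_powers_ndvd n (f : prf (S n)) xs G k j :
  imp (fun G => le G k j /\ dvd G (pr j) (Prf (prime_powers f) (k ::: xs))) bot G.
Proof.
  induct k; iintro [L D].
  - rewrite (prime_powers_0 f xs G) in D. exact (prime_ndvd_one (pr_prime G j) D).
  - rewrite (prime_powers_S f xs k G) in D.
    tdes (euclid (pr_prime G j) D) as [K|K].
    + apply (mp IH). split; auto. apply lt_le. exact L.
    + assert (E := pr_dvd_pr (mp (prime_dvd_pow _ _ (pr_prime G j)) K)).
      exact (lt_neq L (symmetry E)).
Qed.

(** Isolates the contribution of one prime; the other factors are powers of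
    different primes. *)
Lemma prime_powers_split n (f : prf (S n)) xs G i k :
  imp (fun G => lt G i k) (loc (fun G => exists m,
    eqn G (Prf (prime_powers f) (k ::: xs)) (mul (pow (pr i) (Prf f (i ::: xs))) m)
    /\ imp (fun G => dvd G (pr i) m) bot G)) G.
Proof.
  induct k; iintro L.
  - falso. exact (lt_0_absurd L).
  - tdes (lt_S_cases L) as [K|K].
    + assert (H := mp IH K). tdes H as [m [E H]]. here.
      exists (mul m (pow (pr k) (Prf f (k ::: xs)))). split.
      * rewrite (prime_powers_S f xs k G), E. tring.
      * iintro D. tdes (euclid (pr_prime G i) D) as [D'|D'].
        -- exact (mp H D').
        -- assert (E' := pr_dvd_pr (mp (prime_dvd_pow _ _ (pr_prime G i)) D')).
           exact (lt_neq K E').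
    + here. exists (Prf (prime_powers f) (i ::: xs)). split.
      * rewrite (prf_fst_congr (prime_powers f) xs (symmetry (app_congr FSucc K))).
        rewrite (prime_powers_S f xs i G). apply mul_comm.
      * iintro D. apply (mp (prime_powers_ndvd f xs G i i)). split; auto.
        apply le_refl.
Qed.

Lemma pCode_0 n (f : prf (S n)) xs : eqv (Prf (pCode f) (Zero ::: xs)) Zero.
Proof. prf_eval. Qed.

(** The factor p(k) marks the length k + 1; the truncated predecessor in the code
    is harmless since the product is positive. *)
Lemma pCode_S n (f : prf (S n)) xs k :
  eqv (suc (Prf (pCode f) (suc k ::: xs)))
      (mul (pr k) (Prf (prime_powers f) (suc k ::: xs))).
Proof.
  intros G.
  assert (E : eqn G (Prf (pCode f) (suc k ::: xs))
    (pred (mul (pr k) (Prf (prime_powers f) (suc k ::: xs))))).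
  { unfold pCode, C3, C1, C2. rewrite (prf_comp _ _ _ G). simpl.
    rewrite <- (ite_S k Zero
      (pred (mul (pr k) (Prf (prime_powers f) (suc k ::: xs)))) G).
    apply prf_congr. constructor; [apply ax_eqv, (ax_pProj Fin.F1)|].
    constructor; [apply ax_eqv, ax_pZero|]. constructor; [|constructor].
    rewrite (prf_comp _ _ _ G). simpl. apply prf_congr.
    constructor; [|constructor]. rewrite (prf_comp _ _ _ G). simpl. apply prf_congr.
    constructor; [|constructor; [reflexivity|constructor]].
    apply nrm_eqv. reflexivity. }
  rewrite E.
  assert (P := mul_lt (prime_pos (pr_prime G k)) (prime_powers_pos f xs G (suc k))).
  rewrite mul_0_r in P. destruct (pos_suc P) as [u U]. now rewrite U, pred_S.
Qed.

Lemma code_len n (f : prf (S n)) xs G k : eqn G (len (Prf (pCode f) (k ::: xs))) k.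
Proof.
  ncase k as [E|[j E]].
  - apply len_spec; [here; now left|]. intros j. iintro [L D].
    rewrite (prf_fst_congr (pCode f) xs E), (pCode_0 f xs G) in D.
    exact (prime_ndvd_one (pr_prime G j) D).
  - assert (S := app_congr FSucc (prf_fst_congr (pCode f) xs E)).
    rewrite (pCode_S f xs j G) in S.
    apply len_spec.
    + here. right. exists j. split; auto. rewrite S. apply dvd_mul_l, dvd_refl.
    + intros i. iintro [L D]. rewrite S in D.
      tdes (euclid (pr_prime G i) D) as [K|K].
      * assert (E' := pr_dvd_pr K). rewrite E, E' in L. exact (lt_irrefl L).
      * apply (mp (prime_powers_ndvd f xs G (suc j) i)). split; auto. now rewrite <- E.
Qed.

(** The last entry is read from an exponent that the marker of the length has
    increased by one, and [entry_def] takes that one off again. *)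
Lemma code_entry n (f : prf (S n)) xs G k i : lt G i k ->
  eqn G (entry (Prf (pCode f) (k ::: xs)) i) (Prf f (i ::: xs)).
Proof.
  intros L. rewrite entry_def, (code_len f xs G k).
  ncase k as [E|[j E]]; [rewrite E in L; falso; exact (lt_0_absurd L)|].
  assert (S := app_congr FSucc (prf_fst_congr (pCode f) xs E)).
  rewrite (pCode_S f xs j G) in S. rewrite S. rewrite E in L |- *.
  assert (H := mp (prime_powers_split f xs G i (suc j)) L).
  tdes H as [m [M H]]. assert (P2 := proj1 (pr_prime G i)).
  tdes (lt_S_cases L) as [K|K].
  - assert (X : eqn G (expo (pr i) (mul (pr j) (Prf (prime_powers f) (suc j ::: xs))))
      (Prf f (i ::: xs))).
    { apply (expo_spec (u := mul (pr j) m)); auto.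
      - rewrite M. tring.
      - iintro D. tdes (euclid (pr_prime G i) D) as [D'|D'].
        + exact (lt_neq K (pr_dvd_pr D')).
        + exact (mp H D'). }
    rewrite X.
    assert (D : loc (fun G => exists u, eqn G (dist (suc i) (suc j)) (suc u)) G).
    { apply neq_suc. iintro D. apply (proj1 (dist_0 _ _ _)) in D.
      exact (lt_neq K (suc_inj D)). }
    tdes D as [u D]. now rewrite D, nt_S, sub_0_r.
  - assert (X : eqn G (expo (pr i) (mul (pr j) (Prf (prime_powers f) (suc j ::: xs))))
      (suc (Prf f (i ::: xs)))).
    { apply (expo_spec (u := m)); auto. rewrite M, <- K, pow_S_r. tring. }
    rewrite X, (proj2 (dist_0 G (suc i) (suc j)) (app_congr FSucc K)), nt_0.
    now rewrite sub_SS, sub_0_r.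
Qed.

Definition single t := Prf pSingle (t ::: vnil).
Definition concat s t := Prf pConcat (s ::: t ::: vnil).
#[global] Hint Unfold single concat : semdef.
#[global] Instance single_proper G : Proper (eqn G ==> eqn G) single.
Proof. repeat intro. unfold single. congr_tac. Qed.
#[global] Instance concat_proper G : Proper (eqn G ==> eqn G ==> eqn G) concat.
Proof. repeat intro. unfold concat. congr_tac. Qed.

Lemma single_def t : eqv (single t) (Prf (pCode arg1) (one ::: t ::: vnil)).
Proof. intros G. unfold single. prf_match. Qed.

Lemma len_single G t : eqn G (len (single t)) one.
Proof. rewrite single_def. apply code_len. Qed.

Lemma entry_single G t : eqn G (entry (single t) Zero) t.
Proof.
  rewrite single_def, code_entry by apply le_refl.
  apply ax_eqv, (ax_pProj (Fin.FS Fin.F1)).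
Qed.

Definition concat_entry : prf 3 :=
  C3 pIf (C2 pSub (C1 pSucc arg0) (C1 pLength arg1))
     (C2 pEntry arg1 arg0)
     (C2 pEntry arg2 (C2 pSub arg0 (C1 pLength arg1))).

Lemma concat_def s t : eqv (concat s t)
  (Prf (pCode concat_entry) (add (len s) (len t) ::: s ::: t ::: vnil)).
Proof. intros G. unfold concat, concat_entry, add, len. prf_match. Qed.

Lemma concat_entry_def i s t : eqv (Prf concat_entry (i ::: s ::: t ::: vnil))
  (ite (sub (suc i) (len s)) (entry s i) (entry t (sub i (len s)))).
Proof. intros G. unfold ite, sub, entry, len. prf_match. Qed.

Lemma len_concat G s t : eqn G (len (concat s t)) (add (len s) (len t)).
Proof. rewrite concat_def. apply code_len. Qed.

Lemma entry_concat_l G s t i : lt G i (len s) ->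
  eqn G (entry (concat s t) i) (entry s i).
Proof.
  intros H. rewrite concat_def, code_entry, concat_entry_def.
  - unfold lt, le in H. now rewrite H, ite_0.
  - apply lt_le_trans with (len s); auto. apply le_add_r.
Qed.

Lemma entry_concat_r G s t i : lt G i (len t) ->
  eqn G (entry (concat s t) (add (len s) i)) (entry t i).
Proof.
  intros H. destruct (lt_elim H) as [d Ed].
  rewrite concat_def, code_entry, concat_entry_def.
  - rewrite <- add_S_r, !sub_add_l. now rewrite ite_S.
  - apply (lt_intro (d := d)). rewrite Ed at 1. tring.
Qed.

(** * Comprehension *)

Notation K t := (App FK t).
Notation L t := (App FL t).

Lemma K_pair t u : eqv (K (Pair t u)) t.
Proof. intros G. exact (closed_ax G ax_K t u). Qed.
Lemma L_pair t u : eqv (L (Pair t u)) u.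
Proof. intros G. exact (closed_ax G ax_L t u). Qed.
Lemma Id_eq t : eqv (App FId t) t.
Proof. intros G. exact (closed_ax G ax_Id t). Qed.
Lemma Zero_eq t : eqv (App FZero t) Zero.
Proof. intros G. exact (closed_ax G ax_Zero t). Qed.

(** The context is arbitrary, so that closure properties may be used at any point
    of an argument. *)
Definition Comp (F : term -> term) : Prop := forall G,
  loc (fun G => exists c, forall x, eqn G (App c x) (F x)) G.

Lemma comp_id : Comp (fun x => x).
Proof. intros G. here. exists FId. intros x. apply Id_eq. Qed.

Lemma comp_fun f F : Comp F -> Comp (fun x => App f (F x)).
Proof.
  intros H G. tdes (H G) as [c Hc].
  assert (A := closed_ax G ax_comp f c). cbn in A. tdes A as [d Hd].
  here. exists d. intros x. rewrite (Hd x). now rewrite Hc.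
Qed.

Lemma comp_pair F1 F2 : Comp F1 -> Comp F2 -> Comp (fun x => Pair (F1 x) (F2 x)).
Proof.
  intros H1 H2 G. tdes (H1 G) as [c Hc]. tdes (H2 G) as [d Hd].
  assert (A := closed_ax G ax_pair c d). cbn in A. tdes A as [e He].
  here. exists e. intros x. rewrite (He x). now rewrite Hc, Hd.
Qed.

(** A constant function is found by induction on the constant, since BIM has no
    abstraction over numbers. *)
Lemma comp_const t : Comp (fun _ => t).
Proof.
  intros G. induct t.
  - here. exists FZero. intros x. apply Zero_eq.
  - tdes IH as [c Hc]. assert (A := closed_ax G ax_comp FSucc c). cbn in A.
    tdes A as [d Hd]. here. exists d. intros x. rewrite (Hd x). now rewrite Hc.
Qed.

#[global] Instance mono_veqn n (v w : Vector.t term n) : Mono (fun G => veqn G v w).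
Proof.
  intros G G' L H. induction H; constructor; auto. exact (mono_eqn L H).
Qed.

Definition apps {n} (cs : Vector.t fterm n) (x : term) : Vector.t term n :=
  Vector.map (fun c => App c x) cs.

Lemma nth_apps n (cs : Vector.t fterm n) i x :
  Vector.nth (apps cs x) i = App (Vector.nth cs i) x.
Proof. unfold apps. now rewrite (Vector.nth_map _ cs i i eq_refl). Qed.

Lemma comp_funs n (cs : Vector.t fterm n) d G :
  loc (fun G => exists ds, forall x y, imp (fun G => eqn G (App d x) y)
    (fun G => veqn G (apps ds x) (apps cs y)) G) G.
Proof.
  induction cs as [|c n cs IH].
  - here. exists (Vector.nil _). intros x y. iintro _. constructor.
  - tdes IH as [ds Hds]. assert (A := closed_ax G ax_comp c d). cbn in A.
    tdes A as [e He]. here. exists (Vector.cons _ e _ ds). intros x y. iintro H.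
    constructor; [|exact (mp (Hds x y) H)]. rewrite (He x). now rewrite H.
Qed.

(** By recursion on the function symbol.  For a recursion, [ax_rec] is used with
    one parameter [x] that stands for all arguments; the functions for the step
    recover them from the nested pair ((x,k),z). *)
Lemma comp_prim n (f : prf n) : forall G (cs : Vector.t fterm n),
  loc (fun G => exists c, forall x, eqn G (App c x) (Prf f (apps cs x))) G.
Proof.
  induction f as [n| |n i|m n f gs IHf IHgs|n g h IHg IHh]
    using prf_nested_ind; intros G cs.
  - here. exists FZero. intros x. rewrite (ax_eqv (ax_pZero _) G). apply Zero_eq.
  - pattern cs. apply Vector.caseS'. intros c cs'. pattern cs'. apply Vector.case0.
    assert (A := closed_ax G ax_comp FSucc c). cbn in A. tdes A as [d Hd].
    here. exists d. intros x. rewrite (Hd x). symmetry. apply ax_eqv, ax_pSucc.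
  - here. exists (Vector.nth cs i). intros x.
    rewrite (ax_eqv (ax_pProj i (apps cs x)) G), nth_apps. reflexivity.
  - assert (H : loc (fun G => exists ds, forall x,
      veqn G (apps ds x) (Vector.map (fun g => Prf g (apps cs x)) gs)) G).
    { clear f IHf. induction IHgs as [|k g gs Hg _ IH].
      - here. exists (Vector.nil _). intros x. constructor.
      - tdes IH as [ds Hds]. tdes (Hg G cs) as [d Hd].
        here. exists (Vector.cons _ d _ ds). intros x.
        constructor; [apply Hd|apply Hds]. }
    tdes H as [ds Hds]. tdes (IHf G ds) as [c Hc]. here. exists c. intros x.
    rewrite (Hc x), (prf_comp f gs (apps cs x) G). apply prf_congr, Hds.
  - pattern cs. apply Vector.caseS'. clear cs. intros c cs.
    assert (A := closed_ax G ax_comp FL FK). cbn in A. tdes A as [lk Hlk].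
    assert (A := closed_ax G ax_comp FK FK). cbn in A. tdes A as [kk Hkk].
    tdes (comp_funs cs kk G) as [ds Hds].
    tdes (IHg G cs) as [a Ha].
    tdes (IHh G (Vector.cons _ lk _ (Vector.cons _ FL _ ds))) as [b Hb].
    assert (A := closed_ax G ax_rec a b). cbn in A. tdes A as [r Hr].
    assert (A := closed_ax G ax_pair FId c). cbn in A. tdes A as [p Hp].
    assert (A := closed_ax G ax_comp r p). cbn in A. tdes A as [d Hd].
    here. exists d. intros x. rewrite (Hd x), (Hp x), Id_eq. simpl.
    generalize (App c x). intros k. induct k.
    + rewrite (proj1 (Hr x Zero)), (Ha x). symmetry. apply ax_eqv, ax_pRec0.
    + rewrite (proj2 (Hr x k)), (Hb _).
      rewrite (ax_eqv (ax_pRecS g h k (apps cs x)) G).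
      apply prf_congr. simpl. constructor; [|constructor].
      * rewrite (Hlk _). now rewrite K_pair, L_pair.
      * rewrite L_pair. exact IH.
      * apply (mp (Hds _ _)). rewrite (Hkk _). now rewrite !K_pair.
Qed.

Definition CompV n (F : term -> Vector.t term n) : Prop := forall G,
  loc (fun G => exists cs, forall x, veqn G (apps cs x) (F x)) G.

Lemma compV_nil : CompV (fun _ => vnil).
Proof. intros G. here. exists (Vector.nil _). intros x. constructor. Qed.

Lemma compV_cons n F (Fs : term -> Vector.t term n) :
  Comp F -> CompV Fs -> CompV (fun x => F x ::: Fs x).
Proof.
  intros H1 H2 G. tdes (H1 G) as [c Hc]. tdes (H2 G) as [cs Hcs].
  here. exists (Vector.cons _ c _ cs). intros x. constructor; [apply Hc|apply Hcs].
Qed.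

Lemma comp_prf n (f : prf n) Fs : CompV Fs -> Comp (fun x => Prf f (Fs x)).
Proof.
  intros H G. tdes (H G) as [cs Hcs]. tdes (comp_prim f G cs) as [c Hc].
  here. exists c. intros x. rewrite (Hc x). apply prf_congr, Hcs.
Qed.

Ltac comp_step :=
  cbv beta;
  lazymatch goal with
  | |- Comp (fun _ => ?t) => apply comp_const
  | |- Comp (fun x => x) => apply comp_id
  | |- Comp (fun _ => App _ _) => apply comp_fun
  | |- Comp (App _) => apply (comp_fun _ comp_id)
  | |- Comp (Pair ?t) => apply (comp_pair (comp_const t) comp_id)
  | |- Comp (fun _ => Pair _ _) => apply comp_pair
  | |- Comp (fun _ => Prf _ _) => apply comp_prf
  | |- CompV (fun _ => Vector.nil _) => apply compV_nil
  | |- CompV (fun _ => Vector.cons _ _ _ _) => apply compV_cons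
  end.
Ltac comp := autounfold with semdef; solve [repeat comp_step].

(** ** Characteristic functions *)

Definition equi (P Q : hprop) (G : ctx) : Prop := imp P Q G /\ imp Q P G.
#[global] Hint Unfold equi : semdef.
#[global] Instance mono_equi P Q : Mono (equi P Q).
Proof. unfold equi. apply mono_and; apply mono_imp. Qed.

(** Zero is the value for truth, which suits the form of the choice axiom. *)
Definition Char (P : term -> hprop) : Prop := forall G,
  loc (fun G => exists c, forall x, equi (fun G => eqn G (App c x) Zero) (P x) G) G.

Lemma char_of_comp (P : term -> hprop) F : Comp F ->
  (forall x G, equi (fun G => eqn G (F x) Zero) (P x) G) -> Char P.
Proof.
  intros HF HP G. tdes (HF G) as [c Hc]. here. exists c. intros x.
  destruct (HP x G) as [H1 H2]. split; iintro H.
  - apply (mp H1). now rewrite <- Hc.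
  - rewrite (Hc x). exact (mp H2 H).
Qed.

Lemma char_eqn F1 F2 : Comp F1 -> Comp F2 -> Char (fun x G => eqn G (F1 x) (F2 x)).
Proof.
  intros H1 H2. apply char_of_comp with (fun x => dist (F1 x) (F2 x)).
  - apply comp_prf. repeat apply compV_cons; auto. apply compV_nil.
  - intros x G. split; iintro H; now apply dist_0.
Qed.

Lemma char_dec (P : term -> hprop) : Char P -> (forall x, Mono (P x)) -> forall x G,
  loc (fun G => P x G \/ imp (P x) bot G) G.
Proof.
  intros HP HM x G. tdes (HP G) as [c Hc]. destruct (Hc x) as [H1 H2].
  ncase (App c x) as [E|[u E]]; here.
  - left. exact (mp H1 E).
  - right. iintro H. assert (E' := mp H2 H). cbv beta in E'.
    rewrite E in E'. exact (suc_neq_0 E').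
Qed.

Lemma char_and P Q : Char P -> Char Q -> Char (fun x G => P x G /\ Q x G).
Proof.
  intros HP HQ G. tdes (HP G) as [c Hc]. tdes (HQ G) as [d Hd].
  tdes ((ltac:(comp) : Comp (fun x => add (App c x) (App d x))) G) as [e He].
  here. exists e. intros x. destruct (Hc x) as [C1 C2], (Hd x) as [D1 D2].
  split; [iintro H|iintro [H1 H2]].
  - rewrite (He x) in H. split.
    + apply (mp C1). exact (add_eq_0 H).
    + apply (mp D1). rewrite add_comm in H. exact (add_eq_0 H).
  - now rewrite (He x), (mp C2 H1), (mp D2 H2), add_0_l.
Qed.

Lemma char_or P Q : Char P -> Char Q ->
  (forall x, Mono (P x)) -> (forall x, Mono (Q x)) ->
  Char (fun x G => loc (fun G => P x G \/ Q x G) G).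
Proof.
  intros HP HQ MP MQ G. tdes (HP G) as [c Hc]. tdes (HQ G) as [d Hd].
  tdes ((ltac:(comp) : Comp (fun x => mul (App c x) (App d x))) G) as [e He].
  here. exists e. intros x. destruct (Hc x) as [C1 C2], (Hd x) as [D1 D2].
  split; iintro H.
  - rewrite (He x) in H. ncase (App c x) as [E|[u E]].
    + here. left. exact (mp C1 E).
    + ncase (App d x) as [E'|[v E']].
      * here. right. exact (mp D1 E').
      * rewrite E, E', mul_S_l, add_S_r in H. falso. exact (suc_neq_0 H).
  - rewrite (He x). tdes H as [H|H].
    + now rewrite (mp C2 H), mul_0_l.
    + now rewrite (mp D2 H), mul_0_r.
Qed.

(** The product of the negated first function with the second; this is where the
    decidability of the first proposition enters. *)
Lemma char_imp P Q : Char P -> Char Q ->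
  (forall x, Mono (P x)) -> (forall x, Stable (Q x)) -> Char (fun x => imp (P x) (Q x)).
Proof.
  intros HP HQ MP SQ G. tdes (HP G) as [c Hc]. tdes (HQ G) as [d Hd].
  tdes ((ltac:(comp) : Comp (fun x => mul (nt (App c x)) (App d x))) G) as [e He].
  here. exists e. intros x. destruct (Hc x) as [C1 C2], (Hd x) as [D1 D2].
  split; iintro H.
  - iintro H'. rewrite (He x), (mp C2 H'), nt_0, mul_1_l in H. exact (mp D1 H).
  - rewrite (He x). ncase (App c x) as [E|[u E]].
    + now rewrite (mp D2 (mp H (mp C1 E))), mul_0_r.
    + now rewrite E, nt_S, mul_0_l.
Qed.

Lemma char_bot : Char (fun _ => bot).
Proof.
  intros G. tdes (comp_const one G) as [c Hc]. here. exists c.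
  intros x. split; iintro H.
  - rewrite (Hc x) in H. exact (suc_neq_0 H).
  - now falso.
Qed.

(** Minimization as in [mu_spec], for a matrix that is given by a function and
    therefore not available to primitive recursive symbols. *)
Lemma bounded_search c G : loc (fun G => exists r, forall x b,
  equi (fun G => lt G (App r (Pair x b)) b)
       (loc (fun G => exists i, lt G i b /\ eqn G (App c (Pair x i)) Zero)) G /\
  imp (fun G => lt G (App r (Pair x b)) b)
      (fun G => eqn G (App c (Pair x (App r (Pair x b)))) Zero) G) G.
Proof.
  tdes ((ltac:(comp) : Comp (fun y =>
    add (L y) (sg (App c (Pair (K (K y)) (L y)))))) G) as [d Hd].
  assert (A := closed_ax G ax_rec FZero d). cbn in A. tdes A as [r Hr].
  assert (R0 : forall x, eqn G (App r (Pair x Zero)) Zero).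
  { intros x. rewrite (proj1 (Hr x Zero)). apply Zero_eq. }
  assert (RS : forall x b, eqn G (App r (Pair x (suc b)))
    (add (App r (Pair x b)) (sg (App c (Pair x (App r (Pair x b))))))).
  { intros x b. rewrite (proj2 (Hr x b)), (Hd _).
    now rewrite !L_pair, !K_pair. }
  clear Hr Hd. here. exists r. intros x b.
  assert (U : forall f, Uniform (fun i => App f (Pair x i))).
  { intros f n m t Ht. rep_step; rep_step; [rep_step..|exact Ht]. }
  assert (UF := U c). assert (UR := U r).
  destruct (mu_spec UF UR (R0 x) (RS x) b) as (_ & _ & H3).
  split; [split|]; iintro H.
  - tdes H3 as [H3|H3].
    + falso. exact (lt_neq H H3).
    + here. eauto.
  - tdes H as [i [H1 H2]].
    destruct (mu_found UF UR (R0 x) (RS x) H1 H2) as [H4 _].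
    exact (le_lt_trans H4 H1).
  - tdes H3 as [H3|H3]; auto. falso. exact (lt_neq H H3).
Qed.

Lemma char_equi P Q : Char P -> (forall x G, equi (P x) (Q x) G) -> Char Q.
Proof.
  intros HP H G. tdes (HP G) as [c Hc]. here. exists c. intros x.
  destruct (Hc x) as [H1 H2], (H x G) as [H3 H4]. split; iintro H'.
  - exact (mp H3 (mp H1 H')).
  - exact (mp H2 (mp H4 H')).
Qed.

(** A binary predicate has its characteristic function on codes of pairs, and
    respects the equations between a pair and its components. *)
Lemma char_pair (P : term -> term -> hprop) c G :
  (forall i, Rep 1 0 (fun e0 _ => P (e0 0) i)) ->
  (forall x, Rep 1 0 (fun e0 _ => P x (e0 0))) ->
  (forall x i, Mono (P x i)) ->
  (forall y, equi (fun G => eqn G (App c y) Zero) (P (K y) (L y)) G) ->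
  forall x i, equi (fun G => eqn G (App c (Pair x i)) Zero) (P x i) G.
Proof.
  intros R1 R2 MP Hc x i. destruct (Hc (Pair x i)) as [H1 H2]. split; iintro H.
  - apply (resp (P x) (R2 x) (L_pair x i G)).
    apply (resp (fun y => P y (L (Pair x i))) (R1 _) (K_pair x i G)).
    exact (mp H1 H).
  - apply (mp H2). apply (resp (P _) (R2 _) (symmetry (L_pair x i G))).
    apply (resp (fun y => P y i) (R1 _) (symmetry (K_pair x i G))). exact H.
Qed.

Lemma char_bex (P : term -> term -> hprop) b :
  Char (fun y => P (K y) (L y)) -> Comp b ->
  (forall i, Rep 1 0 (fun e0 _ => P (e0 0) i)) ->
  (forall x, Rep 1 0 (fun e0 _ => P x (e0 0))) ->
  (forall x i, Mono (P x i)) ->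
  Char (fun x => loc (fun G => exists i, lt G i (b x) /\ P x i G)).
Proof.
  intros HP Hb R1 R2 MP G. tdes (HP G) as [c Hc]. tdes (Hb G) as [d Hd].
  tdes (bounded_search c G) as [r Hr].
  assert (HP' := char_pair P R1 R2 MP Hc).
  tdes ((ltac:(comp) : Comp (fun x =>
    sub (suc (App r (Pair x (App d x)))) (App d x))) G) as [e He].
  here. exists e. intros x. destruct (Hr x (App d x)) as [[H1 H2] _].
  split; iintro H.
  - rewrite (He x) in H. assert (H3 := mp H1 H). tdes H3 as [i [H3 H4]].
    here. exists i. rewrite <- (Hd x). split; auto. exact (mp (proj1 (HP' x i)) H4).
  - rewrite (He x). apply (mp H2). tdes H as [i [H3 H4]]. here. exists i.
    rewrite (Hd x). split; auto. exact (mp (proj2 (HP' x i)) H4).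
Qed.

Lemma char_dec2 (P : term -> term -> hprop) :
  Char (fun y => P (K y) (L y)) ->
  (forall i, Rep 1 0 (fun e0 _ => P (e0 0) i)) ->
  (forall x, Rep 1 0 (fun e0 _ => P x (e0 0))) ->
  (forall x i, Mono (P x i)) ->
  forall x i G, loc (fun G => P x i G \/ imp (P x i) bot G) G.
Proof.
  intros HP R1 R2 MP x i G. tdes (HP G) as [c Hc].
  destruct (char_pair P R1 R2 MP Hc x i) as [H1 H2].
  ncase (App c (Pair x i)) as [E|[u E]]; here.
  - left. exact (mp H1 E).
  - right. iintro H. assert (E' := mp H2 H). cbv beta in E'. rewrite E in E'.
    exact (suc_neq_0 E').
Qed.

(** Bounded universal quantification is the negation of a bounded search for a
    counterexample, by decidability of the matrix. *)
Lemma char_ball (P : term -> term -> hprop) b :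
  Char (fun y => P (K y) (L y)) -> Comp b ->
  (forall i, Rep 1 0 (fun e0 _ => P (e0 0) i)) ->
  (forall x, Rep 1 0 (fun e0 _ => P x (e0 0))) ->
  (forall x i, Mono (P x i)) -> (forall x i, Stable (P x i)) ->
  Char (fun x G => forall i, imp (fun G => lt G i (b x)) (P x i) G).
Proof.
  intros HP Hb R1 R2 MP SP.
  apply char_equi with (fun x => imp (loc (fun G => exists i, lt G i (b x) /\
    imp (P x i) bot G)) bot).
  - apply char_imp; [|apply char_bot|typeclasses eauto..].
    apply (char_bex (fun x i => imp (P x i) bot)); auto.
    + apply char_imp; [exact HP|apply char_bot|typeclasses eauto..].
    + intros i. apply rep_imp; [apply R1|apply rep_bot].
    + intros x. apply rep_imp; [apply R2|apply rep_bot].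
    + typeclasses eauto.
  - intros x G. split; iintro H.
    + intros i. iintro Hi. tdes (char_dec2 P HP R1 R2 MP x i G) as [D|D]; auto.
      falso. apply (mp H). here. eauto.
    + iintro H'. tdes H' as [i [H1 H2]]. apply (mp H2). exact (mp (H i) H1).
Qed.

Ltac char_step :=
  cbv beta;
  lazymatch goal with
  | |- Char (fun _ _ => bot _) => exact char_bot
  | |- Char (fun _ => bot) => exact char_bot
  | |- Char (fun _ _ => le _ _ _) => unfold le
  | |- Char (fun _ _ => lt _ _ _) => unfold lt, le
  | |- Char (fun _ _ => eqn _ _ _) => apply char_eqn; [comp|comp]
  | |- Char (fun _ _ => _ /\ _) => apply char_and
  | |- Char (fun _ => loc (fun _ => _ \/ _)) =>
    apply char_or; [| |intros; typeclasses eauto..]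
  | |- Char (fun _ _ => loc (fun _ => _ \/ _) _) =>
    apply char_or; [| |intros; typeclasses eauto..]
  | |- Char (fun _ => imp _ _) => apply char_imp; [| |intros; typeclasses eauto..]
  | |- Char (fun _ _ => imp _ _ _) => apply char_imp; [| |intros; typeclasses eauto..]
  | |- Char (fun _ => loc (fun _ => exists i, lt _ _ _ /\ _)) =>
    apply char_bex; [|comp|intros; rep|intros; rep|intros; typeclasses eauto]
  | |- Char (fun _ _ => loc (fun _ => exists i, lt _ _ _ /\ _) _) =>
    apply char_bex; [|comp|intros; rep|intros; rep|intros; typeclasses eauto]
  | |- Char (fun _ _ => forall i, imp _ _ _) =>
    apply char_ball; [|comp|intros; rep|intros; rep|intros; typeclasses eauto..]
  end.
Ltac char := solve [repeat char_step].

(** The constant predicate [exists i < b, P i] has a characteristic function. *)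
Lemma bounded_dec (P : term -> hprop) b :
  Char P -> Rep 1 0 (fun e0 _ => P (e0 0)) -> (forall x, Mono (P x)) ->
  forall G, loc (fun G => loc (fun G => exists i, lt G i b /\ P i G) G \/
    forall i, imp (fun G => lt G i b) (imp (P i) bot) G) G.
Proof.
  intros HP HR HM G. tdes (HP G) as [c Hc].
  assert (D : Char (fun _ : term => loc (fun G => exists i, lt G i b /\
    eqn G (App c i) Zero))) by char.
  tdes (char_dec D _ Zero G) as [H|H]; here; [left|right].
  - tdes H as [i [H1 H2]]. here. exists i. split; auto. exact (mp (proj1 (Hc i)) H2).
  - intros i. iintro H1. iintro H2. apply (mp H). here. exists i. split; auto.
    exact (mp (proj2 (Hc i)) H2).
Qed.

(** Decidability reduces the statement to the quantifier-free axiom. *)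
Lemma choice (P : term -> term -> hprop) :
  Char (fun y => P (K y) (L y)) ->
  (forall i, Rep 1 0 (fun e0 _ => P (e0 0) i)) ->
  (forall x, Rep 1 0 (fun e0 _ => P x (e0 0))) ->
  (forall x i, Mono (P x i)) ->
  forall G, (forall x, loc (fun G => exists i, P x i G) G) ->
  loc (fun G => exists c, forall x, P x (App c x) G) G.
Proof.
  intros HP R1 R2 MP G H. tdes (HP G) as [c Hc].
  assert (HP' := char_pair P R1 R2 MP Hc).
  assert (A := closed_ax G ax_choice c). cbn in A.
  assert (H' : forall x, loc (fun G => exists i, eqn G (App c (Pair x i)) Zero) G).
  { intros x. tdes (H x) as [i Hi]. here. exists i. exact (mp (proj2 (HP' x i)) Hi). }
  assert (A' := mp A H'). tdes A' as [d Hd]. here. exists d. intros x.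
  exact (mp (proj1 (HP' x (App d x))) (Hd x)).
Qed.

(** * The fan theorem and the contraposed axiom of choice *)

Definition codes (c : fterm) (n s : term) : hprop := fun G =>
  eqn G (len s) n /\
  forall i, imp (fun G => lt G i n) (fun G => eqn G (entry s i) (App c i)) G.
Definition bin (c : fterm) : hprop := fun G => forall n, lt G (App c n) two.
Definition bar (B : term -> hprop) : hprop := fun G =>
  forall c, imp (bin c) (loc (fun G => exists n,
    loc (fun G => exists s, codes c n s G /\ B s G) G)) G.
Definition nonzero (t : term) : hprop := imp (fun G => eqn G t Zero) bot.
Definition in_D (b : fterm) (s : term) : hprop := nonzero (App b s).
Definition in_Dnum (u s : term) : hprop := fun G =>
  lt G s (len u) /\ nonzero (entry u s) G.
Definition fin_bar (b : fterm) : hprop :=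
  loc (fun G => exists m, loc (fun G => exists u, codes b m u G /\
    bar (in_Dnum u) G) G).
Definition sec (a : fterm) (k n : term) : term := App a (concat (single k) n).
Definition in_E (a : fterm) (n : term) : hprop :=
  loc (fun G => exists p, eqn G (sec a one p) (suc n)).
Definition ac_premise (a : fterm) : hprop := fun G =>
  forall c, loc (fun G => exists n,
    imp (fun G => le G (App c n) (sec a Zero n)) (in_E a (Pair n (App c n))) G) G.
Definition ac_conclusion (a : fterm) : hprop :=
  loc (fun G => exists n, forall i,
    imp (fun G => le G i (sec a Zero n)) (in_E a (Pair n i)) G).

#[global] Hint Unfold codes bin bar nonzero in_D in_Dnum fin_bar sec in_E
  ac_premise ac_conclusion : semdef.

Lemma nonzero_suc G t : nonzero t G -> loc (fun G => exists u, eqn G t (suc u)) G.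
Proof. exact (@neq_suc G t). Qed.

Lemma suc_nonzero G t u : eqn G t (suc u) -> nonzero t G.
Proof. intros E. iintro H. rewrite E in H. exact (suc_neq_0 H). Qed.

Lemma len_snoc G s v : eqn G (len (concat s (single v))) (suc (len s)).
Proof. rewrite len_concat, len_single. now rewrite add_S_r, add_0_r. Qed.

Lemma entry_snoc G s v : eqn G (entry (concat s (single v)) (len s)) v.
Proof.
  rewrite <- (add_0_r (len s)), entry_concat_r, entry_single; [reflexivity|].
  rewrite len_single. apply zero_lt_S.
Qed.

Lemma codes_snoc G c n s v : codes c n s G -> eqn G v (App c n) ->
  codes c (suc n) (concat s (single v)) G.
Proof.
  intros [H1 H2] E. split; [now rewrite len_snoc, H1|].
  intros i. iintro L. tdes (lt_S_cases L) as [L'|L'].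
  - rewrite entry_concat_l by now rewrite H1. exact (mp (H2 i) L').
  - rewrite L', <- E, <- H1. apply entry_snoc.
Qed.

Lemma codes_nil G c : codes c Zero Zero G.
Proof.
  assert (E := code_len (@pZero 1) vnil G Zero). rewrite (pCode_0 _ _ G) in E.
  split; auto. intros i. iintro H. falso. exact (lt_0_absurd H).
Qed.

Lemma codes_ex c n G : loc (fun G => exists s, codes c n s G) G.
Proof.
  induct n.
  - here. exists Zero. apply codes_nil.
  - tdes IH as [s H]. here. exists (concat s (single (App c n))).
    now apply codes_snoc.
Qed.

(** ** From the fan theorem to choice *)

(** The number at most [m] that a row of a binary matrix codes.  The last value
    [m] is coded by the absence of an earlier mark, so that every row codes a
    number. *)
Definition select (v : term -> term) (n m i : term) : hprop := fun G =>
  le G i m /\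
  (forall j, imp (fun G => lt G j i) (fun G => eqn G (v (Pair n j)) Zero) G) /\
  loc (fun G => eqn G i m \/ nonzero (v (Pair n i)) G) G.

(** A search through the row, by induction on the length of the part searched. *)
Lemma select_ex d n m G : loc (fun G => exists i, select (App d) n m i G) G.
Proof.
  assert (H : forall k, loc (fun G =>
    (forall j, imp (fun G => lt G j k) (fun G => eqn G (App d (Pair n j)) Zero) G)
    \/ loc (fun G => exists i, lt G i k /\
      (forall j, imp (fun G => lt G j i) (fun G => eqn G (App d (Pair n j)) Zero) G)
      /\ nonzero (App d (Pair n i)) G) G) G).
  { intros k. induct k.
    - here. left. intros j. iintro H. falso. exact (lt_0_absurd H).
    - tdes IH as [IH|IH].
      + ncase (App d (Pair n k)) as [E|[u E]]; here; [left|right].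
        * intros j. iintro H. tdes (lt_S_cases H) as [H'|H'].
          -- exact (mp (IH j) H').
          -- now rewrite H'.
        * here. exists k. split; [apply le_refl|]. split; auto.
          exact (suc_nonzero E).
      + here. right. tdes IH as [i [H1 H2]]. here. exists i. split; auto.
        apply lt_le_trans with k; auto. apply lt_le, le_refl. }
  tdes (H m) as [H'|H'].
  - here. exists m. split; [apply le_refl|]. split; auto. here. left. reflexivity.
  - tdes H' as [i [H1 [H2 H3]]]. here. exists i. split; [now apply lt_le|].
    split; auto. here. now right.
Qed.

Lemma pair_bound n k G :
  loc (fun G => exists b, forall j,
    imp (fun G => lt G j k) (fun G => lt G (Pair n j) b) G) G.
Proof.
  induct k.
  - here. exists Zero. intros j. iintro H. falso. exact (lt_0_absurd H).
  - tdes IH as [b Hb]. here. exists (add b (suc (Pair n k))).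
    intros j. iintro H. tdes (lt_S_cases H) as [H'|H'].
    + apply lt_le_trans with b; [exact (mp (Hb j) H')|apply le_add_r].
    + rewrite H'. apply le_add_l.
Qed.

(** The test on [s] that defines the bar.  The positions of the row [n] have to
    lie below the length of [s], so that the number selected in it is final. *)
Definition decided (a : fterm) (s : term) : hprop :=
  loc (fun G => exists n, lt G n (len s) /\
  loc (fun G => exists p, lt G p (len s) /\
  loc (fun G => exists i, lt G i (suc (sec a Zero n)) /\
    ((forall j, imp (fun G => lt G j (suc (sec a Zero n)))
                    (fun G => lt G (Pair n j) (len s)) G) /\
     (forall j, imp (fun G => lt G j i)
                    (fun G => eqn G (entry s (Pair n j)) Zero) G) /\
     loc (fun G => eqn G i (sec a Zero n) \/
                   imp (fun G => eqn G (entry s (Pair n i)) Zero) bot G) G /\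
     eqn G (sec a one p) (suc (Pair n i)))) G) G).

Lemma char_decided a : Char (decided a).
Proof. unfold decided, sec. char. Qed.

Lemma char_in_D (P : term -> hprop) : Char P -> forall G,
  loc (fun G => exists b, forall s, equi (in_D b s) (P s) G) G.
Proof.
  intros HP G. tdes (HP G) as [c Hc].
  tdes ((ltac:(comp) : Comp (fun s => nt (App c s))) G) as [b Hb].
  here. exists b. intros s. destruct (Hc s) as [H1 H2]. split; iintro H.
  - apply (mp H1). ncase (App c s) as [E|[u E]]; auto. falso. apply (mp H).
    now rewrite (Hb s), E, nt_S.
  - apply (suc_nonzero (u := Zero)). now rewrite (Hb s), (mp H2 H), nt_0.
Qed.

Lemma nt_lt_two G t : lt G (nt t) two.
Proof.
  ncase t as [E|[u E]]; rewrite E.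
  - rewrite nt_0. apply le_refl.
  - rewrite nt_S. apply zero_lt_S.
Qed.

(** The selections of a binary sequence form a choice function, to which the
    premise applies; a long initial part of the sequence shows the outcome. *)
Lemma bar_decided a b G : (forall s, equi (in_D b s) (decided a s) G) ->
  ac_premise a G -> bar (in_D b) G.
Proof.
  intros Hb P d. iintro _.
  assert (C : Char (fun y => select (App d) (K y) (sec a Zero (K y)) (L y))).
  { unfold select, nonzero, sec. char. }
  assert (C' := choice (fun n => select (App d) n (sec a Zero n)) C).
  tdes (C' ltac:(intros; unfold select; rep) ltac:(intros; unfold select; rep)
    ltac:(intros; unfold select; typeclasses eauto) G
    (fun n => select_ex d n (sec a Zero n) G)) as [g Hg].
  tdes (P g) as [n Hn]. destruct (Hg n) as (S1 & S2 & S3).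
  assert (E := mp Hn S1). tdes E as [p Ep].
  tdes (pair_bound n (suc (sec a Zero n)) G) as [N HN].
  tdes (codes_ex d (add N (suc (add n p))) G) as [s [Ls Es]].
  here. exists (add N (suc (add n p))). here. exists s. split; [now split|].
  apply (mp (proj2 (Hb s))).
  assert (Kn : lt G n (len s)).
  { rewrite Ls. apply (lt_intro (d := add N p)). tring. }
  assert (Kp : lt G p (len s)).
  { rewrite Ls. apply (lt_intro (d := add N n)). tring. }
  assert (KN : forall j, imp (fun G => le G j (sec a Zero n))
    (fun G => lt G (Pair n j) (len s)) G).
  { intros j. iintro Hj. apply lt_le_trans with N; [|rewrite Ls; apply le_add_r].
    apply (mp (HN j)). now apply lt_S. }
  assert (KE : forall j, imp (fun G => le G j (sec a Zero n))
    (fun G => eqn G (entry s (Pair n j)) (App d (Pair n j))) G).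
  { intros j. iintro Hj. apply (mp (Es _)). rewrite <- Ls. exact (mp (KN j) Hj). }
  here. exists n. split; auto. here. exists p. split; auto.
  here. exists (App g n). split; [now apply lt_S|]. split; [|split; [|split]]; auto.
  - intros j. iintro Hj. apply (mp (KN j)). now apply lt_S.
  - intros j. iintro Hj. rewrite (mp (KE j) (le_trans (lt_le Hj) S1)).
    exact (mp (S2 j) Hj).
  - tdes S3 as [S3|S3]; here; [now left|right].
    iintro H. apply (mp S3). rewrite <- H. symmetry. exact (mp (KE _) S1).
Qed.

(** Stages below [b] have not shown the pair to be in E.  Rows from [b] on carry no
    condition, so that every row may have such a number. *)
Definition bad (a : fterm) (b n i : term) : hprop := fun G =>
  le G i (sec a Zero n) /\
  imp (fun G => lt G n b) (fun G => forall p, imp (fun G => lt G p b)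
    (imp (fun G => eqn G (sec a one p) (suc (Pair n i))) bot) G) G.

(** A bounded search through the rows below [b], whose success is the conclusion
    of the choice principle. *)
Lemma choice_or_bad a b G : loc (fun G => ac_conclusion a G \/
  forall n, loc (fun G => exists i, bad a b n i G) G) G.
Proof.
  assert (C : Char (fun n G => forall i, imp (fun G => lt G i (suc (sec a Zero n)))
    (loc (fun G => exists p, lt G p b /\ eqn G (sec a one p) (suc (Pair n i)))) G)).
  { unfold sec. char. }
  tdes (bounded_dec b C ltac:(rep) ltac:(typeclasses eauto) G) as [H|H];
    here; [left|right].
  - tdes H as [n [_ H]]. here. exists n. intros i. iintro Hi.
    assert (Hi' : lt G i (suc (sec a Zero n))) by now apply lt_S.
    assert (H' := mp (H i) Hi'). tdes H' as [p [_ Ep]]. here. now exists p.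
  - intros n. tdes (le_lt_dec G b n) as [Hn|Hn].
    { here. exists Zero. split; [apply zero_le|]. iintro Hn'. intros p. iintro _.
      iintro _. exact (le_lt_absurd Hn Hn'). }
    assert (Cb : Char (fun i G => forall p, imp (fun G => lt G p b)
      (imp (fun G => eqn G (sec a one p) (suc (Pair n i))) bot) G)).
    { unfold sec. char. }
    tdes (bounded_dec (suc (sec a Zero n)) Cb ltac:(rep) ltac:(typeclasses eauto) G)
      as [D|D].
    + tdes D as [i [Hi Hp]]. here. exists i. split; [now apply lt_S|].
      iintro _. exact Hp.
    + falso. apply (mp (mp (H n) Hn)). intros i. iintro Hi.
      assert (Ci : Char (fun p G => eqn G (sec a one p) (suc (Pair n i)))).
      { unfold sec. char. }
      tdes (bounded_dec b Ci ltac:(rep) ltac:(typeclasses eauto) G) as [B|B]; auto.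
      falso. exact (mp (mp (D i) Hi) B).
Qed.

(** Suppose that each row has a bad number, chosen by [g].  The matrix with a
    single 1 in each row, at the place given by [g], is binary, hence passes
    through the finite bar; the node met there has seen a selected, thus bad,
    number. *)
Lemma choice_of_fin_bar a b G : (forall s, equi (in_D b s) (decided a s) G) ->
  fin_bar b G -> ac_conclusion a G.
Proof.
  intros Hb F. unfold fin_bar in F. tdes F as [m F]. tdes F as [u [[Lu Eu] Hu]].
  tdes (choice_or_bad a m G) as [H|H]; auto. falso.
  assert (C : Char (fun y => bad a m (K y) (L y))).
  { unfold bad, sec. char. }
  tdes (choice (bad a m) C ltac:(intros; unfold bad; rep)
    ltac:(intros; unfold bad; rep)
    ltac:(intros; unfold bad; typeclasses eauto) H) as [g Hg].
  (* The characteristic function of the graph of [g]. *)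
  tdes ((ltac:(comp) : Comp (fun y => nt (dist (L y) (App g (K y))))) G) as [d Hd].
  assert (Bd : bin d G).
  { intros y. rewrite (Hd y). apply nt_lt_two. }
  assert (Hk := mp (Hu d) Bd). tdes Hk as [k Hk]. tdes Hk as [s [[Ls Es] [D1 D2]]].
  assert (D : in_D b s G).
  { iintro Z. apply (mp D2). rewrite <- Z. apply (mp (Eu s)). now rewrite <- Lu. }
  assert (D' := mp (proj1 (Hb s)) D). clear D.
  tdes D' as [n [Hn D]]. tdes D as [p [Hp D]]. tdes D as [i [Hi (A1 & A2 & A3 & A4)]].
  assert (Lm : le G (len s) m).
  { apply le_trans with (suc s); [apply len_le|]. now rewrite <- Lu. }
  destruct (Hg n) as [G1 G2].
  assert (KE : forall j, imp (fun G => lt G j (suc (sec a Zero n)))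
    (fun G => eqn G (entry s (Pair n j)) (nt (dist j (App g n)))) G).
  { intros j. iintro Hj. assert (Q := mp (A1 j) Hj). cbv beta in Q. rewrite Ls in Q.
    rewrite (mp (Es _) Q), (Hd _). now rewrite L_pair, K_pair. }
  assert (E : eqn G i (App g n)).
  { tdes (trichotomy G i (App g n)) as [T|[T|T]]; auto; falso.
    - tdes A3 as [A3|A3].
      + rewrite <- A3 in G1. exact (le_lt_absurd G1 T).
      + apply (mp A3). rewrite (mp (KE i) Hi).
        assert (N : nonzero (dist i (App g n)) G).
        { iintro N. exact (lt_neq T (proj1 (dist_0 _ _ _) N)). }
        tdes (nonzero_suc N) as [v V]. now rewrite V, nt_S.
    - assert (Q := mp (A2 _) T). cbv beta in Q.
      assert (Gn : lt G (App g n) (suc (sec a Zero n))) by now apply lt_S.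
      rewrite (mp (KE _) Gn), (proj2 (dist_0 G _ _) (reflexivity _)), nt_0 in Q.
      exact (suc_neq_0 Q). }
  assert (Hn' : lt G n m) by now apply lt_le_trans with (len s).
  assert (Hp' : lt G p m) by now apply lt_le_trans with (len s).
  apply (mp (mp (mp G2 Hn' p) Hp')). now rewrite <- E.
Qed.

Lemma ac_from_bar a G : loc (fun G => exists b,
  imp (ac_premise a) (bar (in_D b)) G /\ imp (fin_bar b) (ac_conclusion a) G) G.
Proof.
  tdes (char_in_D (char_decided a) G) as [b Hb]. here. exists b. split; iintro H.
  - exact (bar_decided Hb H).
  - exact (choice_of_fin_bar Hb H).
Qed.

(** ** From choice to the fan theorem *)

Lemma lt_two_cases G t : lt G t two ->
  loc (fun G => eqn G t Zero \/ eqn G t one) G.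
Proof.
  intros H. tdes (lt_S_cases H) as [H'|H']; [|here; now right].
  tdes (lt_S_cases H') as [H2|H2]; [falso; exact (lt_0_absurd H2)|here; now left].
Qed.

Lemma sg_lt_two G t : lt G (sg t) two.
Proof.
  ncase t as [E|[u E]]; rewrite E.
  - rewrite sg_0. apply zero_lt_S.
  - rewrite sg_S. apply le_refl.
Qed.

Lemma sg_bit G t : lt G t two -> eqn G (sg t) t.
Proof.
  intros H. tdes (lt_two_cases H) as [E|E]; rewrite E; [apply sg_0|apply sg_S].
Qed.

Definition children_sum : prf 1 :=
  pRec pZero (C2 pAdd arg1 (C2 pAdd (C2 pConcat arg0 (C1 pSingle pZero))
                                    (C2 pConcat arg0 (C1 pSingle pOne)))).
(** Above all codes of binary sequences of length [m], as shown in
    [bin_codes_ex].  Summing over all candidates for the parent avoids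
    a comparison of the codes of different sequences. *)
Definition level_bound : prf 1 := pRec pOne (C1 pSucc (C1 children_sum arg1)).
Definition csum t := Prf children_sum (t ::: vnil).
Definition bound t := Prf level_bound (t ::: vnil).
#[global] Hint Unfold csum bound : semdef.

Lemma csum_S t : eqv (csum (suc t))
  (add (csum t) (add (concat t (single Zero)) (concat t (single one)))).
Proof.
  intros G. unfold csum at 1, children_sum at 1.
  rewrite (eqv_in G (ax_eqv (ax_pRecS _ _ _ _))). fold children_sum.
  unfold csum, add, concat, single. prf_match.
Qed.

Lemma bound_0 : eqv (bound Zero) one.
Proof. prf_eval. Qed.

Lemma bound_S t : eqv (bound (suc t)) (suc (csum (bound t))).
Proof.
  intros G. unfold bound at 1, level_bound at 1.
  rewrite (eqv_in G (ax_eqv (ax_pRecS _ _ _ _))). fold level_bound.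
  unfold csum, bound. prf_match.
Qed.

Lemma child_le G y b : imp (fun G => lt G y b)
  (fun G => le G (add (concat y (single Zero)) (concat y (single one))) (csum b)) G.
Proof.
  induct b; iintro H.
  - falso. exact (lt_0_absurd H).
  - rewrite csum_S. tdes (lt_S_cases H) as [H'|H'].
    + apply le_trans with (csum b); [exact (mp IH H')|apply le_add_r].
    + rewrite H'. apply le_add_l.
Qed.

Lemma bin_codes_ex G c m : bin c G ->
  loc (fun G => exists y, lt G y (bound m) /\ codes c m y G) G.
Proof.
  intros Hc. induct m.
  - here. exists Zero. split; [rewrite bound_0; apply le_refl|apply codes_nil].
  - tdes IH as [y [Hy Ey]]. assert (B := mp (child_le G y (bound m)) Hy). cbv beta in B.
    here. exists (concat y (single (App c m))). split; [|now apply codes_snoc].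
    rewrite bound_S. apply lt_S. refine (le_trans _ B).
    tdes (lt_two_cases (Hc m)) as [E|E]; rewrite E; [apply le_add_r|apply le_add_l].
Qed.

Definition starts (s : term) (v : term -> term) : hprop := fun G =>
  forall i, imp (fun G => lt G i (len s)) (fun G => eqn G (entry s i) (v i)) G.
(** Entries of a node are read through [sg], so that every number is a binary
    node. *)
Definition through (x : term) (c : fterm) : hprop := fun G =>
  forall i, imp (fun G => lt G i (len x)) (fun G => eqn G (sg (entry x i)) (App c i)) G.
Definition secured (b : fterm) (x m : term) : hprop := fun G =>
  forall c, imp (fun G => bin c G /\ through x c G)
    (loc (fun G => exists s, lt G s m /\ (in_D b s G /\ starts s (App c) G))) G.
(** [x] may be longer or shorter than [y]; only common positions are compared. *)
Definition compatible (x y m : term) : hprop := fun G =>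
  eqn G (len y) m /\
  (forall i, imp (fun G => lt G i m) (fun G => lt G (entry y i) two) G) /\
  (forall i, imp (fun G => lt G i m) (imp (fun G => lt G i (len x))
    (fun G => eqn G (sg (entry x i)) (entry y i))) G).
Definition secured_dec (b : fterm) (x m : term) : hprop := fun G =>
  forall y, imp (fun G => lt G y (bound m)) (imp (compatible x y m)
    (loc (fun G => exists s, lt G s m /\ (in_D b s G /\ starts s (entry y) G)))) G.
#[global] Hint Unfold starts through secured compatible secured_dec : semdef.

Lemma len_le_bound G s m : lt G s m -> le G (len s) m.
Proof. intros H. apply le_trans with (suc s); [apply len_le|exact H]. Qed.

(** An initial part s < m of a sequence has length at most [m], so it is also an
    initial part of the node of length [m] on that sequence.  Conversely, a node
    [y] compatible with [x] lies on a binary sequence through [x], which takes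
    its values from [x] as far as possible and from [y] afterwards. *)
Lemma secured_iff b x m G : equi (secured_dec b x m) (secured b x m) G.
Proof.
  split; iintro H.
  - intros c. iintro [Hc Tc]. tdes (bin_codes_ex m Hc) as [y [By [Ly Ey]]].
    assert (C : compatible x y m G).
    { split; [auto|split].
      - intros i. iintro Hi. rewrite (mp (Ey i) Hi). apply Hc.
      - intros i. iintro Hi. iintro Hx. rewrite (mp (Ey i) Hi). exact (mp (Tc i) Hx). }
    assert (S := mp (mp (H y) By) C). tdes S as [s [Hs [Ds Is]]].
    here. exists s. split; auto. split; auto. intros i. iintro Hi.
    rewrite (mp (Is i) Hi). apply (mp (Ey i)).
    apply lt_le_trans with (len s); auto. now apply len_le_bound.
  - intros y. iintro By. iintro (Ly & Biny & Cy).
    tdes ((ltac:(comp) : Comp (fun i =>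
      ite (sub (suc i) (len x)) (sg (entry x i)) (sg (entry y i)))) G) as [c Hc].
    assert (V : forall i, loc (fun G =>
      (lt G i (len x) /\ eqn G (App c i) (sg (entry x i))) \/
      (le G (len x) i /\ eqn G (App c i) (sg (entry y i)))) G).
    { intros i. tdes (le_lt_dec G (len x) i) as [Hi|Hi]; here; [right|left];
        split; auto; rewrite (Hc i).
      - destruct (le_elim Hi) as [d Ed]. now rewrite Ed, <- add_S_r, sub_add_l, ite_S.
      - unfold lt, le in Hi. now rewrite Hi, ite_0. }
    assert (C : bin c G /\ through x c G).
    { split; intros i.
      - tdes (V i) as [[_ E]|[_ E]]; rewrite E; apply sg_lt_two.
      - iintro Hi. tdes (V i) as [[_ E]|[Hi' _]]; [now rewrite E|].
        falso. exact (le_lt_absurd Hi' Hi). }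
    assert (S := mp (H c) C). tdes S as [s [Hs [Ds Is]]].
    here. exists s. split; auto. split; auto. intros i. iintro Hi.
    rewrite (mp (Is i) Hi).
    assert (Hm : lt G i m).
    { apply lt_le_trans with (len s); auto. now apply len_le_bound. }
    tdes (V i) as [[Hi' E]|[_ E]]; rewrite E.
    + exact (mp (mp (Cy i) Hm) Hi').
    + apply sg_bit. exact (mp (Biny i) Hm).
Qed.

Lemma secured_mono b x m m' G : le G m m' -> secured b x m G -> secured b x m' G.
Proof.
  intros Hm H c. iintro C. assert (S := mp (H c) C). tdes S as [s [Hs S]].
  here. exists s. split; auto. now apply lt_le_trans with m.
Qed.

(** The comparison of the two children is frozen at stage [m]; since [secured]
    is monotone in [m], both values of [i] can occur only through the root. *)
Definition separated (b : fterm) (x i m : term) : hprop :=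
  loc (fun G => secured b Zero m G \/
    (secured b (concat x (single i)) m G /\
     imp (secured b (concat x (single (nt i))) m) bot G)).
#[global] Hint Unfold separated : semdef.

Lemma char_secured b x m : Comp x -> Comp m -> Char (fun q => secured b (x q) (m q)).
Proof.
  intros Hx Hm.
  apply char_equi with (fun q => secured_dec b (x q) (m q));
    [|intros; apply secured_iff].
  intros G. tdes (Hx G) as [cx Hcx]. tdes (Hm G) as [cm Hcm].
  assert (C : Char (fun q => secured_dec b (App cx q) (App cm q))).
  { unfold secured_dec, compatible, in_D, nonzero, starts. char. }
  tdes (C G) as [c Hc]. here. exists c. intros q. destruct (Hc q) as [H1 H2].
  split; iintro H.
  - apply (resp (fun x => secured_dec b x (m q)) ltac:(rep) (Hcx q)).
    apply (resp (fun m => secured_dec b (App cx q) m) ltac:(rep) (Hcm q)).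
    exact (mp H1 H).
  - apply (mp H2).
    apply (resp (fun x => secured_dec b x (App cm q)) ltac:(rep) (symmetry (Hcx q))).
    apply (resp (fun m => secured_dec b (x q) m) ltac:(rep) (symmetry (Hcm q))).
    exact H.
Qed.

Lemma char_separated b : Char (fun q => separated b (K (K q)) (L (K q)) (L q)).
Proof.
  unfold separated. apply char_or; [| |typeclasses eauto..].
  - apply char_secured; comp.
  - apply char_and; [apply char_secured; comp|].
    apply char_imp; [apply char_secured; comp|apply char_bot|typeclasses eauto..].
Qed.

Lemma entry_section G k n : eqn G (entry (concat (single k) n) Zero) k.
Proof.
  rewrite entry_concat_l; [apply entry_single|]. rewrite len_single. apply le_refl.
Qed.

Lemma entry_section_single G k q : eqn G (entry (concat (single k) (single q)) one) q.
Proof.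
  assert (E := entry_snoc G (single k) q). now rewrite len_single in E.
Qed.

Lemma separated_congr G b x i m x' i' : eqn G x x' -> eqn G i i' ->
  separated b x i m G -> separated b x' i' m G.
Proof.
  intros E E' H. apply (resp (fun i => separated b x' i m) ltac:(rep) E').
  exact (resp (fun x => separated b x i m) ltac:(rep) E H).
Qed.

(** The enumerating function ignores the sequence structure of its argument
    except for the first two entries: the first tells the two sections apart,
    the second carries the datum.  As <1> * <q> has second entry q, nothing is
    missed. *)
Lemma separated_enum b G : loc (fun G => exists a,
  (forall n, eqn G (sec a Zero n) one) /\
  forall x i, equi (in_E a (Pair x i))
    (loc (fun G => exists m, separated b x i m G)) G) G.
Proof.
  tdes (char_separated b G) as [c Hc].
  tdes ((ltac:(comp) : Comp (fun z => ite (entry z Zero) one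
    (ite (App c (entry z one)) (suc (K (entry z one))) Zero))) G) as [a Ha].
  here. exists a. split.
  - intros n. unfold sec. now rewrite (Ha _), entry_section, ite_0.
  - intros x i. split; iintro H.
    + unfold in_E in H. tdes H as [p Hp]. unfold sec in Hp.
      rewrite (Ha _), entry_section, ite_S in Hp.
      revert Hp. generalize (entry (concat (single one) p) one). intros q Hp.
      ncase (App c q) as [E|[u E]]; rewrite E in Hp.
      * rewrite ite_0 in Hp. apply suc_inj in Hp. here. exists (L q).
        refine (separated_congr (b := b) _ _ (mp (proj1 (Hc q)) E)).
        -- now rewrite Hp, K_pair.
        -- now rewrite Hp, L_pair.
      * rewrite ite_S in Hp. falso. exact (suc_neq_0 (symmetry Hp)).
    + tdes H as [m H]. here. exists (single (Pair (Pair x i) m)). unfold sec.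
      rewrite (Ha _), entry_section, ite_S, entry_section_single, K_pair.
      assert (S : separated b (K (K (Pair (Pair x i) m))) (L (K (Pair (Pair x i) m)))
        (L (Pair (Pair x i) m)) G).
      { apply (resp (fun m' => separated b (K (K (Pair (Pair x i) m)))
          (L (K (Pair (Pair x i) m))) m') ltac:(rep)
          (symmetry (L_pair (Pair x i) m G))).
        refine (separated_congr (b := b) _ _ H).
        - now rewrite !K_pair.
        - now rewrite K_pair, L_pair. }
      now rewrite (mp (proj2 (Hc _)) S), ite_0.
Qed.

(** The later of the two stages at which (n,0) and (n,1) appear records that the
    other child is not secured, although it was secured at the earlier stage. *)
Lemma fin_bar_of_separated b n G :
  (forall i, imp (fun G => le G i one)
    (loc (fun G => exists m, separated b n i m G)) G) ->
  fin_bar b G.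
Proof.
  intros H.
  (* The code of the empty sequence is 0. *)
  assert (R : loc (fun G => exists m, secured b Zero m G) G).
  { assert (H0 := mp (H Zero) (zero_le G one)). tdes H0 as [m0 H0].
    assert (H1 := mp (H one) (le_refl G one)). tdes H1 as [m1 H1].
    unfold separated in H0, H1.
    tdes H0 as [H0|[H0 N0]]; [here; now exists m0|].
    tdes H1 as [H1|[H1 N1]]; [here; now exists m1|].
    assert (E0 : eqn G (concat n (single (nt Zero))) (concat n (single one)))
      by now rewrite nt_0.
    assert (E1 : eqn G (concat n (single (nt one))) (concat n (single Zero)))
      by now rewrite nt_S.
    falso. tdes (le_lt_dec G m0 m1) as [M|M].
    - apply (mp N1). apply (resp (fun x => secured b x m1) ltac:(rep) (symmetry E1)).
      exact (secured_mono M H0).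
    - apply (mp N0). apply (resp (fun x => secured b x m0) ltac:(rep) (symmetry E0)).
      exact (secured_mono (lt_le M) H1). }
  tdes R as [m Hm]. tdes (codes_ex b m G) as [u [Lu Eu]].
  here. exists m. here. exists u. split; [now split|].
  intros c. iintro Hc.
  assert (C : bin c G /\ through Zero c G).
  { split; auto. intros i. iintro Hi. rewrite (proj1 (codes_nil G c)) in Hi.
    falso. exact (lt_0_absurd Hi). }
  assert (S := mp (Hm c) C). tdes S as [s [Hs [Ds Is]]].
  here. exists (len s). here. exists s. split; [split; [reflexivity|exact Is]|].
  split; [now rewrite Lu|]. iintro Z. apply (mp Ds). rewrite <- Z.
  symmetry. exact (mp (Eu s) Hs).
Qed.

Lemma through_snoc G x v c : through x c G -> eqn G (App c (len x)) (sg v) ->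
  through (concat x (single v)) c G.
Proof.
  intros H E i. iintro Hi. rewrite len_snoc in Hi.
  tdes (lt_S_cases Hi) as [Hi'|Hi'].
  - rewrite entry_concat_l by exact Hi'. exact (mp (H i) Hi').
  - now rewrite Hi', entry_snoc, E.
Qed.

(** A binary sequence through [x] passes through one of the two children. *)
Lemma secured_children G b x v m : lt G v two ->
  secured b (concat x (single v)) m G -> secured b (concat x (single (nt v))) m G ->
  secured b x m G.
Proof.
  intros Hv H1 H2 c. iintro [Hc Tc].
  assert (D : loc (fun G => eqn G (App c (len x)) (sg v) \/
    eqn G (App c (len x)) (sg (nt v))) G).
  { tdes (lt_two_cases Hv) as [E|E]; tdes (lt_two_cases (Hc (len x))) as [E'|E'];
      here; rewrite E, E', ?nt_0, ?nt_S, ?sg_0, ?sg_S; [left|right|right|left];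
      reflexivity. }
  tdes D as [D|D].
  - apply (mp (H1 c)). split; auto. now apply through_snoc.
  - apply (mp (H2 c)). split; auto. now apply through_snoc.
Qed.

(** The branch is the recursion x * <g(x)> from the empty sequence. *)
Lemma branch_ex g G : loc (fun G => exists r,
  eqn G (App r (Pair Zero Zero)) Zero /\
  forall j, eqn G (App r (Pair Zero (suc j)))
    (concat (App r (Pair Zero j)) (single (App g (App r (Pair Zero j)))))) G.
Proof.
  tdes ((ltac:(comp) : Comp (fun y => concat (L y) (single (App g (L y))))) G)
    as [d Hd].
  assert (A := closed_ax G ax_rec FZero d). cbn in A. tdes A as [r Hr].
  here. exists r. split.
  - rewrite (proj1 (Hr Zero Zero)). apply Zero_eq.
  - intros j. rewrite (proj2 (Hr Zero j)), (Hd _). now rewrite L_pair.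
Qed.

Lemma branch_entries (g r : fterm) G : eqn G (App r (Pair Zero Zero)) Zero ->
  (forall j, eqn G (App r (Pair Zero (suc j)))
    (concat (App r (Pair Zero j)) (single (App g (App r (Pair Zero j)))))) ->
  forall j, eqn G (len (App r (Pair Zero j))) j /\
    forall i, imp (fun G => lt G i j)
      (fun G => eqn G (entry (App r (Pair Zero j)) i) (App g (App r (Pair Zero i)))) G.
Proof.
  intros R0 RS j. induct j.
  - split; [now rewrite R0, (proj1 (codes_nil G FId))|].
    intros i. iintro H. falso. exact (lt_0_absurd H).
  - destruct IH as [I1 I2]. split; [now rewrite (RS j), len_snoc, I1|].
    intros i. iintro H. rewrite (RS j). tdes (lt_S_cases H) as [H'|H'].
    + rewrite entry_concat_l by now rewrite I1. exact (mp (I2 i) H').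
    + rewrite H'.
      assert (E := entry_snoc G (App r (Pair Zero j)) (App g (App r (Pair Zero j)))).
      now rewrite I1 in E.
Qed.

(** Going back along the branch: where [g] exceeds 1 there is nothing to prove;
    otherwise the sibling of the secured node is secured too, and then so is the
    parent, or it is not, and then the choice made at the parent is in E. *)
Lemma premise_of_secured (a b g r : fterm) G :
  (forall n, eqn G (sec a Zero n) one) ->
  (forall x i, equi (in_E a (Pair x i))
    (loc (fun G => exists m, separated b x i m G)) G) ->
  eqn G (App r (Pair Zero Zero)) Zero ->
  (forall j, eqn G (App r (Pair Zero (suc j)))
    (concat (App r (Pair Zero j)) (single (App g (App r (Pair Zero j)))))) ->
  forall j m, imp (secured b (App r (Pair Zero j)) m) (loc (fun G => exists n,
    imp (fun G => le G (App g n) (sec a Zero n)) (in_E a (Pair n (App g n))) G)) G.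
Proof.
  intros A0 A1 R0 RS j. induct j; intros m; iintro H.
  - here. exists Zero. iintro _. apply (mp (proj2 (A1 _ _))). here. exists m.
    here. left. exact (resp (fun x => secured b x m) ltac:(rep) R0 H).
  - assert (H1 := resp (fun x => secured b x m) ltac:(rep) (RS j) H). cbv beta in H1.
    revert IH H1. generalize (App r (Pair Zero j)). intros x IH H1.
    tdes (le_lt_dec G (App g x) one) as [Hx|Hx].
    + assert (C := char_secured b (comp_const (concat x (single (nt (App g x)))))
        (comp_const m)).
      tdes (char_dec C ltac:(typeclasses eauto) Zero G) as [D|D].
      * apply (mp (IH m)). apply (secured_children (v := App g x)); auto.
        now apply lt_S.
      * here. exists x. iintro _. apply (mp (proj2 (A1 _ _))). here. exists m.
        here. right. now split.
    + here. exists x. iintro Hx'. rewrite (A0 x) in Hx'. falso.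
      exact (le_lt_absurd Hx' Hx).
Qed.

(** The branch of [g], with its entries cut down to bits, meets the bar; the node
    reached is secured. *)
Lemma bar_from_ac b G : loc (fun G => exists a,
  imp (bar (in_D b)) (ac_premise a) G /\ imp (ac_conclusion a) (fin_bar b) G) G.
Proof.
  tdes (separated_enum b G) as [a [A0 A1]]. here. exists a. split; iintro H.
  - intros g. tdes (branch_ex g G) as [r [R0 RS]].
    tdes ((ltac:(comp) : Comp (fun j => sg (App g (App r (Pair Zero j))))) G)
      as [d Hd].
    assert (Bd : bin d G).
    { intros n. rewrite (Hd n). apply sg_lt_two. }
    assert (S := mp (H d) Bd). tdes S as [k S]. tdes S as [s [[Ls Es] Ds]].
    destruct (branch_entries R0 RS k) as [Lk Ek].
    apply (mp (premise_of_secured A0 A1 R0 RS k (suc s))).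
    intros c. iintro [Hc Tc]. here. exists s. split; [apply le_refl|].
    split; auto. intros i. iintro Hi. rewrite Ls in Hi.
    assert (Hi' : lt G i (len (App r (Pair Zero k)))) by now rewrite Lk.
    rewrite (mp (Es i) Hi), (Hd i), <- (mp (Tc i) Hi').
    now rewrite (mp (Ek i) Hi).
  - unfold ac_conclusion in H. tdes H as [n Hn].
    apply fin_bar_of_separated with n. intros i. iintro Hi.
    apply (mp (proj1 (A1 n i))). apply (mp (Hn i)). now rewrite (A0 n).
Qed.

Theorem theorem5p6 :
  BIM_proves (FT <--> revAC)%fm /\ BIM_proves (notFT <--> notRevAC)%fm.
Proof.
  (* [sat] and the named binders compute away. *)
  assert (FT_sem : forall G, sat (close FT) Var FVar G <->
    (forall b, imp (bar (in_D b)) (fin_bar b) G)) by reflexivity.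
  assert (AC_sem : forall G, sat (close revAC) Var FVar G <->
    (forall a, imp (ac_premise a) (ac_conclusion a) G)) by reflexivity.
  assert (notFT_sem : forall G, sat (close notFT) Var FVar G <->
    loc (fun G => exists b, bar (in_D b) G /\
      forall m, imp (loc (fun G => exists u, codes b m u G /\ bar (in_Dnum u) G))
                    bot G) G) by reflexivity.
  assert (notAC_sem : forall G, sat (close notRevAC) Var FVar G <->
    loc (fun G => exists a, ac_premise a G /\ imp (ac_conclusion a) bot G) G)
    by reflexivity.
  split; apply (proj1 (sat_closed _ nil)); split; constructor; intros G _ H.
  - apply AC_sem. apply FT_sem in H. intros a. iintro P.
    tdes (ac_from_bar a G) as [b [H1 H2]].
    exact (mp H2 (mp (H b) (mp H1 P))).
  - apply FT_sem. apply AC_sem in H. intros b. iintro B.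
    tdes (bar_from_ac b G) as [a [H1 H2]].
    exact (mp H2 (mp (H a) (mp H1 B))).
  - apply notAC_sem. apply notFT_sem in H. tdes H as [b [B N]].
    tdes (bar_from_ac b G) as [a [H1 H2]]. here. exists a.
    split; [exact (mp H1 B)|]. iintro C. assert (F := mp H2 C).
    tdes F as [m F]. exact (mp (N m) F).
  - apply notFT_sem. apply notAC_sem in H. tdes H as [a [P N]].
    tdes (ac_from_bar a G) as [b [H1 H2]]. here. exists b.
    split; [exact (mp H1 P)|]. intros m. iintro F. apply (mp N), (mp H2).
    here. now exists m.
Qed.
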